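(* Let $n\ge1$. (a) For each projective compactification $[\mathbb E_n]_\theta$ and each point $A\in[\mathbb E_n]_\theta$, there exists a meromorphic curve $X(z)\in\mathbb E_n$ whose limit in $[\mathbb E_n]_\theta$ is $A$. (b) If the limits of two meromorphic curves $X_1(z)$ and $X_2(z)$ in the sea urchin coincide, then their limits in every projective compactification coincide. (c) If the limits of two meromorphic curves $X_1(z)$ and $X_2(z)$ in the sea urchin are different, then their limits in some projective compactification $[\mathbb E_n]_\theta$ are different.
   Context: $\mathbb E_n$ is the space of real positive definite symmetric $n\times n$ matrices, with $\mathrm{GL}(n,\mathbb R)$ acting by $X\mapsto gXg^\top$ and the invariant Riemannian metric $ds^2=\mathrm{tr}(dX\,X^{-1}\,dX\,X^{-1})$, with distance $\rho$. Its nonconstant geodesics are the curves $g\,\mathrm{diag}(e^{\varphi_1t},\dots,e^{\varphi_nt})g^\top$, $g\in\mathrm{GL}(n,\mathbb R)$, $\varphi\in\mathbb R^n\setminus0$; geodesics are directed and considered up to substitutions $t\mapsto at+b$, $a>0$. The null pencil $\Pi^{nul}_\mu$ of a geodesic $\mu$ is the set of geodesics $\nu$ such that $\lim_{t\to+\infty}\inf_{s\ge0}\rho(\mu(t),\nu(s))=0$; this is an equivalence relation on geodesics. Sea urchin. The sea urchin is the set $\mathbb E_n$ together with the boundary consisting of all null pencils of geodesics $g\,\mathrm{diag}(e^{\varphi_jt})g^\top$ whose velocities $\varphi_1\ge\dots\ge\varphi_n$ can be taken to be integers. Meromorphic curves. A meromorphic curve in $\mathbb E_n$ is a map $z\mapsto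 X(z)\in\mathbb E_n$, $z\in(0,\epsilon)$, such that each matrix element has a convergent Laurent expansion $x_{ij}(z)=z^{-k}(a_0+a_1z+a_2z^2+\dots)$. It admits a representation $X(z)=g(z)\,\mathrm{diag}(z^{-k_1},\dots,z^{-k_n})\,g(z)^\top$ with integers $k_1\ge\dots\ge k_n$, $g$ a real analytic matrix function near $0$, $g(0)$ invertible. Its limit in the sea urchin is the null pencil of the geodesic $g(0)\,\mathrm{diag}(e^{k_1t},\dots,e^{k_nt})\,g(0)^\top$ (if all $k_j=0$, the limit is the point $g(0)g(0)^\top\in\mathbb E_n$); it does not depend on the representation. Projective compactifications. Let $\rho_{\mathbf m}$ be the irreducible polynomial representation of $\mathrm{GL}(n,\mathbb R)$ with highest weight $\mathbf m: m_1\ge m_2\ge\dots\ge m_n$, $m_j\in\mathbb Z$. It contains a nonzero $\mathrm O(n)$-invariant vector iff all $m_j$ are even, and then this vector $q_{\mathbf m}$ is unique up to a scalar. Let $\theta=\bigoplus_\tau\rho_{\mathbf m^\tau}$ be a finite (nonempty) direct sum with all entries of all $\mathbf m^\tau$ even, $H$ its space, $h=\bigoplus_\tau q_{\mathbf m^\tau}\in H$. The projective compactification $[\mathbb E_n]_\theta$ is the closure of the $\mathrm{GL}(n,\mathbb R)$-orbit of the line of $h$ in the projective space $\mathbb PH$. The point $X=gg^\top\in\mathbb E_n$ is sent to the point $[\theta(g)h]\in\mathbb PH$, and the limit of a meromorphic curve $X(z)$ in $[\mathbb E_n]_\theta$ is the limit as $z\to+0$ of the image of $X(z)$ in $\mathbb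 PH$ (this limit always exists). *)

(* Defs.v *)
From HB Require Import structures.
From mathcomp Require Import all_boot all_order all_algebra.
From mathcomp Require Import all_classical all_reals all_analysis.
(* Not imported: the notations of mpoly clash with those of analysis. *)
From mathcomp Require mpoly.

Set Implicit Arguments.
Unset Strict Implicit.
Unset Printing Implicit Defensive.

Import Order.TTheory GRing.Theory Num.Theory.
Import numFieldNormedType.Exports.

Local Open Scope classical_set_scope.
Local Open Scope ring_scope.

Section SymmetricSpace.
Variables (R : realType) (n : nat).
Implicit Types (X Y g : 'M[R]_n) (mu nu gamma : R -> 'M[R]_n).

Definition posdef X : Prop :=
  X^T = X /\ forall v : 'cV[R]_n, v != 0 -> 0 < (v^T *m X *m v) 0 0.

(* A C^1 curve on [0, 1] extends to a C^1 curve on the line, so the curves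
   below are taken to be C^1 on all of R and are constrained on [0, 1] only. *)
Definition path_between X Y gamma : Prop :=
  [/\ forall t, derivable gamma t 1,
      continuous (derive1 gamma),
      forall t, 0 <= t <= 1 -> posdef (gamma t)
    & gamma 0 = X /\ gamma 1 = Y].

(* The speed is the norm of the metric ds^2 = tr (dX X^-1 dX X^-1). *)
Definition speed gamma (t : R) : R :=
  Num.sqrt (\tr (derive1 gamma t *m invmx (gamma t) *m derive1 gamma t
                 *m invmx (gamma t))).

Definition path_length gamma : R :=
  \int[lebesgue_measure]_(t in `[0, 1]) speed gamma t.

Definition dist X Y : R :=
  inf [set path_length gamma | gamma in path_between X Y].

Definition geodesic_curve g (phi : 'rV[R]_n) : R -> 'M[R]_n :=
  fun t => g *m diag_mx (\row_i expR (phi 0 i * t)) *m g^T.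

(* A directed geodesic is the set of its parametrizations. *)
Definition reparam_class mu : set (R -> 'M[R]_n) :=
  [set nu | exists a b : R, 0 < a /\ nu = fun t => mu (a * t + b)].

Definition geodesic_of g (phi : 'rV[R]_n) : set (R -> 'M[R]_n) :=
  reparam_class (geodesic_curve g phi).

Definition is_geodesic (M : set (R -> 'M[R]_n)) : Prop :=
  exists g (phi : 'rV[R]_n),
    [/\ g \in unitmx, phi != 0 & M = geodesic_of g phi].

Definition null_asymptotic mu nu : Prop :=
  inf [set dist (mu t) (nu s) | s in [set s | 0 <= s]] @[t --> +oo] --> (0 : R).

(* Replacing the parametrizations by others of the same directed geodesics does
   not affect null_asymptotic, so any choice of representatives will do. *)
Definition null_pencil (M : set (R -> 'M[R]_n)) : set (set (R -> 'M[R]_n)) :=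
  [set N | is_geodesic N /\
           exists mu nu, [/\ M mu, N nu & null_asymptotic mu nu]].

Inductive sea_point : Type :=
| Interior of 'M[R]_n
| Boundary of set (set (R -> 'M[R]_n)).

Definition int_row (k : 'I_n -> int) : 'rV[R]_n := \row_i (k i)%:~R.

Definition nonincreasing_wt (k : 'I_n -> int) : Prop :=
  forall i j : 'I_n, (i <= j)%N -> k j <= k i.

Definition sea_urchin : set sea_point := [set p |
  (exists2 X, posdef X & p = Interior X) \/
  (exists g k, [/\ g \in unitmx, nonincreasing_wt k, int_row k != 0
                 & p = Boundary (null_pencil (geodesic_of g (int_row k)))])].

(* Curves z |-> X(z) are considered as germs at 0^+; their values elsewhere
   are irrelevant. *)
Definition meromorphic_at0 (f : R -> R) : Prop :=
  exists (k : int) (a : R^nat),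
    \forall z \near 0^'+, pseries a z @ \oo --> z ^ k * f z.

Definition analytic_at0 (f : R -> R) : Prop :=
  exists a : R^nat, \forall z \near 0, pseries a z @ \oo --> f z.

Definition meromorphic_curve (X : R -> 'M[R]_n) : Prop :=
  (\forall z \near 0^'+, posdef (X z)) /\
  (forall i j, meromorphic_at0 (fun z => X z i j)).

Definition diagonalized_by (X : R -> 'M[R]_n) (g : R -> 'M[R]_n)
    (k : 'I_n -> int) : Prop :=
  [/\ nonincreasing_wt k,
      forall i j, analytic_at0 (fun z => g z i j),
      g 0 \in unitmx
    & \forall z \near 0^'+,
        X z = g z *m diag_mx (\row_i z ^ (- k i)) *m (g z)^T].

Definition sea_limit (X : R -> 'M[R]_n) (p : sea_point) : Prop :=
  sea_urchin p /\
  exists (g : R -> 'M[R]_n) (k : 'I_n -> int), diagonalized_by X g k /\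
    (((forall i, k i = 0) /\ p = Interior (g 0 *m (g 0)^T)) \/
     (~ (forall i, k i = 0) /\
      p = Boundary (null_pencil (geodesic_of (g 0) (int_row k))))).

End SymmetricSpace.

(* Representations of GL(n, R) are functions on all n x n matrices whose values
   matter only on unitmx. *)
Section Representations.
Variables (R : realType) (n : nat).

Definition is_rep d (rho : 'M[R]_n -> 'M[R]_d) : Prop :=
  rho 1%:M = 1%:M /\
  {in unitmx &, forall g h, rho (g *m h) = rho g *m rho h}.

(* Since the highest weights m have arbitrary integer entries, the matrix
   elements are polynomial in the g_ij and det(g)^-1. *)
Definition polynomial_rep d (rho : 'M[R]_n -> 'M[R]_d) : Prop :=
  exists (N : nat) (P : 'I_d -> 'I_d -> mpoly.mpoly (n * n) R),
    {in unitmx, forall g a b,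
      \det g ^+ N * rho g a b = mpoly.meval (fun l => mxvec g 0 l) (P a b)}.

Definition irreducible_rep d (rho : 'M[R]_n -> 'M[R]_d) : Prop :=
  (0 < d)%N /\
  forall U : {vspace 'cV[R]_d},
    {in unitmx, forall g, {in U, forall v, rho g *m v \in U}} ->
    U = 0%VS \/ U = fullv.

(* b ranges over the invertible upper triangular matrices. *)
Definition highest_weight d (rho : 'M[R]_n -> 'M[R]_d) (m : 'I_n -> int) : Prop :=
  exists2 v : 'cV[R]_d, v != 0 &
    forall b, b \in unitmx -> is_trig_mx b^T ->
      rho b *m v = (\prod_i b i i ^ m i) *: v.

Record spherical_irrep := SphericalIrrep {
  si_dim : nat;
  si_rep : 'M[R]_n -> 'M[R]_si_dim;
  si_weight : 'I_n -> int;
  si_vec : 'cV[R]_si_dim;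
  si_isrep : is_rep si_rep;
  si_poly : polynomial_rep si_rep;
  si_irr : irreducible_rep si_rep;
  si_noninc : nonincreasing_wt si_weight;
  si_hw : highest_weight si_rep si_weight;
  si_even : forall j, (2 %| si_weight j)%Z;
  si_vec_neq0 : si_vec != 0;
  si_vec_inv : forall k, k *m k^T = 1%:M -> si_rep k *m si_vec = si_vec
}.

End Representations.

(* A point of the projective space of 'cV_D is a 1-dimensional subspace, the
   topology being the quotient topology from 'cV_D minus 0. *)
Section ProjectiveSpace.
Variables (R : realType) (D : nat).

Definition proj_space : set {vspace 'cV[R]_D} := [set L | \dim L = 1%N].

Definition pspace_open (U : set {vspace 'cV[R]_D}) : Prop :=
  open [set v : 'cV[R]_D | v != 0 /\ U <[v]>%VS].

Definition pspace_closure (S : set {vspace 'cV[R]_D}) : set {vspace 'cV[R]_D} :=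
  [set A | proj_space A /\
           forall U, pspace_open U -> U A -> (S `&` U) !=set0].

Definition pspace_cvg (F : R -> {vspace 'cV[R]_D}) (A : {vspace 'cV[R]_D}) : Prop :=
  proj_space A /\
  forall U, pspace_open U -> U A -> \forall z \near 0^'+, U (F z).

End ProjectiveSpace.

Section ProjectiveCompactification.
Variables (R : realType) (n p : nat) (theta : 'I_p -> spherical_irrep R n).

Definition sum_dim : nat := (\sum_(tau < p) si_dim (theta tau))%N.

Definition sum_rep (g : 'M[R]_n) : 'M[R]_sum_dim :=
  \mxdiag_(tau < p) si_rep (theta tau) g.

Definition sum_vec : 'cV[R]_sum_dim := \mxcol_(tau < p) si_vec (theta tau).

Definition orbit_point (g : 'M[R]_n) : {vspace 'cV[R]_sum_dim} :=
  <[sum_rep g *m sum_vec]>%VS.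

Definition compactification : set {vspace 'cV[R]_sum_dim} :=
  pspace_closure [set orbit_point g | g in [set g | g \in unitmx]].

(* The result does not depend on the chosen g with X = g g^T, because sum_vec
   is O(n)-invariant. *)
Definition proj_embed (X : 'M[R]_n) : {vspace 'cV[R]_sum_dim} :=
  orbit_point (xget 1%:M [set g | g \in unitmx /\ X = g *m g^T]).

Definition proj_limit (X : R -> 'M[R]_n) (A : {vspace 'cV[R]_sum_dim}) : Prop :=
  pspace_cvg (fun z => proj_embed (X z)) A.

End ProjectiveCompactification.

Arguments compactification {R n p} theta _.
Arguments proj_limit {R n p} theta X A.

(* Main.v *)
Require Import Defs.
From HB Require Import structures.
From mathcomp Require Import all_boot all_order all_algebra.
From mathcomp Require Import fingroup perm.
From mathcomp Require Import all_classical all_reals all_analysis.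
From mathcomp Require Import ring lra.
From mathcomp Require Import (canonicals) mpoly.

Set Implicit Arguments.
Unset Strict Implicit.
Unset Printing Implicit Defensive.

Import Order.TTheory GRing.Theory Num.Theory.
Import numFieldNormedType.Exports.

Local Open Scope classical_set_scope.
Local Open Scope ring_scope.

(** The null pencil of a geodesic mu is its class for the relation "mu(t) and
    nu(at+b), for some a > 0 and b, are eventually e^d-comparable as quadratic forms
    for every d > 0", because X |-> ln (v^T X v) is 1-Lipschitz for the metric and, conversely, the
    straight segment joining comparable forms is short.

    (a) Write points of the orbit as K_m e^{s_m} h with K_m bounded, and let theta(e^s) h
    be a sum of exponentials e^{<lam_i,s>} h_i with the least number of terms.
    Along an ultrafilter the terms of maximal growth form a face; the face is also
    cut out by an integral direction k, so that z |-> K diag(z^{-k}) K^T up to a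
    constant has the same limit.  Minimality makes the limit vector nonzero.

    (b) For comparable geodesics x_t x_t^T and y_t y_t^T the matrix x_t^{-1} y_t is a lower
    triangular matrix tending to 1 times an orthogonal one, and conjugation by the
    dominant torus element of x_t only contracts it.

    (c) The square of the kernel prod_j Delta_j(x^T y)^{c_j}, Delta_j being the leading
    principal minors, spans an irreducible representation of highest weight
    sum_j 2 c_j omega_j, whose O(n)-invariant vector is x |-> prod_j Delta_j(x^T x)^{c_j}.
    Equal limits in the sums of two of these make the weights proportional and the
    leading coefficients of all Delta_j(g^T X(z) g) equal up to a character; this forces
    the two limiting geodesics to be comparable in this sense. *)

(** * Quadratic forms and entrywise limits *)

(** Only two inequalities on the distance are used, never its value: a lower bound by logarithms of
    forms, and an upper bound that tends to 0 with the comparison exponent. The obstacle in (a) is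
    that the s_m point in arbitrary real directions while a meromorphic curve allows only integral
    exponents. It disappears because a face is described by finitely many integral weights, and the
    part of s_m that converges against them survives as a constant factor. In (c) a single
    irreducible summand is not enough: its limit line forgets both the growth rate and the scalar.
    Two summands inside one line share them, so they can be compared. The representations are built
    from kernels because linear functionals of a limit vector are then limits of explicit minors,
    and because irreducibility follows from contraction by a torus. *)

Section QuadraticForms.
Variable R : rcfType.

Definition qf n (X : 'M[R]_n) (v : 'cV[R]_n) : R := (v^T *m X *m v) 0 0.
Definition sqn n (v : 'cV[R]_n) : R := \sum_i v i 0 ^+ 2.
(** Convertible to [posdef], but available over every real closed field. *)
Definition pdef n (X : 'M[R]_n) : Prop :=
  X^T = X /\ forall v, v != 0 -> 0 < qf X v.

Lemma qfE n (X : 'M[R]_n) v : qf X v = \sum_i \sum_j v i 0 * X i j * v j 0.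
Proof.
rewrite /qf mxE exchange_big /=; apply: eq_bigr => j _.
by rewrite !mxE mulr_suml; apply: eq_bigr => i _; rewrite mxE.
Qed.

Lemma qf1 n v : qf (1%:M : 'M[R]_n) v = sqn v.
Proof. by rewrite /qf mulmx1 mxE; apply: eq_bigr => i _; rewrite mxE expr2. Qed.

Lemma qf_conj n (g X : 'M[R]_n) v : qf (g *m X *m g^T) v = qf X (g^T *m v).
Proof. by rewrite /qf trmx_mul trmxK !mulmxA. Qed.

Lemma qfD n (X Y : 'M[R]_n) v : qf (X + Y) v = qf X v + qf Y v.
Proof. by rewrite /qf mulmxDr mulmxDl mxE. Qed.

Lemma qfN n (X : 'M[R]_n) v : qf (- X) v = - qf X v.
Proof. by rewrite /qf mulmxN mulNmx mxE. Qed.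

Lemma qfZ n c (X : 'M[R]_n) v : qf (c *: X) v = c * qf X v.
Proof. by rewrite /qf -scalemxAr -scalemxAl mxE. Qed.

Lemma qf_diag n (d : 'rV[R]_n) v : qf (diag_mx d) v = \sum_i d 0 i * v i 0 ^+ 2.
Proof.
rewrite qfE; apply: eq_bigr => i _; rewrite (bigD1 i) //= big1 => [|j ji].
  by rewrite mxE eqxx mulr1n addr0; ring.
by rewrite mxE eq_sym (negPf ji) mulr0 mul0r.
Qed.

Lemma qf0 n (X : 'M[R]_n) : qf X 0 = 0.
Proof. by rewrite /qf mulmx0 mxE. Qed.

Lemma sqn_ge0 n (v : 'cV[R]_n) : 0 <= sqn v.
Proof. by apply: sumr_ge0 => i _; rewrite sqr_ge0. Qed.

Lemma sqn_gt0 n (v : 'cV[R]_n) : v != 0 -> 0 < sqn v.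
Proof.
move=> v0; rewrite lt_def sqn_ge0 andbT; apply: contraNneq v0 => /eqP.
rewrite psumr_eq0 => [/allP h|i _]; last by rewrite sqr_ge0.
apply/eqP/matrixP => i j; rewrite ord1 mxE; apply/eqP.
by have := h i; rewrite mem_index_enum => /(_ isT); rewrite sqrf_eq0.
Qed.

Lemma unitmx_mulv_neq0 n (g : 'M[R]_n) (v : 'cV[R]_n) :
  g \in unitmx -> v != 0 -> g *m v != 0.
Proof.
move=> ug; apply: contraNneq => gv0.
by rewrite -(mul1mx v) -(mulVmx ug) -mulmxA gv0 mulmx0.
Qed.

Lemma pdef_conj n (g X : 'M[R]_n) : g \in unitmx -> pdef X -> pdef (g *m X *m g^T).
Proof.
move=> ug [sX pX]; split; first by rewrite !trmx_mul trmxK sX mulmxA.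
move=> v v0; rewrite qf_conj; apply: pX.
by rewrite unitmx_mulv_neq0 ?unitmx_tr.
Qed.

Lemma pdef_conjV n (g X : 'M[R]_n) : g \in unitmx -> pdef (g *m X *m g^T) -> pdef X.
Proof.
move=> ug h; have ug' : invmx g \in unitmx by rewrite unitmx_inv.
have := pdef_conj ug' h.
by rewrite !mulmxA mulVmx // mul1mx -mulmxA -trmx_mul mulVmx // trmx1 mulmx1.
Qed.

Lemma pdef_diag n (d : 'rV[R]_n) : (forall i, 0 < d 0 i) -> pdef (diag_mx d).
Proof.
move=> d0; split; first exact: tr_diag_mx.
move=> v v0; rewrite qf_diag lt_def; apply/andP; split; last first.
  by apply: sumr_ge0 => i _; rewrite mulr_ge0 ?sqr_ge0 // ltW.
apply: contraNneq v0 => /eqP; rewrite psumr_eq0 => [/allP h|i _]; last first.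
  by rewrite mulr_ge0 ?sqr_ge0 // ltW.
apply/eqP/matrixP => i j; rewrite ord1 mxE; apply/eqP.
have := h i; rewrite mem_index_enum => /(_ isT); rewrite mulf_eq0 sqrf_eq0.
by rewrite gt_eqF.
Qed.

Lemma pdef1 n : pdef (1%:M : 'M[R]_n).
Proof. by split; [rewrite trmx1|move=> v v0; rewrite qf1 sqn_gt0]. Qed.

Lemma pdef_mulT n (g : 'M[R]_n) : g \in unitmx -> pdef (g *m g^T).
Proof. by move=> ug; rewrite -[X in X *m _]mulmx1; apply/pdef_conj/pdef1. Qed.

Lemma qf_delta n (X : 'M[R]_n) i : qf X (delta_mx i 0) = X i i.
Proof. by rewrite /qf trmx_delta -rowE -colE !mxE. Qed.

Lemma pdef_diag_gt0 n (X : 'M[R]_n) i : pdef X -> 0 < X i i.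
Proof.
case=> _ pX; rewrite -qf_delta; apply: pX; apply/eqP => /matrixP /(_ i 0).
by rewrite !mxE !eqxx /= => /eqP; rewrite oner_eq0.
Qed.

(** One step of elimination with pivot [a]. Congruence by the unipotent [L] preserves positivity, so
    the complementary block [S] inherits it; this is the induction step of both factorizations
    below. *)
Lemma pdef_schur n (X : 'M[R]_(1 + n)) : pdef X ->
  let a := X 0 0 in let b := dlsubmx X in
  let S := drsubmx X - a^-1 *: (b *m b^T) in
  let L : 'M[R]_(1 + n) := block_mx 1%:M 0 (a^-1 *: b) 1%:M in
  [/\ 0 < a, pdef S & X = L *m block_mx a%:M 0 0 S *m L^T].
Proof.
move=> pX a b S L; have a0 : 0 < a by exact: pdef_diag_gt0.
have XE : X = L *m block_mx a%:M 0 0 S *m L^T.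
  have sX : X^T = X by case: pX.
  rewrite /L tr_block_mx !mulmx_block !trmx1 !trmx0 !mul0mx !mulmx0 !mul1mx !mulmx1.
  rewrite !addr0 !add0r mul_mx_scalar linearZ /= mul_scalar_mx -!scalemxAl -scalemxAr.
  rewrite !scalerA !(divff (lt0r_neq0 a0)) mul1r !scale1r.
  have -> : a^-1 *: (b *m b^T) + S = drsubmx X by rewrite /S addrC subrK.
  rewrite -{1}(submxK X); congr block_mx; last by rewrite /b trmx_dlsub sX.
  apply/matrixP => i j; rewrite !ord1 !mxE eqxx mulr1n /a; congr (X _ _); exact: val_inj.
split=> //; have uL : L \in unitmx by rewrite unitmxE /L det_lblock !det1 mulr1 unitr1.
have [sY pY] : pdef (block_mx a%:M 0 0 S : 'M[R]_(1 + n)).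
  by apply: (pdef_conjV uL); rewrite -XE.
split; first by move: sY; rewrite tr_block_mx => /eq_block_mx [].
move=> w w0; have := pY (col_mx 0 w); rewrite /qf tr_col_mx mul_row_block mul_row_col.
rewrite trmx0 !mul0mx !mulmx0 !add0r; apply.
by apply: contraNneq w0 => /eqP; rewrite col_mx_eq0 => /andP[].
Qed.

Lemma cholesky n (X : 'M[R]_n) : pdef X ->
  exists p : 'M[R]_n, [/\ is_trig_mx p, forall i, 0 < p i i & X = p *m p^T].
Proof.
elim: n X => [|n IHn]; [move=> X pX|rewrite -[n.+1]/(1 + n)%N => X pX].
  by exists 0; split=> [|[]//|]; [apply/is_trig_mxP; case|apply/matrixP; case].
have [a0 pS XE] := pdef_schur pX.
have [p [tp p0 SE]] := IHn _ pS.
set a := X 0 0 in a0 XE SE *; set b := dlsubmx X in XE SE *.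
pose q : 'M[R]_(1 + n) := block_mx (Num.sqrt a)%:M 0 ((Num.sqrt a / a) *: b) p.
have tq : is_trig_mx q.
  rewrite /q is_trig_block_mx // eqxx tp andbT /=; apply/is_trig_mxP => i j.
  by rewrite !ord1.
exists q; split=> //; rewrite /q.
- move=> i; case: (split_ordP i) => j ->; last by rewrite block_mxEdr.
  by rewrite block_mxEul !ord1 mxE mulr1n sqrtr_gt0.
- rewrite {1}XE SE; set s := Num.sqrt a.
  have s2 : s * s = a by rewrite -expr2 sqr_sqrtr // ltW.
  rewrite !tr_block_mx !mulmx_block !trmx1 !trmx0 !mul0mx !mulmx0 !mul1mx !mulmx1.
  have tZ c : (c *: b)^T = c *: b^T by rewrite linearZ.
  rewrite !tr_scalar_mx !addr0 !add0r !tZ !mul_scalar_mx !mul_mx_scalar !scalerA.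
  rewrite -!scalemxAl -!scalemxAr !scalerA scale_scalar_mx s2.
  have [an0 sn0] : a != 0 /\ s != 0 by rewrite !gt_eqF // sqrtr_gt0.
  by congr (block_mx _ (_ *: _) (_ *: _) (_ *: _ + _)); rewrite -?s2; field.
Qed.


(** A substitute for the orthogonal factor of a polar decomposition that needs no eigenvalues:
    entries bounded by 1 and a determinant of square 1 confine [g] to a compact set of invertible
    matrices. The bound on the entries comes from pivoting on a largest diagonal entry. *)
Lemma pivoted_ldl n (X : 'M[R]_n) : pdef X ->
  exists (g : 'M[R]_n) (d : 'rV[R]_n),
    [/\ forall i j, `|g i j| <= 1, \det g ^+ 2 = 1, forall i, 0 < d 0 i
      & X = g *m diag_mx d *m g^T].
Proof.
elim: n X => [|n IHn]; [move=> X pX|rewrite -[n.+1]/(1 + n)%N => X pX].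
  exists 0, 0; split=> [[]//||[]//|]; first by rewrite det_mx00 expr1n.
  by apply/matrixP; case.
have [i0 _ i0max] : extremum_spec >=%R predT (fun i => X i i)
  [arg max_(i > ord0) X i i]%O by exact: arg_maxP.
pose P : 'M[R]_(1 + n) := perm_mx (tperm ord0 i0).
have PP : P^T *m P = 1%:M by rewrite /P tr_perm_mx -perm_mxM mulVg perm_mx1.
have uP : P \in unitmx by exact: unitmx_perm.
have [Y YX] : exists Y : 'M[R]_(1 + n), Y = P *m X *m P^T by exists (P *m X *m P^T).
have YE i j : Y i j = X (tperm ord0 i0 i) (tperm ord0 i0 j).
  by rewrite YX /P tr_perm_mx -col_permE -row_permE !mxE.
have pY : pdef Y by rewrite YX; exact: pdef_conj.
have [a0 pS YS] := pdef_schur pY.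
have [g [d [g1 dg d0 SE]]] := IHn _ pS.
set a := Y 0 0 in a0 YS SE pS *; set b := dlsubmx Y in YS SE pS *.
have aE : a = X i0 i0 by rewrite /a YE tpermL.
(* The Schur complement has positive diagonal, so b_i^2 < a Y_ii, and Y_ii <= a by the choice of the
   pivot. *)
have ba i : `|b i 0| <= a.
  have h : a^-1 * b i 0 ^+ 2 < Y (rshift 1 i) (rshift 1 i).
    have := pdef_diag_gt0 i pS.
    set z := (X in 0 < X -> _).
    have zE : z = Y (rshift 1 i) (rshift 1 i) - a^-1 * b i 0 ^+ 2; last by rewrite zE subr_gt0.
    by rewrite /z /b !mxE big_ord1 !mxE expr2.
  have Yia : Y (rshift 1 i) (rshift 1 i) <= a by rewrite YE aE; exact: i0max.
  have : b i 0 ^+ 2 <= a ^+ 2.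
    rewrite -(ler_pM2l (_ : 0 < a^-1)) ?invr_gt0 // (expr2 a) mulKf ?gt_eqF //.
    by rewrite (le_trans _ Yia) // ltW.
  rewrite -[b i 0 ^+ 2]real_normK ?num_real //.
  by rewrite ler_pXn2r ?nnegrE ?normr_ge0 ?(ltW a0).
pose G : 'M[R]_(1 + n) := block_mx 1%:M 0 (a^-1 *: b) g.
have G1 i j : `|G i j| <= 1.
  case: (split_ordP i) => k ->; case: (split_ordP j) => l ->.
  + by rewrite block_mxEul mxE !ord1 eqxx normr1.
  + by rewrite block_mxEur mxE normr0 ler01.
  + rewrite block_mxEdl mxE ord1 normrM normfV (gtr0_norm a0) mulrC.
    by rewrite ler_pdivrMr // mul1r.
  + by rewrite block_mxEdr.
exists (P^T *m G), (row_mx (const_mx a) d); split.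
- by move=> i j; rewrite /P tr_perm_mx -row_permE mxE; exact: G1.
- rewrite det_mulmx det_lblock det1 mul1r exprMn dg mulr1 det_tr /P det_perm.
  by rewrite sqrr_sign.
- move=> i; case: (split_ordP i) => k ->; rewrite ?row_mxEl ?row_mxEr //.
  by rewrite mxE.
- have -> : X = P^T *m Y *m P.
    by rewrite YX !mulmxA PP mul1mx -mulmxA PP mulmx1.
  rewrite trmx_mul trmxK !mulmxA; congr (_ *m _); rewrite -!mulmxA; congr (_ *m _).
  rewrite YS SE diag_mx_row diag_const_mx !mulmxA.
  rewrite !tr_block_mx !mulmx_block !trmx1 !trmx0 !mul0mx !mulmx0 !mul1mx !mulmx1.
  by rewrite !addr0 !add0r !mul0mx !addr0.
Qed.

Lemma eq_mulT_orth n (g h : 'M[R]_n) : g \in unitmx -> g *m g^T = h *m h^T ->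
  exists2 o : 'M[R]_n, o *m o^T = 1%:M & h = g *m o.
Proof.
move=> ug e; exists (invmx g *m h); last by rewrite mulKVmx.
rewrite trmx_mul mulmxA -(mulmxA _ h) -e !mulmxA mulVmx // mul1mx -trmx_mul.
by rewrite mulVmx // trmx1.
Qed.

Lemma qf_pm n (E : 'M[R]_n) i j : E^T = E ->
  4%:R * E i j = qf E (delta_mx i 0 + delta_mx j 0) - qf E (delta_mx i 0 - delta_mx j 0).
Proof.
move=> sE; pose B (a b : 'cV[R]_n) := (a^T *m E *m b) 0 0.
have Bl a b c : B (a + b) c = B a c + B b c by rewrite /B linearD /= !mulmxDl mxE.
have BC a b : B a b = B b a.
  rewrite /B; have -> : b^T *m E *m a = (a^T *m E *m b)^T.
    by rewrite !trmx_mul trmxK sE mulmxA.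
  by rewrite [RHS]mxE.
have BN a b : B (- a) b = - B a b by rewrite /B linearN /= !mulNmx mxE.
have eij : B (delta_mx i 0) (delta_mx j 0) = E i j.
  by rewrite /B trmx_delta -rowE -colE !mxE.
rewrite -eij /qf -!/(B _ _) !Bl !(BC _ (_ + _)) !Bl !BN !(BC _ (- _)) !BN.
by rewrite (BC (delta_mx j 0)); ring.
Qed.

(** The value 4 is attained when [i = j] with the plus sign; distinct indices give 2. *)
Lemma sqn_delta_pm n (i j : 'I_n) (s : bool) :
  sqn (delta_mx i 0 + (-1) ^+ s *: delta_mx j 0 : 'cV[R]_n) <= 4%:R.
Proof.
rewrite /sqn; have [->|ij] := eqVneq i j.
  rewrite (bigD1 j) //= big1 => [|k kj]; last first.
    by rewrite !mxE (negPf kj) /= mulr0 addr0 expr0n.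
  by rewrite !mxE !eqxx /= addr0 mulr1; case: s; rewrite ?expr0 ?expr1; lra.
rewrite (bigD1 i) //= (bigD1 j) 1?eq_sym //= big1 => [|k /andP[ki kj]]; last first.
  by rewrite !mxE (negPf kj) (negPf ki) /= mulr0 addr0 expr0n.
rewrite !mxE !eqxx /= (negPf ij) eq_sym (negPf ij) /= mulr0 addr0 add0r mulr1 addr0.
by rewrite -exprM mulnC exprM sqrrN !expr1n; lra.
Qed.

(** Polarization: 4 E_ij is a difference of two values of the form, at vectors of squared length at
    most 4, whence the factor 2. *)
Lemma entry_le_qf n (E : 'M[R]_n) e : E^T = E -> 0 <= e ->
  (forall v, `|qf E v| <= e * sqn v) -> forall i j, `|E i j| <= 2%:R * e.
Proof.
move=> sE e0 h i j; have := qf_pm i j sE.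
have := h (delta_mx i 0 + delta_mx j 0); have := h (delta_mx i 0 - delta_mx j 0).
have := sqn_delta_pm i j false; have := sqn_delta_pm i j true.
rewrite expr0 expr1 scale1r scaleN1r.
set u := qf _ _; set v := qf _ _; set a := sqn _; set b := sqn _.
move=> a4 b4; have := ler_wpM2l e0 a4; have := ler_wpM2l e0 b4.
rewrite !ler_norml => ? ? /andP[? ?] /andP[? ?] ?; apply/andP; split; lra.
Qed.

Lemma qf_le_entry n (E : 'M[R]_n) e : (forall i j, `|E i j| <= e) ->
  forall v, `|qf E v| <= n%:R * e * sqn v.
Proof.
move=> h v; rewrite qfE; apply: le_trans (ler_norm_sum _ _ _) _.
have e2 (i j : 'I_n) : `|v i 0 * E i j * v j 0| <= e * ((v i 0 ^+ 2 + v j 0 ^+ 2) / 2%:R).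
  rewrite !normrM mulrAC mulrC -(real_normK (num_real (v i 0))) -(real_normK (num_real (v j 0))).
  apply: ler_pM; rewrite ?mulr_ge0 //.
  rewrite ler_pdivlMr // -subr_ge0; set x := `|v i 0|; set y := `|v j 0|.
  by rewrite (_ : _ - _ = (x - y) ^+ 2) ?sqr_ge0 //; ring.
apply: (@le_trans _ _ (\sum_i \sum_j e * ((v i 0 ^+ 2 + v j 0 ^+ 2) / 2%:R))).
  apply: ler_sum => i _; apply: le_trans (ler_norm_sum _ _ _) _.
  by apply: ler_sum => j _; exact: e2.
under eq_bigr do rewrite -mulr_sumr -mulr_suml big_split /= sumr_const card_ord.
rewrite -mulr_sumr -mulr_suml big_split /= sumr_const card_ord sumrMnl -/(sqn v).
by rewrite le_eqVlt -[_ *+ _ as X in _ + X]mulr_natl; apply/orP; left; apply/eqP; field.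
Qed.

(** Lagrange's identity: the difference of the two sides is half the sum of the squares (a_i b_j -
    a_j b_i)^2. *)
Lemma cauchy_schwarz n (a b : 'I_n -> R) :
  (\sum_i a i * b i) ^+ 2 <= (\sum_i a i ^+ 2) * (\sum_i b i ^+ 2).
Proof.
rewrite -subr_ge0.
have -> : (\sum_i a i ^+ 2) * (\sum_i b i ^+ 2) - (\sum_i a i * b i) ^+ 2 =
  (\sum_i \sum_j (a i * b j - a j * b i) ^+ 2) / 2%:R.
  have -> : \sum_i \sum_j (a i * b j - a j * b i) ^+ 2 =
     \sum_i \sum_j (a i ^+ 2 * b j ^+ 2) + \sum_i \sum_j (a j ^+ 2 * b i ^+ 2)
     - 2%:R * \sum_i \sum_j (a i * b i * (a j * b j)).
    rewrite mulr_sumr -sumrN -!big_split /=; apply: eq_bigr => i _.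
    rewrite mulr_sumr -sumrN -!big_split /=; apply: eq_bigr => j _; ring.
  rewrite [X in _ + X - _]exchange_big /=.
  have E (f g : 'I_n -> R) : \sum_i \sum_j (f i * g j) = (\sum_i f i) * (\sum_j g j).
    by rewrite mulr_suml; apply: eq_bigr => i _; rewrite mulr_sumr.
  by rewrite !E; field.
by rewrite divr_ge0 // sumr_ge0 // => i _; rewrite sumr_ge0 // => j _; rewrite sqr_ge0.
Qed.

Lemma qf_le_trace n (E : 'M[R]_n) v : qf E v ^+ 2 <= \tr (E *m E^T) * sqn v ^+ 2.
Proof.
have -> : \tr (E *m E^T) = \sum_i \sum_j E i j ^+ 2.
  rewrite /mxtrace; apply: eq_bigr => i _; rewrite mxE; apply: eq_bigr => j _.
  by rewrite mxE expr2.
have -> : qf E v = \sum_i v i 0 * (\sum_j E i j * v j 0).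
  rewrite qfE; apply: eq_bigr => i _; rewrite mulr_sumr; apply: eq_bigr => j _.
  by rewrite mulrA.
apply: le_trans (cauchy_schwarz _ _) _.
rewrite -/(sqn v) [sqn v ^+ 2]expr2 mulrCA ler_wpM2l ?sqn_ge0 // mulr_suml.
by apply: ler_sum => i _; exact: cauchy_schwarz.
Qed.

End QuadraticForms.

(** * Entrywise limits of matrices along a filter *)

Section EntrywiseLimits.
Variables (R : realType) (T : Type) (F : set_system T).
Context {FF : Filter F}.

Lemma expR_decay (tau : T -> R) a : 0 < a -> tau t @[t --> F] --> +oo ->
  expR (- (a * tau t)) @[t --> F] --> 0.
Proof.
move=> a0 ty; apply: (@cvg_comp _ _ _ (fun t => a * tau t) (fun t => expR (- t)) _ (pinfty_nbhs R)).
  apply: (@cvg_comp _ _ _ tau (fun r => a * r) _ (pinfty_nbhs R)) => //.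
  by apply: (gt0_cvgMry a0); exact: cvg_id.
exact: cvgr_expR.
Qed.

Lemma cvg_sumr (I : Type) (r : seq I) (P : pred I) (f : I -> T -> R) (a : I -> R) :
  (forall i, P i -> f i x @[x --> F] --> a i) ->
  \sum_(i <- r | P i) f i x @[x --> F] --> \sum_(i <- r | P i) a i.
Proof.
move=> h; elim: r => [|i r IH].
  under eq_cvg do rewrite big_nil.
  by rewrite big_nil; exact: cvg_cst.
under eq_cvg do rewrite big_cons.
by rewrite big_cons; case: ifP => // Pi; apply: cvgD => //; exact: h.
Qed.

Lemma cvg_prodr (I : Type) (r : seq I) (P : pred I) (f : I -> T -> R) (a : I -> R) :
  (forall i, P i -> f i x @[x --> F] --> a i) ->
  \prod_(i <- r | P i) f i x @[x --> F] --> \prod_(i <- r | P i) a i.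
Proof.
move=> h; elim: r => [|i r IH].
  under eq_cvg do rewrite big_nil.
  by rewrite big_nil; exact: cvg_cst.
under eq_cvg do rewrite big_cons.
by rewrite big_cons; case: ifP => // Pi; apply: cvgM => //; exact: h.
Qed.

Lemma cvg_expr (f : T -> R) (a : R) (k : nat) : f @ F --> a -> f x ^+ k @[x --> F] --> a ^+ k.
Proof.
move=> h; elim: k => [|k IH].
  by under eq_cvg do rewrite expr0; exact: cvg_cst.
by under eq_cvg do rewrite exprS; rewrite exprS; exact: cvgM.
Qed.

(** Entrywise convergence reduces sums, products, determinants and inverses to real limits;
    [mlim_cvg] identifies it with convergence in the matrix topology. *)
Definition mlim m n (f : T -> 'M[R]_(m, n)) (A : 'M[R]_(m, n)) : Prop :=
  forall i j, f x i j @[x --> F] --> A i j.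

Lemma mlim_cst m n (A : 'M[R]_(m, n)) : mlim (fun=> A) A.
Proof. by move=> i j; exact: cvg_cst. Qed.

Lemma mlimZ m n (c : T -> R) (f : T -> 'M[R]_(m, n)) (a : R) A :
  c @ F --> a -> mlim f A -> mlim (fun x => c x *: f x) (a *: A).
Proof.
move=> ca fA i j; rewrite mxE; under eq_cvg do rewrite mxE.
by apply: cvgM => //; exact: fA.
Qed.

Lemma mlimM m n p (f : T -> 'M[R]_(m, n)) (g : T -> 'M[R]_(n, p)) A B :
  mlim f A -> mlim g B -> mlim (fun x => f x *m g x) (A *m B).
Proof.
move=> fA gB i j; rewrite mxE; under eq_cvg do rewrite mxE.
by apply: cvg_sumr => k _; apply: cvgM; [exact: fA|exact: gB].
Qed.

Lemma mlim_sum (I : eqType) (r : seq I) m n (f : I -> T -> 'M[R]_(m, n)) A :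
  {in r, forall i, mlim (f i) (A i)} ->
  mlim (fun x => \sum_(i <- r) f i x) (\sum_(i <- r) A i).
Proof.
move=> h i j; rewrite summxE big_seq.
apply: (@cvg_trans _ ((fun x => \sum_(k <- r | k \in r) f k x i j) @ F)).
  by apply: near_eq_cvg; apply: nearW => x; rewrite summxE [RHS]big_seq.
by apply: cvg_sumr => k kr; exact: h.
Qed.

Lemma mlim_tr m n (f : T -> 'M[R]_(m, n)) A : mlim f A -> mlim (fun x => (f x)^T) A^T.
Proof. by move=> fA i j; rewrite mxE; under eq_cvg do rewrite mxE; exact: fA. Qed.

Lemma mlim_det n (f : T -> 'M[R]_n) A : mlim f A -> \det (f x) @[x --> F] --> \det A.
Proof.
move=> fA; apply: cvg_sumr => s _; apply: cvgM; first exact: cvg_cst.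
by apply: cvg_prodr => i _; exact: fA.
Qed.

Lemma mlim_near m n (f g : T -> 'M[R]_(m, n)) A :
  (\forall x \near F, f x = g x) -> mlim f A -> mlim g A.
Proof.
move=> fg fA i j; apply: cvg_trans (fA i j); apply: near_eq_cvg.
by near=> x; rewrite (near fg x).
Unshelve. all: by end_near. Qed.

Lemma mlim_unitmx n (f : T -> 'M[R]_n) A : mlim f A -> A \in unitmx ->
  \forall x \near F, f x \in unitmx.
Proof.
move=> fA uA; have dA : \det A != 0 by rewrite -unitfE -unitmxE.
have := mlim_det fA => /cvgr_neq0 /(_ dA).
by apply: filterS => x; rewrite -unitfE -unitmxE.
Qed.

Lemma mlim_inv n (f : T -> 'M[R]_n) A : mlim f A -> A \in unitmx ->
  mlim (fun x => invmx (f x)) (invmx A).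
Proof.
move=> fA uA; have dA : \det A != 0 by rewrite -unitfE -unitmxE.
apply: (@mlim_near _ _ (fun x => (\det (f x))^-1 *: \adj (f x))).
  by apply: filterS (mlim_unitmx fA uA) => x ux; rewrite /invmx ux.
rewrite /invmx uA; apply: mlimZ.
  by apply: cvgV => //; exact: mlim_det.
move=> i j; rewrite mxE; under eq_cvg do rewrite mxE.
apply: cvgM; first exact: cvg_cst.
apply: mlim_det => k l; rewrite !mxE; under eq_cvg do rewrite !mxE.
exact: fA.
Qed.

Lemma mlim_trace n (f : T -> 'M[R]_n) A : mlim f A -> \tr (f x) @[x --> F] --> \tr A.
Proof. by move=> fA; apply: cvg_sumr => i _; exact: fA. Qed.

Lemma mlim_qf n (f : T -> 'M[R]_n) A v : mlim f A -> qf (f x) v @[x --> F] --> qf A v.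
Proof.
by move=> fA; apply: mlimM; [apply: mlimM => //|]; exact: mlim_cst.
Qed.

Lemma mlim_cvg m n (f : T -> 'M[R]_(m, n)) A : mlim f A <-> f @ F --> A.
Proof.
split=> [fA|fA i j].
  apply/cvg_ballP => e e0; near=> x; split=> // i j.
  move: i j; near: x; apply: filter_forall => i; apply: filter_forall => j.
  by have /cvg_ballP := fA i j; apply.
by apply/cvg_ballP => e e0; have /cvg_ballP /(_ e e0) := fA; apply: filterS => x [].
Unshelve. all: by end_near. Qed.

End EntrywiseLimits.
Arguments mlim {R T} F {m n} f A.

Lemma invmx_mul (K : comUnitRingType) n (A B : 'M[K]_n) :
  A \in unitmx -> B \in unitmx -> invmx (A *m B) = invmx B *m invmx A.
Proof.
move=> uA uB; have uAB : A *m B \in unitmx by rewrite unitmx_mul uA.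
by rewrite -[RHS](mulKmx uAB) -(mulmxA A) mulKVmx // mulmxV // mulmx1.
Qed.

(** * The metric and null pencils *)

Section MetricBounds.
Variables (R : realType) (n : nat).
Implicit Types (X Y g : 'M[R]_n) (v : 'cV[R]_n) (gamma : R -> 'M[R]_n).

(** The linear substitute for a bound d on the distance: [dist_near_le] and [near_le_dist] translate
    between the two, with a loss in the second direction that tends to 0 with d. *)
Definition near_le (d : R) X Y : Prop :=
  forall v, expR (- d) * qf X v <= qf Y v <= expR d * qf X v.

Lemma continuous_mlim m k (f : R -> 'M[R]_(m, k)) : continuous f ->
  forall t, mlim (nbhs t) f (f t).
Proof. by move=> cf t; apply/mlim_cvg; exact: cf. Qed.

Lemma derivable_mlim m k (f : R -> 'M[R]_(m, k)) : (forall t, derivable f t 1) ->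
  forall t, mlim (nbhs t) f (f t).
Proof.
move=> df t i j; have /derivable_mxP /(_ i j) := df t.
by move/derivable1_diffP/differentiable_continuous.
Qed.

Lemma posdef_unit X : pdef X -> X \in unitmx.
Proof.
case/cholesky => p [tp p0 ->]; rewrite unitmx_mul unitmx_tr andbb unitmxE unitfE.
by rewrite det_trig // prodf_seq_neq0; apply/allP => i _; rewrite gt_eqF.
Qed.

(** With gamma t = p p^T, the speed is the Frobenius norm of E = p^-1 D p^-T, and the left side is a
    Rayleigh quotient of E at p^T v. *)
Lemma speed_ge_qf gamma t : pdef (gamma t) -> (derive1 gamma t)^T = derive1 gamma t ->
  forall v, v != 0 -> `|qf (derive1 gamma t) v| / qf (gamma t) v <= speed gamma t.
Proof.
rewrite /speed; set D := derive1 gamma t => pX sD v v0; case: (pX) => _ /(_ v v0) qv.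
have [p [tp p0 XE]] := cholesky pX.
have up : p \in unitmx.
  by rewrite unitmxE unitfE det_trig // prodf_seq_neq0; apply/allP => i _; rewrite gt_eqF.
pose E := invmx p *m D *m (invmx p)^T.
have DE : D = p *m E *m p^T.
  by rewrite /E !mulmxA mulmxV // mul1mx -mulmxA -trmx_mul mulmxV // trmx1 mulmx1.
have sE : E^T = E by rewrite /E !trmx_mul trmxK sD mulmxA.
have trE : \tr (D *m invmx (gamma t) *m D *m invmx (gamma t)) = \tr (E *m E^T).
  have iX : invmx (gamma t) = (invmx p)^T *m invmx p.
    rewrite trmx_inv XE; have up' : p^T \in unitmx by rewrite unitmx_tr.
    by rewrite invmx_mul.
  rewrite sE iX DE !mulmxA.
  have tp1 : p^T *m (invmx p)^T = 1%:M by rewrite -trmx_mul mulVmx // trmx1.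
  rewrite -!(mulmxA _ p^T) tp1 !mulmx1 -!(mulmxA _ (invmx p)) mulVmx // !mulmx1.
  by rewrite mxtrace_mulC !mulmxA mulVmx // mul1mx.
rewrite ler_pdivrMr // trE {1}DE XE qf_conj -[X in qf (p *m X)](mul1mx) mulmxA.
have -> : qf (p *m 1%:M *m p^T) v = sqn (p^T *m v) by rewrite qf_conj qf1.
have := qf_le_trace E (p^T *m v); set q := qf _ _; set s := sqn _; set tt := \tr _ => h.
have t0 : 0 <= tt.
  rewrite /tt /mxtrace; apply: sumr_ge0 => i _; rewrite mxE.
  by apply: sumr_ge0 => j _; rewrite [E^T _ _]mxE -expr2 sqr_ge0.
have -> : Num.sqrt tt * s = Num.sqrt (tt * s ^+ 2).
  by rewrite sqrtrM // sqrtr_sqr ger0_norm // sqn_ge0.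
by rewrite -sqrtr_sqr ler_sqrt // mulr_ge0 // sqr_ge0.
Qed.


(** Outside [0, 1] the path may leave the symmetric matrices. In the open interval the derivative
    sees only nearby symmetric values; at the endpoints the continuity of the derivative takes
    over. *)
Lemma unit_itv_sym_derive gamma :
  (forall t, derivable gamma t 1) -> continuous (derive1 gamma) ->
  (forall t : R, 0 <= t <= 1 -> (gamma t)^T = gamma t) ->
  forall t : R, 0 <= t <= 1 -> (derive1 gamma t)^T = derive1 gamma t.
Proof.
move=> dg cg sg; pose h i j (t : R) := derive1 gamma t i j - derive1 gamma t j i.
have ch i j : continuous (h i j).
  by move=> t; apply: cvgB; apply: (continuous_mlim cg).
have h0 i j (t : R) : 0 < t < 1 -> h i j t = 0.
  move=> t01; rewrite /h !derive1E !derive_mx // !mxE; apply/eqP; rewrite subr_eq0.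
  apply/eqP; apply: near_eq_derive.
  have : \forall s \near t, s \in `]0, 1[ by apply: near_in_itvoo; rewrite in_itv.
  apply: filterS => s; rewrite in_itv /= => /andP[s0 s1].
  by rewrite -[in RHS](sg s) ?mxE // !ltW.
have h01 i j (t : R) : 0 <= t <= 1 -> h i j t = 0.
  move=> /andP[]; rewrite le_eqVlt => /predU1P[<- _|t0].
    apply: (cvg_unique _ (cvg_at_right_filter (ch i j 0))) => //.
    apply: (@cvg_trans _ (cst 0 @ 0^'+)); last exact: cvg_cst.
    apply: near_eq_cvg; near=> s; symmetry; apply: h0.
    by apply/andP; split; near: s; [exact: nbhs_right_gt|exact: nbhs_right_lt].
  rewrite le_eqVlt => /predU1P[->|t1]; last by rewrite h0 // t0.
  apply: (cvg_unique _ (cvg_at_left_filter (ch i j 1))) => //.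
  apply: (@cvg_trans _ (cst 0 @ 1^'-)); last exact: cvg_cst.
  apply: near_eq_cvg; near=> s; symmetry; apply: h0.
  by apply/andP; split; near: s; [exact: nbhs_left_gt|exact: nbhs_left_lt].
move=> t t01; apply/matrixP => i j; rewrite mxE; apply/eqP.
by rewrite -subr_eq0; apply/eqP; exact: h01.
Unshelve. all: by end_near. Qed.

Lemma speed_integrable gamma X Y : path_between X Y gamma ->
  (lebesgue_measure).-integrable `[0, 1]%classic (EFin \o speed gamma).
Proof.
move=> [dg cg pg [g0 g1]].
have mg (t : R) : mlim (nbhs t) gamma (gamma t) by exact: derivable_mlim.
have mg' (t : R) : mlim (nbhs t) (derive1 gamma) (derive1 gamma t) by exact: continuous_mlim.
have cs (t : R) : 0 <= t <= 1 -> {for t, continuous (speed gamma)}.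
  move=> t01; apply: continuous_cvg; first exact: sqrt_continuous.
  have mi : mlim (nbhs t) (fun s => invmx (gamma s)) (invmx (gamma t)).
    by apply: mlim_inv; [exact: mg|exact/posdef_unit/pg].
  apply: mlim_trace; apply: mlimM; last exact: mi.
  apply: mlimM; last exact: mg'.
  by apply: mlimM; [exact: mg'|exact: mi].
have ws : {within `[0, 1]%classic, continuous (speed gamma)}.
  by apply: continuous_in_subspaceT => t; rewrite inE /= in_itv /=; exact: cs.
by apply: continuous_compact_integrable => //; exact: segment_compact.
Qed.

(** The fundamental theorem of calculus for the logarithm of the form at v, whose derivative is
    bounded by the speed. *)
Lemma path_length_ge gamma X Y v : path_between X Y gamma -> v != 0 ->
  `|ln (qf Y v) - ln (qf X v)| <= path_length gamma.
Proof.
move=> [dg cg pg [g0 g1]] v0.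
have mg (t : R) : mlim (nbhs t) gamma (gamma t) by exact: derivable_mlim.
have mg' (t : R) : mlim (nbhs t) (derive1 gamma) (derive1 gamma t) by exact: continuous_mlim.
have sg' : forall t : R, 0 <= t <= 1 -> (derive1 gamma t)^T = derive1 gamma t.
  by apply: unit_itv_sym_derive => // t /pg [].
have dqf (t : R) : is_derive t 1 (fun s => qf (gamma s) v) (qf (derive1 gamma t) v).
  have -> : (fun s => qf (gamma s) v) = \sum_i \sum_j (fun s => v i 0 * gamma s i j * v j 0).
    apply/funext => s; rewrite qfE fct_sumE; apply: eq_bigr => i _.
    by rewrite fct_sumE.
  rewrite qfE; apply: is_derive_sum => i; apply: is_derive_sum => j.
  have dij : is_derive t 1 (fun s => gamma s i j) (derive1 gamma t i j).
    split; first by have /derivable_mxP := dg t; exact.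
    by rewrite derive1E (derive_mx (dg t)) mxE.
  apply: is_derive_eq; rewrite /GRing.scale /=; ring.
pose q (t : R) := qf (gamma t) v.
have q0 (t : R) : 0 <= t <= 1 -> 0 < q t by move=> /pg [_]; exact.
pose f (t : R) := qf (derive1 gamma t) v / q t.
have dF (t : R) : 0 <= t <= 1 -> is_derive t 1 (fun s : R => ln (q s)) (f t).
  move=> t01; rewrite /f mulrC; apply: is_derive1_comp; apply: is_derive1_ln; exact: q0.
have cf (t : R) : 0 <= t <= 1 -> {for t, continuous f}.
  move=> t01; apply: cvgM; first by apply: mlim_qf; exact: mg'.
  by apply: cvgV; [rewrite gt_eqF // q0|by apply: mlim_qf; exact: mg].
have wf : {within `[0, 1]%classic, continuous f}.
  by apply: continuous_in_subspaceT => t; rewrite inE /= in_itv /=; exact: cf.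
have If : (lebesgue_measure).-integrable `[0, 1]%classic (EFin \o f).
  by apply: continuous_compact_integrable => //; exact: segment_compact.
have Is := speed_integrable (And4 dg cg pg (conj g0 g1)).
have -> : ln (qf Y v) - ln (qf X v) = \int[lebesgue_measure]_(t in `[0, 1]) f t.
  rewrite /Rintegral (@continuous_FTC2 R f (fun s : R => ln (q s)) 0 1) //=; first by rewrite /q g0 g1.
    have c01 (t : R) : 0 <= t <= 1 -> {for t, continuous (fun s : R => ln (q s))}.
      by move=> /dF [+ _] => /derivable1_diffP/differentiable_continuous.
    split.
    - by move=> t; rewrite in_itv /= => /andP[/ltW t0 /ltW t1];
        have t01 : 0 <= t <= 1 by [rewrite t0 t1]; have [] := dF t t01.
    - by apply: cvg_at_right_filter; apply: c01; rewrite lexx ler01.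
    - by apply: cvg_at_left_filter; apply: c01; rewrite lexx ler01.
  move=> t; rewrite in_itv /= => /andP[/ltW t0 /ltW t1].
  have t01 : 0 <= t <= 1 by rewrite t0 t1.
  by rewrite derive1E; have [_ ->] := dF t t01.
apply: le_trans (le_normr_Rintegral _ _) _ => //.
apply: le_Rintegral => //.
  by apply: integrable_norm.
move=> t; rewrite /= in_itv /= => t01; rewrite /f normrM normfV (gtr0_norm (q0 _ t01)).
exact: (speed_ge_qf (pg t t01) (sg' t t01)).

Qed.

Lemma straight_path X Y : pdef X -> pdef Y ->
  path_between X Y (fun t : R => X + t *: (Y - X)) /\
  forall t : R, derive1 (fun t : R => X + t *: (Y - X)) t = Y - X.
Proof.
move=> [sX pX] [sY pY].
have der (t : R) i j :
    is_derive t 1 (fun s : R => (X + s *: (Y - X)) i j) ((Y - X) i j).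
  rewrite (_ : (fun s : R => _) = cst (X i j) + (Y - X) i j *: id); last first.
    by apply/funext => s; rewrite !mxE /= !fctE /GRing.scale /= mulrC.
  move: (X i j) ((Y - X) i j) => x0 c.
  apply: (is_derive_eq (is_deriveD (is_derive_cst x0 t 1) (is_deriveZ c (is_derive_id t 1)))).
  by rewrite add0r /GRing.scale /= mulr1.
have dpath (t : R) : derivable (fun s : R => X + s *: (Y - X)) t 1.
  by apply/derivable_mxP => i j; have [] := der t i j.
have der1 (t : R) : derive1 (fun t : R => X + t *: (Y - X)) t = Y - X.
  rewrite derive1E (derive_mx (dpath t)); apply/matrixP => i j; rewrite mxE.
  by have [_ ->] := der t i j.
split; last exact: der1.
split; first exact: dpath.
- move=> t; rewrite (_ : derive1 _ = cst (Y - X)); first exact: cvg_cst.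
  by apply/funext => s; rewrite der1.
- move=> t /andP[t0 t1]; split.
    by rewrite linearD linearZ /= linearB /= sX sY.
  move=> v v0; rewrite -/(qf _ v) qfD qfZ qfD qfN.
  have := pX v v0; have := pY v v0; set a := qf Y v; set b := qf X v => a0 b0.
  have -> : b + t * (a - b) = (1 - t) * b + t * a by ring.
  move: t0; rewrite le_eqVlt => /predU1P[<-|t0]; first by rewrite subr0 mul0r mul1r addr0.
  by rewrite ltr_wpDl ?mulr_gt0 // mulr_ge0 ?subr_ge0 // ltW.
- by split; rewrite ?scale0r ?addr0 // scale1r addrC subrK.
Qed.

Lemma path_length_ge0 gamma : 0 <= path_length gamma.
Proof. by apply: Rintegral_ge0 => t _; rewrite /speed sqrtr_ge0. Qed.

Lemma dist_ge0 X Y : 0 <= dist X Y.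
Proof.
(* Without connecting paths the infimum is that of the empty set, which is 0 by convention. *)
rewrite /dist; have [->|/set0P e] := eqVneq [set path_length gamma | gamma in path_between X Y] set0.
  by rewrite inf0.
by apply: lb_le_inf => // _ [g _ <-]; exact: path_length_ge0.
Qed.

Lemma dist_ge_ln X Y v : pdef X -> pdef Y -> v != 0 ->
  `|ln (qf Y v) - ln (qf X v)| <= dist X Y.
Proof.
move=> pX pY v0; apply: lb_le_inf.
  by exists (path_length (fun t : R => X + t *: (Y - X))), (fun t : R => X + t *: (Y - X));
    [have [] := straight_path pX pY|].
by move=> _ [g pg <-]; exact: path_length_ge.
Qed.

Lemma dist_near_le X Y d : pdef X -> pdef Y -> dist X Y <= d -> near_le d X Y.
Proof.
move=> pX pY dd v; have [->|v0] := eqVneq v 0; first by rewrite !qf0 !mulr0 lexx.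
have [_ /(_ v v0) qX] := pX; have [_ /(_ v v0) qY] := pY.
have := le_trans (dist_ge_ln pX pY v0) dd; rewrite ler_norml => /andP[h1 h2].
rewrite -[qf X v]lnK ?posrE // -[qf Y v]lnK ?posrE // -!expRD !ler_expR.
apply/andP; split; lra.
Qed.

(** Along the segment the velocity is the constant Y - X; its form is at most (e^d - 1) q_X in
    absolute value, and q_X is at most e^d times the form of the current point. Polarization
    contributes the factor 2, and the Frobenius norm of an n by n matrix the factor n. *)
Lemma near_le_dist X Y d : 0 <= d -> pdef X -> pdef Y -> near_le d X Y ->
  dist X Y <= n%:R * (2%:R * ((expR d - 1) * expR d)).
Proof.
move=> d0 pX pY nXY; have [pa der] := straight_path pX pY.
set g := (fun t : R => X + t *: (Y - X)) in pa der.
set e := _ * (2%:R * _); have e0 : 0 <= e.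
  by rewrite /e !mulr_ge0 ?expR_ge0 // subr_ge0 -expR0 ler_expR.
apply: (@le_trans _ _ (path_length g)).
  apply: ge_inf; last by exists g.
  by exists 0 => _ [h _ <-]; exact: path_length_ge0.
have sp (t : R) : 0 <= t <= 1 -> speed g t <= e.
  move=> t01; have [_ _ /(_ t t01) pg _] := pa; rewrite /speed der.
  have [p [tp p0 XE]] := cholesky pg; have up : p \in unitmx.
    by rewrite unitmxE unitfE det_trig // prodf_seq_neq0; apply/allP => i _; rewrite gt_eqF.
  set D := Y - X; have sD : D^T = D by rewrite /D linearB /=; case: pX => ->; case: pY => ->.
  pose E := invmx p *m D *m (invmx p)^T.
  have sE : E^T = E by rewrite /E !trmx_mul trmxK sD mulmxA.
  have -> : \tr (D *m invmx (g t) *m D *m invmx (g t)) = \tr (E *m E^T).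
    have -> : invmx (g t) = (invmx p)^T *m invmx p.
      by rewrite trmx_inv XE; rewrite invmx_mul ?unitmx_tr.
    by rewrite sE /E mxtrace_mulC !mulmxA -[RHS]mxtrace_mulC !mulmxA mxtrace_mulC !mulmxA.
  have Eij : forall i j, `|E i j| <= 2%:R * ((expR d - 1) * expR d).
    apply: entry_le_qf => //; first by rewrite mulr_ge0 ?expR_ge0 // subr_ge0 -expR0 ler_expR.
    move=> v; pose w := (invmx p)^T *m v.
    have -> : sqn v = qf (g t) w.
      rewrite XE -[X in _ *m X]mul1mx mulmxA qf_conj qf1 /w mulmxA -trmx_mul mulVmx //.
      by rewrite trmx1 mul1mx.
    rewrite qf_conj -/w /g /D !(qfD, qfZ, qfN).
    have := nXY w; have : 0 <= qf X w.
      have [->|w0] := eqVneq w 0; first by rewrite qf0.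
      by case: pX => _ /(_ w w0) /ltW.
    move: t01 => /andP[t0 t1]; have ed : 1 <= expR d by rewrite -expR0 ler_expR.
    have ede : expR (- d) * expR d = 1 by rewrite -expRD addNr expR0.
    have := expR_ge0 (- d).
    set x := qf X w; set y := qf Y w; set a := expR d; set b := expR (- d) in ede *.
    move=> b0 x0 /andP[h1 h2]; rewrite ler_norml.
    have b1 : b <= 1 by rewrite -ede ler_peMr.
    have hg : b * x <= x + t * (y - x).
      have -> : x + t * (y - x) = (1 - t) * x + t * y by ring.
      have bx : b * x <= x by rewrite ler_piMl.
      have := ler_wpM2l t0 h1; have := ler_wpM2l (_ : 0 <= 1 - t) bx.
      by rewrite subr_ge0 => /(_ t1); lra.
    have hk : (a - 1) * x <= (a - 1) * a * (x + t * (y - x)).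
      have -> : (a - 1) * x = (a - 1) * a * (b * x) by rewrite -mulrA (mulrA a) [a * b]mulrC ede mul1r.
      by rewrite ler_wpM2l // mulr_ge0 ?expR_ge0 // subr_ge0.
    apply/andP; split; last by lra.
    have : (1 - b) * x <= (a - 1) * x.
      have : 0 <= (a - 1) * (1 - b) by rewrite mulr_ge0 ?subr_ge0.
      by rewrite mulrBl mulrBr mulr1 mul1r (mulrC a) ede => ?; rewrite ler_wpM2r //; lra.
    by lra.
  rewrite -[e]ger0_norm // -sqrtr_sqr ler_sqrt ?sqr_ge0 // /mxtrace.
  set c := 2%:R * _ in Eij e e0 *.
  have Eij2 i j : E i j ^+ 2 <= c ^+ 2.
    rewrite -[E i j ^+ 2]real_normK ?num_real // ler_pXn2r ?nnegrE //.
    exact: le_trans (normr_ge0 _) (Eij i j).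
  apply: (@le_trans _ _ (\sum_(i < n) \sum_(j < n) c ^+ 2)).
    apply: ler_sum => i _; rewrite mxE; apply: ler_sum => j _.
    by rewrite [E^T _ _]mxE -expr2.
  by rewrite !sumr_const card_ord -mulrnA -mulr_natl natrM [X in _ <= X]exprMn [X in _ <= X * _]expr2.
rewrite /path_length; apply: (@le_trans _ _ (\int[lebesgue_measure]_(t in `[0, 1]) cst e t)).
  apply: le_Rintegral => //; first exact: (speed_integrable pa).
  by apply: continuous_compact_integrable; [exact: segment_compact|apply: continuous_subspaceT => t; exact: cvg_cst].
by rewrite Rintegral_cst //= lebesgue_measure_itv /= lte_fin ltr01 -EFinD subr0 /= mulr1.
Qed.


End MetricBounds.

(** * Null pencils as classes of asymptotic geodesics *)

Section Pencils.
Variables (R : realType) (n : nat).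
Implicit Types (X Y Z g h : 'M[R]_n) (v : 'cV[R]_n) (mu nu : R -> 'M[R]_n) (phi psi : 'rV[R]_n).

Lemma mx_neq0 (p q : nat) (A : 'M[R]_(p, q)) : A != 0 -> exists i j, A i j != 0.
Proof.
move=> A0; apply: contrapT => h; move/eqP: A0; apply; apply/matrixP => i j.
by rewrite mxE; apply/eqP/negPn/negP => Aij; apply: h; exists i, j.
Qed.

Lemma pdef_qf_ge0 X v : pdef X -> 0 <= qf X v.
Proof.
move=> [_ pX]; have [->|v0] := eqVneq v 0; first by rewrite qf0.
exact/ltW/pX.
Qed.

Lemma near_le_sym d X Y : near_le d X Y -> near_le d Y X.
Proof.
move=> h v; have /andP[h1 h2] := h v.
have e0 := expR_gt0 d; have e1 := expR_gt0 (- d).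
apply/andP; split.
  by rewrite -(ler_pM2l e0) mulrA -expRD subrr expR0 mul1r.
by rewrite -(ler_pM2l e1) mulrA -expRD addNr expR0 mul1r.
Qed.

Lemma near_le_trans d e X Y Z : near_le d X Y -> near_le e Y Z -> near_le (d + e) X Z.
Proof.
move=> h k v; have /andP[h1 h2] := h v; have /andP[k1 k2] := k v.
apply/andP; split.
  apply: le_trans k1; rewrite opprD addrC expRD -mulrA.
  by rewrite ler_wpM2l ?expR_ge0.
apply: (le_trans k2); rewrite addrC expRD -mulrA.
by rewrite ler_wpM2l ?expR_ge0.
Qed.

Lemma near_le_mono d e X Y : pdef X -> d <= e -> near_le d X Y -> near_le e X Y.
Proof.
move=> pX de h v; have /andP[h1 h2] := h v; have x0 := pdef_qf_ge0 v pX.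
apply/andP; split.
  by apply: le_trans h1; rewrite ler_wpM2r // ler_expR lerN2.
by apply: (le_trans h2); rewrite ler_wpM2r // ler_expR.
Qed.

Lemma near_le_refl d X : pdef X -> 0 <= d -> near_le d X X.
Proof.
move=> pX d0; apply: (near_le_mono pX d0) => v.
by rewrite oppr0 expR0 !mul1r lexx.
Qed.

Lemma pdef_geodesic g phi t : g \in unitmx -> pdef (geodesic_curve g phi t).
Proof.
move=> ug; apply: pdef_conj => //; apply: pdef_diag => i.
by rewrite mxE expR_gt0.
Qed.

Lemma qf_geodesic g phi t v :
  qf (geodesic_curve g phi t) v = \sum_i expR (phi 0 i * t) * (g^T *m v) i 0 ^+ 2.
Proof. by rewrite qf_conj qf_diag; apply: eq_bigr => i _; rewrite mxE. Qed.

Lemma geodesic_affine g phi a b t :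
  geodesic_curve g phi (a * t + b) =
  geodesic_curve (g *m diag_mx (\row_i expR (phi 0 i * b / 2%:R))) (a *: phi) t.
Proof.
rewrite /geodesic_curve trmx_mul tr_diag_mx !mulmxA; congr (_ *m _).
rewrite -!mulmxA; congr (_ *m _); rewrite !mulmx_diag; congr diag_mx.
apply/rowP => i; rewrite !mxE -!expRD; by congr expR; field.
Qed.

Lemma unit_expR_diag g (c : 'rV[R]_n) : g \in unitmx ->
  g *m diag_mx (\row_i expR (c 0 i)) \in unitmx.
Proof.
move=> ug; rewrite unitmx_mul ug unitmxE unitfE det_diag prodf_seq_neq0.
by apply/allP => i _; rewrite mxE gt_eqF // expR_gt0.
Qed.

(** Both curves run at the same time; the freedom of parametrization is carried by affine changes of
    [nu]. *)
Definition strongly_asymptotic mu nu : Prop :=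
  forall d, 0 < d -> \forall t \near +oo, near_le d (mu t) (nu t).

Lemma strong_sym mu nu : strongly_asymptotic mu nu -> strongly_asymptotic nu mu.
Proof. by move=> h d d0; apply: filterS (h d d0) => t; exact: near_le_sym. Qed.

Lemma strong_trans mu nu la : strongly_asymptotic mu nu -> strongly_asymptotic nu la ->
  strongly_asymptotic mu la.
Proof.
move=> h k d d0; have d2 : 0 < d / 2%:R by rewrite divr_gt0.
near=> t; have -> : d = d / 2%:R + d / 2%:R by field.
by apply: (@near_le_trans _ _ _ (nu t)); near: t; [exact: h|exact: k].
Unshelve. all: by end_near. Qed.

Lemma strong_affine mu nu a b : 0 < a -> strongly_asymptotic mu nu ->
  strongly_asymptotic (fun t => mu (a * t + b)) (fun t => nu (a * t + b)).
Proof.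
move=> a0 h d d0; have [M [Mr hM]] := h d d0; near=> t; apply: hM.
rewrite -ltrBlDr mulrC -ltr_pdivrMr //; near: t.
by apply: nbhs_pinfty_gt; rewrite num_real.
Unshelve. all: by end_near. Qed.

Lemma null_asymptotic_near_le mu nu :
  (forall t, pdef (mu t)) -> (forall t, pdef (nu t)) -> null_asymptotic mu nu ->
  forall d, 0 < d -> \forall t \near +oo, exists2 s, 0 <= s & near_le d (mu t) (nu s).
Proof.
move=> pm pn h d d0; have /cvgrPdist_lt /(_ d d0) := h.
apply: filterS => t; rewrite sub0r normrN; set E := (X in inf X) => hE.
have iE : has_inf E.
  split; first by exists (dist (mu t) (nu 0)), 0 => //=.
  by exists 0 => _ [s _ <-]; exact: dist_ge0.
have e0 : 0 < d - inf E by rewrite subr_gt0 (le_lt_trans (ler_norm _) hE).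
have [_ [s s0 <-] hs] := inf_adherent e0 iE; exists s => //.
by apply: dist_near_le => //; rewrite ltW // (lt_le_trans hs) // addrC subrK.
Qed.

Lemma strong_null_asymptotic mu nu :
  (forall t, pdef (mu t)) -> (forall t, pdef (nu t)) -> strongly_asymptotic mu nu ->
  null_asymptotic mu nu.
Proof.
move=> pm pn h; apply/cvgrPdist_le => e e0.
have [d d0 de] : exists2 d, 0 < d & n%:R * (2%:R * ((expR d - 1) * expR d)) <= e.
  have : (n%:R * (2%:R * ((expR d - 1) * expR d)) : R) @[d --> (0:R)^'+] --> (0:R).
    rewrite [X in _ --> X](_ : _ = n%:R * (2%:R * ((expR 0 - 1) * expR 0))); last first.
      by rewrite expR0 subrr mul0r !mulr0.
    have ce : expR d @[d --> (0:R)^'+] --> expR (0:R).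
      by apply: cvg_at_right_filter; exact: continuous_expR.
    apply: cvgM; first exact: cvg_cst; apply: cvgM; first exact: cvg_cst.
    by apply: cvgM => //; apply: cvgB => //; exact: cvg_cst.
  move=> /cvgrPdist_le /(_ e e0) hh; near (0:R)^'+ => d; exists d.
    by near: d; exact: nbhs_right_gt.
  have : `|0 - n%:R * (2%:R * ((expR d - 1) * expR d))| <= e by near: d.
  by rewrite sub0r normrN; apply: le_trans; exact: ler_norm.
near=> t; rewrite sub0r normrN ger0_norm; last first.
  by apply: lb_le_inf => [|_ [s _ <-]]; [exists (dist (mu t) (nu 0)), 0 => //=|exact: dist_ge0].
apply: (@le_trans _ _ (dist (mu t) (nu t))).
  apply: ge_inf; first by exists 0 => _ [s _ <-]; exact: dist_ge0.
  by exists t => //=; near: t; apply: nbhs_pinfty_ge; rewrite num_real.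
apply: le_trans de; apply: near_le_dist => //; first exact: ltW.
by near: t; exact: h.
Unshelve. all: by end_near. Qed.

Lemma near_le_shift h psi s s' P d : h \in unitmx -> (forall i, `|psi 0 i| <= P) ->
  P * `|s - s'| <= d -> near_le d (geodesic_curve h psi s) (geodesic_curve h psi s').
Proof.
move=> uh hP hd v; rewrite !qf_geodesic !mulr_sumr.
have key i : - d <= psi 0 i * s' - psi 0 i * s <= d.
  rewrite -mulrBr -ler_norml normrM distrC (le_trans _ hd) //.
  by rewrite ler_wpM2r // .
apply/andP; split; apply: ler_sum => i _; rewrite mulrA ler_wpM2r ?sqr_ge0 // -expRD ler_expR;
  have /andP[] := key i; lra.
Qed.

(** In the coordinates u = h^T v the form is the sum of the u_i^2 e^(psi_i s). The slope [m] is the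
    largest psi_i with u_i nonzero, attained at j say, and the remaining factor [D] stays between
    u_j^2 and |u|^2 for s >= 0. *)
Lemma growth_geodesic h psi v : h \in unitmx -> v != 0 ->
  exists (m B L : R) (D : R -> R),
    [/\ forall s, 0 < D s, forall s, ln (qf (geodesic_curve h psi s) v) = m * s + ln (D s),
        forall s, 0 <= s -> `|ln (D s)| <= B & ln (D s) @[s --> +oo] --> L].
Proof.
move=> uh v0; set u := h^T *m v.
have [j0 uj0] : exists j, u j 0 != 0.
  have [|j [k]] := @mx_neq0 _ _ u; first by rewrite unitmx_mulv_neq0 // unitmx_tr.
  by rewrite ord1; exists j.
have [j uj jmax] : extremum_spec >=%R (fun j => u j 0 != 0) (fun j => psi 0 j)
  [arg max_(j > j0 | u j 0 != 0) psi 0 j]%O by exact: arg_maxP.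
set m := psi 0 j in jmax *; pose D (s : R) := \sum_i expR ((psi 0 i - m) * s) * u i 0 ^+ 2.
have Dge s : u j 0 ^+ 2 <= D s.
  rewrite /D (bigD1 j) //= subrr mul0r expR0 mul1r lerDl sumr_ge0 // => i _.
  by rewrite mulr_ge0 ?expR_ge0 ?sqr_ge0.
have uj2 : 0 < u j 0 ^+ 2 by rewrite exprn_even_gt0.
have D0 s : 0 < D s by exact: lt_le_trans (Dge s).
have Dle s : 0 <= s -> D s <= sqn u.
  move=> s0; apply: ler_sum => i _; have [->|ui] := eqVneq (u i 0) 0.
    by rewrite expr0n mulr0.
  rewrite ler_piMl ?sqr_ge0 // -expR0 ler_expR mulr_le0_ge0 // subr_le0.
  exact: jmax.
pose L := \sum_i (if psi 0 i == m then u i 0 ^+ 2 else 0).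
have Dcvg : D s @[s --> +oo] --> L.
  apply: cvg_sumr => i _; have [e|ne] := eqVneq (psi 0 i) m.
    under eq_cvg do rewrite e subrr mul0r expR0 mul1r.
    exact: cvg_cst.
  have [->|ui] := eqVneq (u i 0) 0.
    by under eq_cvg do rewrite expr0n mulr0; exact: cvg_cst.
  have lt : 0 < m - psi 0 i by rewrite subr_gt0 lt_neqAle ne /=; exact: jmax.
  rewrite -[X in _ --> X](mul0r (u i 0 ^+ 2)); apply: cvgM; last exact: cvg_cst.
  have e s : (psi 0 i - m) * s = - ((m - psi 0 i) * s) by ring.
  under eq_cvg do rewrite e.
  by apply: expR_decay => //; exact: cvg_id.
have L0 : 0 < L.
  apply: lt_le_trans uj2 _; rewrite /L (bigD1 j) //= eqxx lerDl sumr_ge0 // => i _.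
  by case: ifP => // _; exact: sqr_ge0.
exists m, (`|ln (u j 0 ^+ 2)| + `|ln (sqn u)|), (ln L), D; split=> //.
- move=> s; rewrite -[m * s]expRK -lnM ?posrE ?expR_gt0 // qf_geodesic; congr ln.
  rewrite /D mulr_sumr; apply: eq_bigr => i _.
  by rewrite mulrA -expRD -mulrDl addrC subrK.
- move=> s s0; have su : 0 < sqn u by exact: lt_le_trans (Dle s s0).
  have h1 : ln (u j 0 ^+ 2) <= ln (D s) by rewrite ler_ln ?posrE.
  have h2 : ln (D s) <= ln (sqn u) by rewrite ler_ln ?posrE // Dle.
  have := ler_norm (ln (sqn u)); have := ler_norm (- ln (u j 0 ^+ 2)); rewrite normrN => k1 k2.
  have k3 := normr_ge0 (ln (sqn u)); have k4 := normr_ge0 (ln (u j 0 ^+ 2)).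
  by rewrite ler_norml; apply/andP; split; lra.
- by apply: continuous_cvg => //; exact: continuous_ln.
Qed.

(** A vector v dual to a coordinate with phi_i nonzero has logarithmic form phi_i t on the first
    geodesic and m s + ln D(s) on the second. Comparability at the times t and s thus forces s to be
    (phi_i t - L) / m up to a vanishing error, and moving s to this affine value costs little. *)
Lemma geodesic_strong g phi h psi : g \in unitmx -> h \in unitmx -> phi != 0 ->
  (forall d, 0 < d -> \forall t \near +oo,
     exists2 s, 0 <= s & near_le d (geodesic_curve g phi t) (geodesic_curve h psi s)) ->
  exists a b, 0 < a /\
    strongly_asymptotic (geodesic_curve g phi) (fun t => geodesic_curve h psi (a * t + b)).
Proof.
move=> ug uh phi0 H.
have [i phii] : exists i, phi 0 i != 0.
  by have [k [j]] := mx_neq0 phi0; rewrite ord1; exists j.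
pose v : 'cV[R]_n := invmx g^T *m delta_mx i 0.
have ugt : g^T \in unitmx by rewrite unitmx_tr.
have v0 : v != 0.
  rewrite unitmx_mulv_neq0 ?unitmx_inv //; apply/eqP => /matrixP /(_ i 0).
  by rewrite !mxE !eqxx => /eqP; rewrite oner_eq0.
have qmu t : ln (qf (geodesic_curve g phi t) v) = phi 0 i * t.
  rewrite qf_geodesic /v mulKVmx // (bigD1 i) //= big1 => [|j ji]; last first.
    by rewrite mxE (negPf ji) expr0n mulr0.
  by rewrite mxE !eqxx expr1n mulr1 addr0 expRK.
have [m [B [L [D [D0 Dln DB DL]]]]] := growth_geodesic psi uh v0.
have lnle d t s : near_le d (geodesic_curve g phi t) (geodesic_curve h psi s) ->
    `|m * s + ln (D s) - phi 0 i * t| <= d.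
  move=> /(_ v); rewrite -Dln -qmu.
  have [_ /(_ v v0) q1] := pdef_geodesic phi t ug.
  have [_ /(_ v v0) q2] := pdef_geodesic psi s uh.
  rewrite -{1 2}[qf (geodesic_curve g phi t) v]lnK ?posrE // -[X in _ <= X <= _ -> _]lnK ?posrE //.
  by rewrite -!expRD !ler_expR => /andP[h1 h2]; rewrite ler_norml; apply/andP; split; lra.
have Bs d t s : 0 <= s -> near_le d (geodesic_curve g phi t) (geodesic_curve h psi s) ->
    `|m * s - phi 0 i * t| <= B + d.
  move=> s0 /lnle k; have := DB s s0; move: k; rewrite !ler_norml => /andP[? ?] /andP[? ?].
  by apply/andP; split; lra.
have B0 : 0 <= B by exact: le_trans (normr_ge0 _) (DB 0 (lexx 0)).
(* Since s >= 0 and m s - phi_i t stays bounded while t grows, m and phi_i have the same sign. *)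
have a0 : 0 < phi 0 i / m.
  have [M [_ HM]] := H 1 ltr01.
  (* Beyond the threshold M, and so large that |phi_i| t >= B + 2 exceeds the bound B + 1 on |m s -
     phi_i t|. *)
  pose t := Num.max (M + 1) ((B + 2%:R) / `|phi 0 i|).
  have php : 0 < `|phi 0 i| by rewrite normr_gt0.
  have t0 : 0 < t by rewrite lt_max divr_gt0 ?orbT // ltr_wpDl.
  have [|s s0 /(Bs _ _ _ s0)] := HM t; first by rewrite lt_max ltrDl ltr01.
  have : B + 2%:R <= `|phi 0 i| * t by rewrite mulrC -ler_pdivrMr // le_max lexx orbT.
  have [pn|pp|p0] := ltgtP (phi 0 i) 0; last by rewrite p0 eqxx in phii.
    rewrite (ltr0_norm pn) => k1; rewrite ler_norml => /andP[k2 k3].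
    have : m * s < 0 by lra.
    have [s00|sn0] := eqVneq s 0; first by rewrite s00 mulr0 ltxx.
    have s1 : 0 < s by rewrite lt_neqAle eq_sym sn0 s0.
    rewrite pmulr_llt0 // => m0.
    by rewrite nmulr_rgt0 // invr_lt0.
  rewrite (gtr0_norm pp) => k1; rewrite ler_norml => /andP[k2 k3].
  have : 0 < m * s by lra.
  have [s00|sn0] := eqVneq s 0; first by rewrite s00 mulr0 ltxx.
  have s1 : 0 < s by rewrite lt_neqAle eq_sym sn0 s0.
  rewrite pmulr_lgt0 // => m0.
  by rewrite divr_gt0.
have m0 : m != 0 by apply: contraTneq a0 => ->; rewrite invr0 mulr0 ltxx.
have mp : 0 < `|m| by rewrite normr_gt0.
exists (phi 0 i / m), (- (L / m)); split => // d d0.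
pose P := 1 + \sum_j `|psi 0 j|.
have P0 : 0 < P by rewrite ltr_pwDl // sumr_ge0.
have hP j : `|psi 0 j| <= P.
  by rewrite /P (bigD1 j) //= addrCA lerDl addr_ge0 // sumr_ge0.
(* Half of d pays for the comparison at s, the other half for the time shift: P eta = d / 2, and
   each of the two errors in m (s - (a t + b)) is at most |m| eta / 2. *)
pose eta := d / (2%:R * P).
have eta0 : 0 < eta by rewrite divr_gt0 // mulr_gt0.
pose d1 := Num.min (d / 2%:R) (`|m| * eta / 2%:R).
have d10 : 0 < d1 by rewrite lt_min !divr_gt0 // mulr_gt0.
have /cvgrPdist_le /(_ (`|m| * eta / 2%:R)) [|S [_ HS]] := DL.
  by rewrite divr_gt0 // mulr_gt0.
near=> t.
have [s s0 ns] : exists2 s, 0 <= s & near_le d1 (geodesic_curve g phi t) (geodesic_curve h psi s).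
  by near: t; exact: H.
(* Because m s - phi_i t is bounded, s grows with t, so that ln D(s) is already close to its limit
   L. *)
have sS : S < s.
  have := Bs _ _ _ s0 ns.
  have tt : (S + 1 + (B + d1) / `|m|) / (phi 0 i / m) <= t.
    by near: t; apply: nbhs_pinfty_ge; rewrite num_real.
  rewrite ler_pdivrMr // in tt => k.
  have : `|s - t * (phi 0 i / m)| <= (B + d1) / `|m|.
    rewrite ler_pdivlMr // mulrC -normrM; apply: le_trans k; rewrite le_eqVlt; apply/orP; left.
    by apply/eqP; congr (`|_|); field.
  by rewrite ler_norml => /andP[? ?]; lra.
have -> : d = d / 2%:R + d / 2%:R by field.
apply: (@near_le_trans _ _ _ (geodesic_curve h psi s)).
  apply: near_le_mono ns; first exact: pdef_geodesic.
  by rewrite ge_min lexx.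
apply: (near_le_shift uh hP).
have -> : d / 2%:R = P * eta by rewrite /eta; field; rewrite gt_eqF.
rewrite ler_pM2l //.
have := HS s sS; have := lnle _ _ _ ns.
rewrite -(ler_pM2l mp) -normrM.
have -> : m * (s - (phi 0 i / m * t - L / m)) = (m * s + ln (D s) - phi 0 i * t) + (L - ln (D s)).
  by field.
move=> k1 k2; apply: le_trans (ler_normD _ _) _.
have : d1 <= `|m| * eta / 2%:R by rewrite ge_min lexx orbT.
by lra.
Unshelve. all: by end_near. Qed.

Lemma geodesic_of_unit g phi mu : g \in unitmx -> phi != 0 -> geodesic_of g phi mu ->
  exists g' phi', [/\ g' \in unitmx, phi' != 0 & mu = geodesic_curve g' phi'].
Proof.
move=> ug phi0 [a [b [a0 ->]]].
exists (g *m diag_mx (\row_i expR (phi 0 i * b / 2%:R))), (a *: phi); split.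
- rewrite (_ : \row_i _ = \row_i expR (((b / 2%:R) *: phi) 0 i)).
    exact: unit_expR_diag.
  by apply/rowP => i; rewrite !mxE; congr expR; field.
- by rewrite scaler_eq0 negb_or gt_eqF.
- by apply/funext => t; exact: geodesic_affine.
Qed.

Lemma reparam_trans (M : set (R -> 'M[R]_n)) mu a b : 0 < a -> is_geodesic M -> M mu ->
  M (fun t => mu (a * t + b)).
Proof.
move=> a0 [g [phi [_ _ ->]]] [a' [b' [a'0 ->]]].
exists (a' * a), (a' * b + b'); split; first exact: mulr_gt0.
by apply/funext => t; congr (geodesic_curve _ _ _); ring.
Qed.

(** An affine change of parameter in both curves normalizes the representative of the first geodesic
    to the given curve. *)
Lemma null_pencilE g phi (N : set (R -> 'M[R]_n)) : g \in unitmx -> phi != 0 ->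
  null_pencil (geodesic_of g phi) N <->
  is_geodesic N /\ exists2 nu, N nu & strongly_asymptotic (geodesic_curve g phi) nu.
Proof.
move=> ug phi0; split=> [[gN [mu [nu [Mmu Nnu H]]]]|[gN [nu Nnu H]]]; split=> //.
  have [g1 [phi1 [ug1 p1 muE]]] := geodesic_of_unit ug phi0 Mmu.
  have [h [psi [uh psi0 NE]]] := gN.
  have [g2 [phi2 [ug2 p2 nuE]]] : exists g' phi',
    [/\ g' \in unitmx, phi' != 0 & nu = geodesic_curve g' phi'].
    by apply: (geodesic_of_unit uh psi0); rewrite -NE.
  have [a [b [a0 S]]] : exists a b, 0 < a /\ strongly_asymptotic mu (fun t => nu (a * t + b)).
    rewrite muE nuE; apply: geodesic_strong => //; rewrite -muE -nuE.
    by apply: null_asymptotic_near_le H => t; rewrite ?muE ?nuE; exact: pdef_geodesic.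
  have [a1 [b1 [a10 muE1]]] := Mmu.
  exists (fun t => nu (a / a1 * t + (b - a * b1 / a1))).
    exact: (reparam_trans _ (divr_gt0 a0 a10) gN Nnu).
  have := strong_affine (- (b1 / a1)) (_ : 0 < a1^-1) S; rewrite invr_gt0 => /(_ a10).
  have -> : (fun t => mu (a1^-1 * t - b1 / a1)) = geodesic_curve g phi.
    apply/funext => t; rewrite muE1; congr (geodesic_curve _ _ _).
    by field; rewrite gt_eqF.
  have -> // : (fun t => nu (a * (a1^-1 * t - b1 / a1) + b)) =
    (fun t => nu (a / a1 * t + (b - a * b1 / a1))).
  by apply/funext => t; congr (nu _); field; rewrite gt_eqF.
have [h [psi [uh psi0 NE]]] := gN.
have [g2 [phi2 [ug2 p2 nuE]]] : exists g' phi',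
    [/\ g' \in unitmx, phi' != 0 & nu = geodesic_curve g' phi'].
  by apply: (geodesic_of_unit uh psi0); rewrite -NE.
exists (geodesic_curve g phi), nu; split => //.
  by exists 1, 0; split=> //; apply/funext => t; rewrite mul1r addr0.
by apply: strong_null_asymptotic H => t; rewrite ?nuE; exact: pdef_geodesic.
Qed.

Lemma null_pencil_sub g1 phi1 g2 phi2 a b : g1 \in unitmx -> g2 \in unitmx ->
  phi1 != 0 -> phi2 != 0 -> 0 < a ->
  strongly_asymptotic (geodesic_curve g1 phi1) (fun t => geodesic_curve g2 phi2 (a * t + b)) ->
  null_pencil (geodesic_of g1 phi1) `<=` null_pencil (geodesic_of g2 phi2).
Proof.
move=> u1 u2 p1 p2 a0 S N /null_pencilE [] // gN [nu Nnu H].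
apply/null_pencilE => //; split=> //.
exists (fun t => nu (a^-1 * t - b / a)); first by apply: (reparam_trans _ _ gN Nnu); rewrite invr_gt0.
have := strong_affine (- (b / a)) (_ : 0 < a^-1) (strong_trans (strong_sym S) H).
rewrite invr_gt0 => /(_ a0).
have -> // : (fun t => geodesic_curve g2 phi2 (a * (a^-1 * t - b / a) + b)) =
  geodesic_curve g2 phi2.
by apply/funext => t; congr (geodesic_curve _ _ _); field; rewrite gt_eqF.
Qed.

Lemma null_pencil_eqP g1 phi1 g2 phi2 : g1 \in unitmx -> g2 \in unitmx ->
  phi1 != 0 -> phi2 != 0 ->
  null_pencil (geodesic_of g1 phi1) = null_pencil (geodesic_of g2 phi2) <->
  exists a b, 0 < a /\
    strongly_asymptotic (geodesic_curve g1 phi1) (fun t => geodesic_curve g2 phi2 (a * t + b)).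
Proof.
move=> u1 u2 p1 p2; split=> [E|[a [b [a0 S]]]].
  have : null_pencil (geodesic_of g2 phi2) (geodesic_of g2 phi2).
    apply/null_pencilE => //; split; first by exists g2, phi2.
    exists (geodesic_curve g2 phi2).
      by exists 1, 0; split=> //; apply/funext => t; rewrite mul1r addr0.
    move=> d d0; apply: nearW => t; apply: near_le_refl; last exact: ltW.
    exact: pdef_geodesic.
  by rewrite -E => /null_pencilE [] // _ [_ [a [b [a0 ->]]] S]; exists a, b.
apply/seteqP; split; first exact: null_pencil_sub S.
apply: (@null_pencil_sub _ _ _ _ a^-1 (- (b / a))) => //; first by rewrite invr_gt0.
have := strong_affine (- (b / a)) (_ : 0 < a^-1) (strong_sym S).
rewrite invr_gt0 => /(_ a0).
have -> // : (fun t => geodesic_curve g2 phi2 (a * (a^-1 * t - b / a) + b)) =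
  geodesic_curve g2 phi2.
by apply/funext => t; congr (geodesic_curve _ _ _); field; rewrite gt_eqF.
Qed.

End Pencils.

(** * Limits of orbits in a representation *)

Section RegularFunctions.
Variables (R : realType) (n : nat).
Implicit Types (g : 'M[R]_n) (f : ('I_n -> R) -> R).

Definition regular_fun (f : 'M[R]_n -> R) : Prop :=
  exists (N : nat) (P : mpoly.mpoly (n * n) R),
    {in unitmx, forall g, \det g ^+ N * f g = mpoly.meval (fun l => mxvec g 0 l) P}.

Lemma regular_fun0 : regular_fun (fun=> 0).
Proof. by exists 0%N, (0 : mpoly.mpoly (n * n) R) => g _; rewrite mulr0 mpoly.meval0. Qed.

Lemma mlim_regular (T : Type) (F : set_system T) {FF : Filter F}
    (f : 'M[R]_n -> R) (x : T -> 'M[R]_n) A :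
  regular_fun f -> mlim F x A -> A \in unitmx -> f (x t) @[t --> F] --> f A.
Proof.
move=> [N [P fP]] xA uA.
have dA : \det A ^+ N != 0 by rewrite expf_neq0 // -unitfE -unitmxE.
have E g : g \in unitmx -> f g = (\det g ^+ N)^-1 * mpoly.meval (fun l => mxvec g 0 l) P.
  move=> ug; rewrite -fP // mulKf // expf_neq0 // -unitfE -unitmxE //.
rewrite (E A uA).
have h : (\det (x t) ^+ N)^-1 * mpoly.meval (fun l => mxvec (x t) 0 l) P @[t --> F] -->
    (\det A ^+ N)^-1 * mpoly.meval (fun l => mxvec A 0 l) P.
  apply: cvgM; first by apply: cvgV => //; apply: cvg_expr; exact: mlim_det.
  rewrite mpoly.mevalE; under eq_cvg do rewrite mpoly.mevalE.
  apply: cvg_sumr => m _; apply: cvgM; first exact: cvg_cst.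
  apply: cvg_prodr => l _; apply: cvg_expr; case/mxvec_indexP: l => i j.
  by rewrite mxvecE; under eq_cvg do rewrite mxvecE; exact: xA.
apply: cvg_trans h; apply: near_eq_cvg.
by apply: filterS (mlim_unitmx xA uA) => t ut; rewrite E.
Qed.

Definition weight_pairing (la : {ffun 'I_n -> int}) (s : 'I_n -> R) : R :=
  \sum_j (la j)%:~R * s j.

Lemma weight_pairingD la s t :
  weight_pairing la (fun j => s j + t j) = weight_pairing la s + weight_pairing la t.
Proof. by rewrite -big_split; apply: eq_bigr => j _; rewrite mulrDr. Qed.

Lemma weight_pairingZ la c s :
  weight_pairing la (fun j => c * s j) = c * weight_pairing la s.
Proof. by rewrite mulr_sumr; apply: eq_bigr => j _; rewrite mulrCA. Qed.

Definition exp_diag (s : 'I_n -> R) : 'M[R]_n := diag_mx (\row_i expR (s i)).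

Lemma unit_exp_diag s : exp_diag s \in unitmx.
Proof.
rewrite unitmxE unitfE det_diag prodf_seq_neq0.
by apply/allP => i _; rewrite mxE gt_eqF // expR_gt0.
Qed.

Lemma exp_diagD s t : exp_diag (fun j => s j + t j) = exp_diag s *m exp_diag t.
Proof.
by rewrite /exp_diag mulmx_diag; congr diag_mx; apply/rowP => i; rewrite !mxE expRD.
Qed.

(** Finite real combinations of integral characters of the positive torus, read in logarithmic
    coordinates. *)
Definition exp_sum f : Prop :=
  exists S : seq ({ffun 'I_n -> int} * R),
    forall s, f s = \sum_(p <- S) expR (weight_pairing p.1 s) * p.2.

Lemma exp_sum_ext f f' : (forall s, f s = f' s) -> exp_sum f -> exp_sum f'.
Proof. by move=> e [S hS]; exists S => s; rewrite -e. Qed.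

Lemma exp_sum_cst c : exp_sum (fun=> c).
Proof.
exists [:: ([ffun=> 0], c)] => s; rewrite big_seq1 /weight_pairing big1 ?expR0 ?mul1r //.
by move=> j _; rewrite ffunE mul0r.
Qed.

Lemma exp_sum_exp la : exp_sum (fun s => expR (weight_pairing la s)).
Proof. by exists [:: (la, 1)] => s; rewrite big_seq1 mulr1. Qed.

Lemma exp_sumD f f' : exp_sum f -> exp_sum f' -> exp_sum (fun s => f s + f' s).
Proof. by move=> [S hS] [S' hS']; exists (S ++ S') => s; rewrite big_cat hS hS'. Qed.

Lemma exp_sumM f f' : exp_sum f -> exp_sum f' -> exp_sum (fun s => f s * f' s).
Proof.
move=> [S hS] [S' hS'].
pose pr (p q : {ffun 'I_n -> int} * R) : {ffun 'I_n -> int} * R :=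
  ([ffun j => p.1 j + q.1 j], p.2 * q.2).
exists [seq pr p q | p <- S, q <- S'] => s.
rewrite big_allpairs_dep /= hS mulr_suml; apply: eq_bigr => p _.
rewrite hS' mulr_sumr; apply: eq_bigr => q _ /=.
have -> : weight_pairing [ffun j => p.1 j + q.1 j] s = weight_pairing p.1 s + weight_pairing q.1 s.
  by rewrite -big_split; apply: eq_bigr => j _; rewrite ffunE intrD mulrDl.
by rewrite expRD; ring.
Qed.

Lemma exp_sum_sum (I : Type) (r : seq I) (P : pred I) (f : I -> ('I_n -> R) -> R) :
  (forall i, exp_sum (f i)) -> exp_sum (fun s => \sum_(i <- r | P i) f i s).
Proof.
move=> h; elim: r => [|i r IH].
  by apply: exp_sum_ext (exp_sum_cst 0) => s; rewrite big_nil.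
case Pi : (P i).
  by apply: exp_sum_ext (exp_sumD (h i) IH) => s; rewrite big_cons Pi.
by apply: exp_sum_ext IH => s; rewrite big_cons Pi.
Qed.

Lemma exp_sum_prod (I : Type) (r : seq I) (f : I -> ('I_n -> R) -> R) :
  (forall i, exp_sum (f i)) -> exp_sum (fun s => \prod_(i <- r) f i s).
Proof.
move=> h; elim: r => [|i r IH].
  by apply: exp_sum_ext (exp_sum_cst 1) => s; rewrite big_nil.
by apply: exp_sum_ext (exp_sumM (h i) IH) => s; rewrite big_cons.
Qed.

Lemma exp_sum_expn f k : exp_sum f -> exp_sum (fun s => f s ^+ k).
Proof.
move=> h; elim: k => [|k IH]; first by apply: exp_sum_ext (exp_sum_cst 1) => s; rewrite expr0.
by apply: exp_sum_ext (exp_sumM h IH) => s; rewrite exprS.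
Qed.

Lemma exp_sum_regular (f : 'M[R]_n -> R) : regular_fun f -> exp_sum (fun s => f (exp_diag s)).
Proof.
move=> [N [P fP]].
(* The factor det^-N restricts to the character of constant weight -N. *)
pose la : {ffun 'I_n -> int} := [ffun=> - N%:Z].
apply: (@exp_sum_ext (fun s => expR (weight_pairing la s) *
   mpoly.meval (fun l => mxvec (exp_diag s) 0 l) P)) => [s|].
  rewrite -fP ?unit_exp_diag // mulrA.
  have -> : \det (exp_diag s) = expR (\sum_j s j).
    by rewrite det_diag expR_sum; apply: eq_bigr => i _; rewrite mxE.
  rewrite -expRM_natl -expRD.
  have -> : weight_pairing la s = - (N%:R * \sum_j s j).
    rewrite mulr_sumr -sumrN; apply: eq_bigr => j _.
    by rewrite ffunE rmorphN mulNr.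
  by rewrite addNr expR0 mul1r.
apply: exp_sumM; first exact: exp_sum_exp.
apply: (@exp_sum_ext (fun s => \sum_(m <- mpoly.msupp P) mpoly.mcoeff m P *
   \prod_l mxvec (exp_diag s) 0 l ^+ (mpoly.fun_of_multinom m l))) => [s|].
  by rewrite mpoly.mevalE.
apply: exp_sum_sum => m; apply: exp_sumM; first exact: exp_sum_cst.
apply: exp_sum_prod => l; apply: exp_sum_expn; case/mxvec_indexP: l => i j.
have [->|ij] := eqVneq i j.
  pose e : {ffun 'I_n -> int} := [ffun k => (k == j)%:Z].
  apply: exp_sum_ext (exp_sum_exp e) => s; rewrite mxvecE !mxE eqxx mulr1n.
  congr expR; rewrite /weight_pairing (bigD1 j) //= big1 => [|k kj].
    by rewrite ffunE eqxx mul1r addr0.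
  by rewrite ffunE (negPf kj) mul0r.
by apply: exp_sum_ext (exp_sum_cst 0) => s; rewrite mxvecE !mxE (negPf ij).
Qed.

End RegularFunctions.

(** * Expansion of a torus orbit into exponentials *)

Section WeightExpansion.
Variables (R : realType) (n D : nat) (rho : 'M[R]_n -> 'M[R]_D) (h : 'cV[R]_D).
Hypothesis rep_rho : is_rep rho.
Hypothesis reg_rho : forall a b, regular_fun (fun g => rho g a b).
Hypothesis h_neq0 : h != 0.

Lemma rep_unit g : g \in unitmx -> rho g \in unitmx.
Proof.
move=> ug; have [r1 rM] := rep_rho.
have e : rho g *m rho (invmx g) = 1%:M by rewrite -rM ?unitmx_inv // mulmxV.
by have [] := mulmx1_unit e.
Qed.

Lemma mlim_rep (T : Type) (F : set_system T) {FF : Filter F} (x : T -> 'M[R]_n) A :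
  mlim F x A -> A \in unitmx -> mlim F (fun t => rho (x t)) (rho A).
Proof. by move=> xA uA i j; exact: (mlim_regular (reg_rho i j) xA uA). Qed.

(** Weights may repeat and no weight spaces are involved: minimality of the length will stand in for
    the linear independence of the terms. *)
Definition expands (S : seq ({ffun 'I_n -> int} * 'cV[R]_D)) : Prop :=
  forall s, rho (exp_diag s) *m h = \sum_(p <- S) expR (weight_pairing p.1 s) *: p.2.

Lemma expands_ex : exists S, expands S.
Proof.
have eA a : exp_sum (fun s => (rho (exp_diag s) *m h) a 0).
  apply: (@exp_sum_ext _ _ (fun s => \sum_b rho (exp_diag s) a b * h b 0)) => [s|].
    by rewrite mxE.
  apply: (@exp_sum_sum _ _ _ _ _ (fun b s => rho (exp_diag s) a b * h b 0)) => b.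
  apply: (@exp_sumM _ _ (fun s => rho (exp_diag s) a b) (fun=> h b 0)).
    exact: (exp_sum_regular (reg_rho a b)).
  exact: exp_sum_cst.
have /choice [S hS] := eA.
exists [seq (q.1, q.2 *: (delta_mx a 0 : 'cV[R]_D)) | a <- enum 'I_D, q <- S a] => s.
apply/matrixP => i j; rewrite ord1 summxE big_allpairs_dep /= hS.
rewrite big_enum /= (bigD1 i) //= [X in _ + X]big1 ?addr0 => [|a ai].
  by apply: eq_bigr => p _; rewrite !mxE !eqxx mulr1.
apply: big1_seq => p _; rewrite !mxE [i == a]eq_sym (negPf ai) /= !mulr0 //.
Qed.

Lemma expansion_limit S (k : 'I_n -> R) (F : pred ({ffun 'I_n -> int} * 'cV[R]_D)) m s :
  expands S ->
  {in S, forall p, F p -> weight_pairing p.1 k = m} ->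
  {in S, forall p, ~~ F p -> weight_pairing p.1 k < m} ->
  mlim (pinfty_nbhs R) (fun tau => expR (- (tau * m)) *:
      (rho (exp_diag (fun j => s j + tau * k j)) *m h))
    (\sum_(p <- S | F p) expR (weight_pairing p.1 s) *: p.2).
Proof.
move=> hS Fm Fl.
rewrite (_ : \sum_(p <- S | F p) _ =
    \sum_(p <- S) (expR (weight_pairing p.1 s) * (F p)%:R) *: p.2); last first.
  rewrite big_mkcond; apply: eq_bigr => p _; case: (F p); rewrite ?mulr1 //.
  by rewrite mulr0 scale0r.
apply: (@mlim_near _ _ _ _ _ _ (fun tau => \sum_(p <- S) (expR (weight_pairing p.1 s) *
      expR (tau * (weight_pairing p.1 k - m))) *: p.2)).
  apply: nearW => tau; rewrite hS scaler_sumr; apply: eq_bigr => p _.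
  by rewrite scalerA -!expRD weight_pairingD weight_pairingZ; congr (expR _ *: _); ring.
apply: mlim_sum => p pS; apply: mlimZ; last exact: mlim_cst.
apply: cvgM; first exact: cvg_cst.
have [Fp|/(Fl p pS)] := boolP (F p).
  under eq_cvg do rewrite (Fm p pS Fp) subrr mulr0 expR0.
  exact: cvg_cst.
rewrite -subr_gt0 => lt.
have e tau : tau * (weight_pairing p.1 k - m) = - ((m - weight_pairing p.1 k) * tau) by ring.
under eq_cvg do rewrite e.
by apply: expR_decay => //; exact: cvg_id.
Qed.

(* If a face sum vanished at s0, translating by the torus would make it vanish
   identically, and its terms could be dropped from the shortest expansion. *)
Lemma minimal_expansion : exists2 S, expands S &
  forall (k : 'I_n -> R) (F : pred ({ffun 'I_n -> int} * 'cV[R]_D)) m,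
    has F S ->
    {in S, forall p, F p -> weight_pairing p.1 k = m} ->
    {in S, forall p, ~~ F p -> weight_pairing p.1 k < m} ->
    forall s0, \sum_(p <- S | F p) expR (weight_pairing p.1 s0) *: p.2 != 0.
Proof.
have [S0 hS0] := expands_ex.
have ex : exists r, `[< exists2 S, expands S & size S = r >].
  by exists (size S0); apply/asboolP; exists S0.
case: (ex_minnP ex) => r /asboolP [S hS Sr] rmin; exists S => // k F m hasF Fm Fl s0.
apply/eqP => VF0.
have key s : \sum_(p <- S | F p) expR (weight_pairing p.1 s) *: p.2 = 0.
  have lim1 := expansion_limit (s := s) hS Fm Fl.
  have lim2 : mlim (pinfty_nbhs R) (fun tau => expR (- (tau * m)) *:
      (rho (exp_diag (fun j => s j + tau * k j)) *m h)) 0.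
    rewrite -[0](mulmx0 1 (rho (exp_diag (fun j => s j - s0 j)))) -VF0.
    apply: (@mlim_near _ _ _ _ _ _ (fun tau => rho (exp_diag (fun j => s j - s0 j)) *m
       (expR (- (tau * m)) *: (rho (exp_diag (fun j => s0 j + tau * k j)) *m h)))).
      apply: nearW => tau; rewrite -scalemxAr mulmxA; have [_ <-] := rep_rho; rewrite ?unit_exp_diag //.
      rewrite -exp_diagD; congr (_ *: (rho (exp_diag _) *m h)).
      by apply/funext => j; rewrite addrA subrK.
    by apply: mlimM; [exact: mlim_cst|exact: expansion_limit].
  apply/matrixP => i j; apply: (cvg_unique (@Rhausdorff R) (lim1 i j) (lim2 i j)).
have : (r <= size [seq p <- S | ~~ F p])%N.
  apply: rmin; apply/asboolP; exists [seq p <- S | ~~ F p] => // s.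
  by rewrite hS (bigID F) /= key add0r big_filter.
by rewrite size_filter -Sr -(count_predC F S) leqNgt -{1}[count _ S]add0n ltn_add2r -has_count hasF.
Qed.

End WeightExpansion.

Section ProjectiveLimits.
Variables (R : realType) (D : nat).
Implicit Types (u v : 'cV[R]_D).

Lemma vline_scale (c : R) u : c != 0 -> <[c *: u]>%VS = <[u]>%VS.
Proof.
move=> c0; apply/eqP; rewrite eqEsubv -!memvE memvZ ?memv_line //=.
by apply/vlineP; exists c^-1; rewrite scalerA mulVf // scale1r.
Qed.

Lemma vline_eqP u v : u != 0 -> <[u]>%VS = <[v]>%VS -> exists2 c : R, c != 0 & u = c *: v.
Proof.
move=> u0 e; have : u \in <[v]>%VS by rewrite -e memv_line.
case/vlineP => c uc; exists c => //; apply: contraNneq u0 => c0.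
by rewrite uc c0 scale0r.
Qed.

Lemma pspace_cvg_line (F : R -> {vspace 'cV[R]_D}) (v : R -> 'cV[R]_D) v0 :
  v0 != 0 -> mlim (0^'+) v v0 -> (\forall z \near 0^'+, F z = <[v z]>%VS) ->
  pspace_cvg F <[v0]>%VS.
Proof.
move=> n0 /mlim_cvg vv0 FE; split; first by rewrite /proj_space /= dim_vline n0.
move=> U oU Uv0; have : nbhs v0 [set v | v != 0 /\ U <[v]>%VS] by apply: open_nbhs_nbhs.
by move/vv0; apply: filterS2 FE => z -> [].
Qed.

(** Proportionality is the vanishing of the two by two minors of a pair of vectors, a closed
    condition; this takes the place of a separation property of the quotient topology. *)
Lemma vline_lim_unique (T : Type) (F : set_system T) {FF : ProperFilter F}
    (v w : T -> 'cV[R]_D) v0 w0 :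
  v0 != 0 -> w0 != 0 -> mlim F v v0 -> mlim F w w0 ->
  (\forall t \near F, <[v t]>%VS = <[w t]>%VS) -> <[v0]>%VS = <[w0]>%VS.
Proof.
move=> n0 m0 vv ww e.
have minor i j : v0 i 0 * w0 j 0 = v0 j 0 * w0 i 0.
  apply: (cvg_unique (@Rhausdorff R) (F := fmap (fun t => v t i 0 * w t j 0) F)).
    by apply: cvgM; [exact: vv|exact: ww].
  apply: (@cvg_trans _ ((fun t => v t j 0 * w t i 0) @ F)); last first.
    by apply: cvgM; [exact: vv|exact: ww].
  apply: near_eq_cvg; apply: filterS e => t et.
  have : v t \in <[w t]>%VS by rewrite -et memv_line.
  by case/vlineP => c ->; rewrite !mxE; ring.
have [j [k]] := mx_neq0 m0; rewrite ord1 => wj.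
have vE : v0 = (v0 j 0 / w0 j 0) *: w0.
  apply/matrixP => i l; rewrite ord1 !mxE; apply: (mulIf wj); rewrite minor.
  by field.
rewrite vE vline_scale //; apply: contraNneq n0 => c0.
by rewrite vE c0 scale0r.
Qed.

End ProjectiveLimits.

(** Convergence of the series is only known pointwise. Convergence at one r > 0 bounds the terms a_i
    r^i by B, and for 0 < z <= r / 2 comparison with a geometric series bounds |f z - a_0| by 2 B z
    / r. *)
Lemma analytic_at0_cvg (R : realType) (f : R -> R) : analytic_at0 f ->
  f z @[z --> 0^'+] --> f 0.
Proof.
move=> [a af].
have f0 : f 0 = a 0%N.
  (* The neighbourhood contains 0 itself, where every nonempty partial sum equals [a 0]. *)
  have /(cvg_unique (@Rhausdorff R)) := nbhs_singleton af; apply.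
  apply: (@cvg_trans _ ((fun=> a 0%N) @ \oo)); last exact: cvg_cst.
  apply: near_eq_cvg; near=> m; rewrite /pseries /series /=.
  have m0 : (0 < m)%N by near: m; exact: nbhs_infty_gt.
  by rewrite big_ltn // expr0 mulr1 big_nat big1 ?addr0 // => i /andP[i0 _]; rewrite expr0n gtn_eqF // mulr0.
have [r r0 hr] : exists2 r : R, 0 < r & pseries a r @ \oo --> f r.
  near (0:R)^'+ => r; exists r; first by near: r; exact: nbhs_right_gt.
  by near: r; exact: cvg_within.
have [B B0 hB] : exists2 B : R, 0 < B & forall i, `|a i * r ^+ i| <= B.
  have /cvg_series_cvg_0 : cvgn (pseries a r) by apply/cvg_ex; exists (f r).
  move=> /cvgP /cvg_seq_bounded [M [_ HM]].
  exists (`|M| + 1); first by rewrite ltr_wpDl.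
  by move=> i; apply: (HM (`|M| + 1)) => //; rewrite (le_lt_trans (ler_norm M)) // ltrDl.
apply/cvgrPdist_le => e e0; near=> z.
have z0 : 0 < z by near: z; exact: nbhs_right_gt.
have zf : pseries a z @ \oo --> f z by near: z; exact: cvg_within.
pose q := z / r.
have q0 : 0 < q by exact: divr_gt0.
have q2 : q <= 2%:R^-1.
  rewrite ler_pdivrMr //; near: z; apply: nbhs_right_le.
  by rewrite mulr_gt0 // invr_gt0.
have bound m : `|pseries a z m.+1 - a 0%N| <= 2%:R * B * q.
  rewrite /pseries /series /= big_nat_recl //= expr0 mulr1 addrC addKr.
  apply: le_trans (ler_norm_sum _ _ _) _.
  apply: (@le_trans _ _ (\sum_(0 <= i < m) B * q * 2%:R^-1 ^+ i)).
    apply: ler_sum => i _.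
    have -> : a i.+1 * z ^+ i.+1 = (a i.+1 * r ^+ i.+1) * q ^+ i.+1.
      by rewrite -mulrA -exprMn /q mulrCA divff ?mulr1 // gt_eqF.
    rewrite normrM [`|q ^+ _|]ger0_norm ?exprn_ge0 ?(ltW q0) // (exprS q) mulrA.
    apply: ler_pM.
    - by rewrite mulr_ge0 // ltW.
    - by rewrite exprn_ge0 // ltW.
    - by rewrite ler_wpM2r // ltW.
    - by rewrite lerXn2r ?nnegrE ?invr_ge0 ?(ltW q0).
  rewrite -mulr_sumr (_ : 2%:R * B * q = B * q * 2%:R); last by ring.
  apply: ler_wpM2l; first exact: mulr_ge0 (ltW B0) (ltW q0).
  have -> : \sum_(0 <= i < m) (2%:R^-1 : R) ^+ i = 2%:R - 2%:R * 2%:R^-1 ^+ m.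
    elim: m => [|m IH]; first by rewrite big_geq // expr0 mulr1 subrr.
    by rewrite big_nat_recr //= IH exprS; field.
  by rewrite lerBlDr lerDl mulr_ge0 // exprn_ge0 // invr_ge0.
rewrite f0 distrC.
apply: (@le_trans _ _ (2%:R * B * q)).
  have h1 : `|pseries a z m.+1 - a 0%N| @[m --> \oo] --> `|f z - a 0%N|.
    apply: cvg_norm; apply: cvgB; last exact: cvg_cst.
    by rewrite (cvg_shiftS (pseries a z)).
  by apply: (cvgr_to_le h1); apply: nearW; exact: bound.
rewrite /q mulrA ler_pdivrMr //.
rewrite mulrC -ler_pdivlMr ?mulr_gt0 //; near: z; apply: nbhs_right_le.
by apply: divr_gt0; apply: mulr_gt0.
Unshelve. all: by end_near. Qed.

Section TriangularLimits.
Variables (R : realType) (n : nat) (T : Type) (F : set_system T).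
Context {FF : Filter F}.

Lemma near_cvg (f g : T -> R) (l : R) :
  f @ F --> l -> (\forall x \near F, f x = g x) -> g @ F --> l.
Proof.
move=> fl fg; apply: cvg_trans fl; apply: near_eq_cvg.
by apply: filterS fg => x ->.
Qed.

(** Induction on columns: column j of u u^T involves only earlier columns and the products u_ij
    u_jj. The earlier limits therefore give that of u_jj^2, then that of u_jj > 0, then that of the
    whole column. *)
Lemma cholesky_cvg1 (u : T -> 'M[R]_n) : (forall t, is_trig_mx (u t)) ->
  (forall t i, 0 < u t i i) -> mlim F (fun t => u t *m (u t)^T) 1%:M -> mlim F u 1%:M.
Proof.
move=> tu u0 uu.
have uuE t (i j : 'I_n) : (u t *m (u t)^T) i j =
    \sum_(l < n | (l < j)%N) u t i l * u t j l + u t i j * u t j j.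
  rewrite mxE (bigID (fun l : 'I_n => (l < j)%N)) /=; congr (_ + _).
    by apply: eq_bigr => l _; rewrite mxE.
  rewrite (bigD1 j) ?ltnn //= mxE big1 ?addr0 // => l /andP[jl lj].
  have /is_trig_mxP tt := tu t; rewrite [_^T _ _]mxE (tt j l) ?mulr0 //.
  by rewrite ltn_neqAle eq_sym lj leqNgt.
suff H m : forall j : 'I_n, (j < m)%N -> forall i, u t i j @[t --> F] --> (1%:M : 'M[R]_n) i j.
  by move=> i j; exact: (H j.+1).
elim: m => // m IH j jm i.
have S i' : \sum_(l < n | (l < j)%N) u t i' l * u t j l @[t --> F] -->
    \sum_(l < n | (l < j)%N) (1%:M : 'M[R]_n) i' l * (1%:M : 'M[R]_n) j l.
  apply: cvg_sumr => l lj; have lm : (l < m)%N by exact: leq_trans lj jm.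
  by apply: cvgM; exact: IH.
have S0 i' : \sum_(l < n | (l < j)%N) (1%:M : 'M[R]_n) i' l * (1%:M : 'M[R]_n) j l = 0.
  by apply: big1 => l lj; rewrite [X in _ * X]mxE -val_eqE /= gtn_eqF // mulr0.
have P i' : u t i' j * u t j j @[t --> F] --> (1%:M : 'M[R]_n) i' j.
  rewrite -[X in _ --> X]subr0 -(S0 i'); apply: near_cvg (cvgB (uu i' j) (S i')) _.
  by apply: nearW => t; rewrite -[LHS]/((u t *m (u t)^T) i' j - _) uuE addrAC subrr add0r.
have Pj : u t j j @[t --> F] --> (1 : R).
  have : Num.sqrt (u t j j * u t j j) @[t --> F] --> Num.sqrt 1.
    by apply: continuous_cvg; [exact: sqrt_continuous|have := P j; rewrite mxE eqxx].
  rewrite sqrtr1 => H1; apply: near_cvg H1 _; apply: nearW => t.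
  by rewrite -expr2 sqrtr_sqr gtr0_norm.
have [->|ij] := eqVneq i j; first by rewrite mxE eqxx.
rewrite -[X in _ --> X]mulr1 -[X in _ * X]invr1.
apply: near_cvg (cvgM (P i) (cvgV (oner_neq0 _) Pj)) _.
by apply: nearW => t /=; rewrite mulfK // gt_eqF.
Qed.

End TriangularLimits.

Lemma exprz_expR (R : realType) (z : R) (k : int) : 0 < z -> z ^ k = expR (k%:~R * ln z).
Proof.
move=> z0; have pos m : z ^+ m = expR (m%:R * ln z).
  by rewrite expRM_natl lnK // posrE.
case: k => m; first by rewrite -exprnP pos.
by rewrite NegzE -exprnN pos -expRN rmorphN mulNr.
Qed.

Lemma seq_argmax (R : realType) (I : eqType) (r : seq I) (f : I -> R) :
  (exists i, i \in r) -> exists2 i, i \in r & {in r, forall j, f j <= f i}.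
Proof.
case=> q; elim: r q => // p s IH q _.
case: s IH => [|p' s] IH.
  by exists p; [rewrite inE|move=> p'; rewrite inE => /eqP ->].
have [p1 p1s h1] := IH p' (mem_head _ _).
have [le|lt] := leP (f p) (f p1).
  by exists p1 => [|p2]; rewrite inE ?p1s ?orbT // => /predU1P[->//|/h1].
exists p; first exact: mem_head.
by move=> p2; rewrite inE => /predU1P[->//|/h1 le2]; exact: le_trans le2 (ltW lt).
Qed.

(** * Limits of a spherical orbit along curves and geodesics *)

Section OrbitLimits.
Variables (R : realType) (n D : nat) (rho : 'M[R]_n -> 'M[R]_D) (h : 'cV[R]_D).
Hypothesis rep_rho : is_rep rho.
Hypothesis reg_rho : forall a b, regular_fun (fun g => rho g a b).
Hypothesis h_neq0 : h != 0.
Hypothesis h_orth : forall k, k *m k^T = 1%:M -> rho k *m h = h.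

Lemma orbit_eq g x : g \in unitmx -> g *m g^T = x *m x^T -> rho x *m h = rho g *m h.
Proof.
move=> ug /(eq_mulT_orth ug) [q qq ->]; have uq : q \in unitmx by have [] := mulmx1_unit qq.
by have [_ rM] := rep_rho; rewrite (rM g q ug uq) -mulmxA h_orth.
Qed.

Lemma orbit_neq0 g : g \in unitmx -> rho g *m h != 0.
Proof. by move=> ug; apply: unitmx_mulv_neq0 => //; exact: rep_unit. Qed.

Lemma leading_vector (k : 'I_n -> R) : exists M v, v != 0 /\
  mlim (pinfty_nbhs R)
    (fun tau => expR (- (tau * M)) *: (rho (exp_diag (fun j => tau * k j)) *m h)) v.
Proof.
have [S hS minS] := minimal_expansion h rep_rho reg_rho.
have S0 : exists p0, p0 \in S.
  have := hS (fun=> 0); case: (S) => [|p s]; last by exists p; rewrite inE eqxx.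
  rewrite big_nil => e; have := orbit_neq0 (unit_exp_diag (fun=> 0)).
  by rewrite e eqxx.
have [p0 p0S p0max] : exists2 p0, p0 \in S &
    {in S, forall p, weight_pairing p.1 k <= weight_pairing p0.1 k}.
  by apply: seq_argmax; case: S0 => q qS; exists q.
set m := weight_pairing p0.1 k in p0max.
pose F (p : {ffun 'I_n -> int} * 'cV[R]_D) := weight_pairing p.1 k == m.
have hF : has F S by apply/hasP; exists p0; rewrite // /F eqxx.
have Fm : {in S, forall p, F p -> weight_pairing p.1 k = m} by move=> p _ /eqP.
have Fl : {in S, forall p, ~~ F p -> weight_pairing p.1 k < m}.
  by move=> p pS ne; rewrite lt_neqAle ne p0max.
exists m, (\sum_(p <- S | F p) expR (weight_pairing p.1 (fun=> 0)) *: p.2); split.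
  exact: minS hF Fm Fl _.
apply: mlim_near (expansion_limit (s := fun=> 0) hS Fm Fl); apply: nearW => tau.
by congr (_ *: (rho (exp_diag _) *m h)); apply/funext => j; rewrite add0r.
Qed.

Lemma ln_half_cvg : (- (ln z / 2%:R) : R) @[z --> (0:R)^'+] --> +oo.
Proof.
apply/cvgryPge => A; near=> z.
have z0 : 0 < z by near: z; exact: nbhs_right_gt.
have : z <= expR (- (2%:R * A)) by near: z; apply: nbhs_right_le; exact: expR_gt0.
rewrite -{1}[z]lnK ?posrE // ler_expR => ?; lra.
Unshelve. all: by end_near. Qed.

(** With tau = - ln z / 2 one has z^(-k) = e^(2 tau k), so this is a factor x with X z = x x^T; the
    representation acts through x, not through X. *)
Definition sqrt_curve (g : R -> 'M[R]_n) (k : 'I_n -> int) (z : R) : 'M[R]_n :=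
  g z *m exp_diag (fun j => - (ln z / 2%:R) * (k j)%:~R).

Lemma diagonalized_sqrt X g k : diagonalized_by X g k ->
  [/\ mlim ((0:R)^'+) g (g 0), \forall z \near (0:R)^'+, g z \in unitmx
    & \forall z \near (0:R)^'+, X z = sqrt_curve g k z *m (sqrt_curve g k z)^T].
Proof.
move=> [_ ag u0 XE]; have mg : mlim ((0:R)^'+) g (g 0).
  by move=> i j; exact: (analytic_at0_cvg (ag i j)).
split=> //; first exact: mlim_unitmx mg u0.
near=> z; have z0 : 0 < z by near: z; exact: nbhs_right_gt.
have -> : X z = g z *m diag_mx (\row_i z ^ (- k i)) *m (g z)^T by near: z.
rewrite /sqrt_curve trmx_mul tr_diag_mx !mulmxA; congr (_ *m _); rewrite -!mulmxA.
congr (_ *m _); rewrite mulmx_diag; congr diag_mx; apply/rowP => i; rewrite !mxE -expRD.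
rewrite exprz_expR // rmorphN.
by congr expR; field.
Unshelve. all: by end_near. Qed.

Lemma diagonalized_limit X g k : diagonalized_by X g k ->
  exists (M : R) (v : 'cV[R]_D), [/\ v != 0,
    mlim (pinfty_nbhs R)
      (fun tau => expR (- (tau * M)) *: (rho (exp_diag (fun j => tau * (k j)%:~R)) *m h)) v
    & pspace_cvg (fun z => <[rho (xget 1%:M [set g | g \in unitmx /\ X z = g *m g^T]) *m h]>%VS)
        <[rho (g 0%R) *m v]>%VS].
Proof.
move=> dX; have [mg ug XE] := diagonalized_sqrt dX.
have [_ _ u0 _] := dX.
have [M [v [v0 hv]]] := leading_vector (fun j => (k j)%:~R).
exists M, v; split=> //.
apply: (@pspace_cvg_line _ _ _ (fun z => rho (g z) *m (expR (- (- (ln z / 2%:R) * M)) *: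
    (rho (exp_diag (fun j => - (ln z / 2%:R) * (k j)%:~R)) *m h)))).
- by apply: unitmx_mulv_neq0 => //; exact: rep_unit.
- apply: mlimM; first exact: (mlim_rep reg_rho mg u0).
  move=> i j; apply: (@cvg_comp _ _ _ (fun z : R => - (ln z / 2%:R)) (fun tau =>
    (expR (- (tau * M)) *: (rho (exp_diag (fun j => tau * (k j)%:~R)) *m h)) i j) _ (pinfty_nbhs R)).
    exact: ln_half_cvg.
  exact: hv.
- near=> z.
  have ugz : g z \in unitmx by near: z.
  have XEz : X z = sqrt_curve g k z *m (sqrt_curve g k z)^T by near: z.
  have us : sqrt_curve g k z \in unitmx by rewrite unitmx_mul ugz unit_exp_diag.
  case: xgetP => [x _ [ux Xx]|/(_ (sqrt_curve g k z)) /=]; last by case.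
  rewrite (orbit_eq us) -?XEz // -scalemxAr vline_scale ?gt_eqF ?expR_gt0 //.
  by rewrite mulmxA; have [_ <-] := rep_rho; rewrite ?unit_exp_diag.
Unshelve. all: by end_near. Qed.

Lemma affine_cvgy (a b : R) : 0 < a -> (a * t + b) / 2%:R @[t --> +oo] --> +oo.
Proof.
move=> a0; apply/cvgryPge => A; near=> t.
rewrite ler_pdivlMr // -lerBlDr [a * t]mulrC -ler_pdivrMr //.
Unshelve. all: by end_near. Qed.

Definition leads (k : 'I_n -> R) (M : R) (v : 'cV[R]_D) : Prop :=
  mlim (pinfty_nbhs R)
    (fun tau => expR (- (tau * M)) *: (rho (exp_diag (fun j => tau * k j)) *m h)) v.

Lemma leads_comp k M v (f : R -> R) : leads k M v -> f t @[t --> +oo] --> +oo ->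
  mlim (pinfty_nbhs R) (fun t => expR (- (f t * M)) *:
    (rho (exp_diag (fun j => f t * k j)) *m h)) v.
Proof.
move=> kv fy i j; apply: (@cvg_comp _ _ _ f (fun tau =>
    (expR (- (tau * M)) *: (rho (exp_diag (fun j => tau * k j)) *m h)) i j) _ (pinfty_nbhs R)) => //.
exact: kv.
Qed.

Definition geodesic_sqrt (g : 'M[R]_n) (phi : 'rV[R]_n) (t : R) : 'M[R]_n :=
  g *m exp_diag (fun j => t / 2%:R * phi 0 j).

Lemma geodesic_sqrtE g phi t :
  geodesic_curve g phi t = geodesic_sqrt g phi t *m (geodesic_sqrt g phi t)^T.
Proof.
rewrite /geodesic_curve /geodesic_sqrt trmx_mul tr_diag_mx !mulmxA; congr (_ *m _).
rewrite -!mulmxA; congr (_ *m _); rewrite mulmx_diag; congr diag_mx.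
by apply/rowP => i; rewrite !mxE -expRD; congr expR; field.
Qed.

Lemma geodesic_sqrt_unit g phi t : g \in unitmx -> geodesic_sqrt g phi t \in unitmx.
Proof. by move=> ug; rewrite unitmx_mul ug unit_exp_diag. Qed.

(** In the frame x the first form becomes the identity, and comparability up to e^d becomes
    closeness of the second Gram matrix to 1. *)
Lemma near_le_mulT (x y : 'M[R]_n) d : x \in unitmx -> 0 <= d -> near_le d (x *m x^T) (y *m y^T) ->
  forall i j, `|(invmx x *m y *m (invmx x *m y)^T - 1%:M) i j| <= 2%:R * (expR d - 1).
Proof.
move=> ux d0 nl; have ed : 1 <= expR d by rewrite -expR0 ler_expR.
apply: entry_le_qf; first by rewrite linearB /= trmx_mul trmxK trmx1.
  by rewrite subr_ge0.
move=> w; have := nl ((invmx x)^T *m w).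
have xw : x^T *m ((invmx x)^T *m w) = w by rewrite mulmxA -trmx_mul mulVmx // trmx1 mul1mx.
have -> : x *m x^T = x *m 1%:M *m x^T by rewrite mulmx1.
rewrite qf_conj xw qf1.
have -> : qf (y *m y^T) ((invmx x)^T *m w) = qf (invmx x *m y *m (invmx x *m y)^T) w.
  by rewrite -[(invmx x)^T in LHS]trmxK -qf_conj trmxK trmx_mul !mulmxA.
rewrite qfD qfN qf1; have := expR_ge1Dx d; have := expR_ge1Dx (- d).
have := sqn_ge0 w; set q := qf _ _; set s := sqn w => s0 h1 h2 /andP[h3 h4].
have : (2%:R - expR d) * s <= expR (- d) * s by rewrite ler_wpM2r //; lra.
move=> h5; rewrite ler_norml mulrBl mul1r; apply/andP; split; lra.
Qed.

(** The Cholesky factor u_t replaces x_t^-1 y_t without changing the orbit point, because the two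
    differ by an orthogonal matrix on the right. Moved to the left of the torus element, u_t becomes
    w_t -> 1, and the limit is that of the first geodesic alone. *)
Lemma strong_same_limit g1 g2 (k1 k2 : 'rV[R]_n) a b M1 v1 M2 v2 :
  g1 \in unitmx -> g2 \in unitmx -> (forall i j : 'I_n, (i <= j)%N -> k1 0 j <= k1 0 i) ->
  0 < a -> strongly_asymptotic (geodesic_curve g1 k1) (fun t => geodesic_curve g2 k2 (a * t + b)) ->
  v1 != 0 -> v2 != 0 -> leads (k1 0) M1 v1 -> leads (k2 0) M2 v2 ->
  <[rho g1 *m v1]>%VS = <[rho g2 *m v2]>%VS.
Proof.
move=> u1 u2 dom a0 S n1 n2 L1 L2.
pose x t := geodesic_sqrt g1 k1 t; pose y t := geodesic_sqrt g2 k2 (a * t + b).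
have ux t : x t \in unitmx by exact: geodesic_sqrt_unit.
have uy t : y t \in unitmx by exact: geodesic_sqrt_unit.
pose s t := invmx (x t) *m y t.
have us t : s t \in unitmx by rewrite unitmx_mul unitmx_inv ux uy.
have lim_s : mlim (pinfty_nbhs R) (fun t => s t *m (s t)^T) 1%:M.
  move=> i j; apply/cvgrPdist_le => e e0.
  (* This d solves 2 (e^d - 1) = e, the bound given by [near_le_mulT]. *)
  have d0 : 0 < ln (1 + e / 2%:R) by rewrite ln_gt0 // ltrDl divr_gt0.
  apply: filterS (S _ d0) => t; rewrite !geodesic_sqrtE => nl.
  have mB (A B : 'M[R]_n) : (A - B) i j = A i j - B i j by rewrite !mxE.
  have := near_le_mulT (ux t) (ltW d0) nl i j; rewrite mB distrC => /le_trans; apply.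
  by rewrite lnK ?posrE ?addr_gt0 ?divr_gt0 // addrC addKr mulrC divfK.
have /choice [u hu] : forall t, exists u,
    [/\ is_trig_mx u, forall i, 0 < u i i & s t *m (s t)^T = u *m u^T].
  by move=> t; apply: cholesky; exact: pdef_mulT.
have lim_u : mlim (pinfty_nbhs R) u 1%:M.
  apply: cholesky_cvg1; [by move=> t; case: (hu t)|by move=> t; case: (hu t)|].
  by apply: mlim_near lim_s; apply: nearW => t; case: (hu t).
pose c t : 'I_n -> R := fun j => t / 2%:R * k1 0 j.
pose w t := exp_diag (c t) *m u t *m exp_diag (fun j => - c t j).
have wE t i j : w t i j = expR (c t i - c t j) * u t i j.
  rewrite /w /exp_diag mul_mx_diag mxE mul_diag_mx !mxE expRD; ring.
have lim_w : mlim (pinfty_nbhs R) w 1%:M.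
  move=> i j; have [ij|ji|/val_inj ij] := ltngtP i j.
  - rewrite mxE -val_eqE /= ltn_eqF //; apply: (near_cvg (f := cst 0)); first exact: cvg_cst.
    apply: nearW => t /=; rewrite wE; have [/is_trig_mxP -> //] := hu t.
    by rewrite mulr0.
  (* Below the diagonal c_i - c_j <= 0 for t >= 0, because k1 is nonincreasing, so the factor e^(c_i
     - c_j) is at most 1. *)
  - have := lim_u i j; rewrite mxE -val_eqE /= gtn_eqF // => /cvgrPdist_le hh.
    apply/cvgrPdist_le => e e0; near=> t; rewrite sub0r normrN wE normrM ger0_norm ?expR_ge0 //.
    have : `|0 - u t i j| <= e by near: t; exact: hh.
    rewrite sub0r normrN; apply: le_trans; rewrite ler_piMl // -expR0 ler_expR /c -mulrBr.
    rewrite mulr_ge0_le0 ?subr_le0 ?dom // ?(ltnW ji) // divr_ge0 //.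
  - rewrite ij; apply: near_cvg (lim_u j j) _; apply: nearW => t.
    by rewrite wE subrr expR0 mul1r.
apply: (@vline_lim_unique _ _ _ (pinfty_nbhs R) _
  (fun t => rho (g1 *m w t) *m (expR (- (t / 2%:R * M1)) *: (rho (exp_diag (c t)) *m h)))
  (fun t => rho g2 *m (expR (- ((a * t + b) / 2%:R * M2)) *:
      (rho (exp_diag (fun j => (a * t + b) / 2%:R * k2 0 j)) *m h)))).
- by apply: unitmx_mulv_neq0 => //; exact: rep_unit.
- by apply: unitmx_mulv_neq0 => //; exact: rep_unit.
- apply: mlimM.
    rewrite -[g1 in X in mlim _ _ X]mulmx1; apply: (mlim_rep reg_rho); last by rewrite mulmx1.
    by apply: mlimM => //; exact: mlim_cst.
  apply: leads_comp L1 _; have := affine_cvgy 0 ltr01.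
  by under eq_cvg do rewrite mul1r addr0.
- apply: mlimM; first exact: mlim_cst.
  by apply: leads_comp L2 _; exact: affine_cvgy.
- apply: nearW => t; rewrite -!scalemxAr !vline_scale ?gt_eqF ?expR_gt0 //.
  have [r1 rM] := rep_rho; have uu : u t \in unitmx.
    by have [_ _ e] := hu t; have : u t *m (u t)^T \in unitmx;
       [rewrite -e unitmx_mul unitmx_tr us|rewrite unitmx_mul => /andP[]].
  have uw : w t \in unitmx by rewrite !unitmx_mul !unit_exp_diag uu.
  have -> : rho (g1 *m w t) *m (rho (exp_diag (c t)) *m h) = rho (x t *m u t) *m h.
    have ugw : g1 *m w t \in unitmx by rewrite unitmx_mul u1 uw.
    rewrite mulmxA -(rM _ _ ugw (unit_exp_diag _)).
    rewrite /w -!mulmxA -exp_diagD (_ : exp_diag (fun j => - c t j + c t j) = 1%:M) ?mulmx1 ?mulmxA //.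
    by apply/matrixP => i j; rewrite !mxE addNr expR0.
  have -> : rho g2 *m (rho (exp_diag (fun j => (a * t + b) / 2%:R * k2 0 j)) *m h) = rho (y t) *m h.
    by rewrite mulmxA -rM ?unit_exp_diag.
  rewrite -(@orbit_eq (x t *m u t) (y t)) //; first by rewrite unitmx_mul ux.
  transitivity ((x t *m s t) *m (x t *m s t)^T); last by rewrite mulKVmx.
  rewrite (trmx_mul (x t) (u t)) (trmx_mul (x t) (s t)) -2!(mulmxA (x t)); congr (x t *m _).
  by rewrite (mulmxA (u t)) (mulmxA (s t)); have [_ _ ->] := hu t.
Unshelve. all: by end_near. Qed.

End OrbitLimits.

(** * Boundary points as limits of meromorphic curves *)

Section RationalFace.
Variables (R : realType) (n r : nat) (T : Type) (U : set_system T).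
Context {UU : ProperFilter U}.
Variables (delta : 'I_r -> 'I_n -> int) (F : pred 'I_r) (c : 'I_r -> R)
  (s : T -> 'I_n -> R).
Hypothesis s_face : forall i, F i -> \sum_j (delta i j)%:~R * s t j @[t --> U] --> c i.
Hypothesis s_inf : forall i, ~~ F i ->
  forall A : R, \forall t \near U, \sum_j (delta i j)%:~R * s t j <= A.

Let f : {rmorphism rat -> R} := ratr.
Let ff (p q : nat) (A : 'M[rat]_(p, q)) : 'M[R]_(p, q) := map_mx f A.
Let Delta : 'M[rat]_(r, n) := \matrix_(i, j) (delta i j)%:~R.
Let DF : 'M[rat]_(r, n) := \matrix_(i, j) (if F i then (delta i j)%:~R else 0).
Let P : 'M[rat]_(n, r) := pinvmx DF.
(** A projector onto the kernel of [DF] with rational entries: it makes the exact equations on the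
    face survive rational approximation. *)
Let Q : 'M[rat]_n := 1%:M - P *m DF.
Let sv t : 'cV[R]_n := \col_j s t j.
Let cv : 'cV[R]_r := \col_i (if F i then c i else 0).

Lemma DFP : DF *m P *m DF = DF.
Proof. by rewrite mulmxKpV. Qed.

Lemma DFQ : DF *m Q = 0.
Proof. by rewrite /Q mulmxBr mulmx1 mulmxA DFP subrr. Qed.

Lemma ffM p q l (A : 'M[rat]_(p, q)) (B : 'M[rat]_(q, l)) : ff (A *m B) = ff A *m ff B.
Proof. exact: map_mxM. Qed.

Lemma Deltas t i : (ff Delta *m sv t) i 0 = \sum_j (delta i j)%:~R * s t j.
Proof. by rewrite mxE; apply: eq_bigr => j _; rewrite !mxE rmorph_int. Qed.

Lemma DFs_cvg : mlim U (fun t => ff DF *m sv t) cv.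
Proof.
move=> i j; rewrite ord1 mxE; case Fi : (F i).
  apply: near_cvg (s_face Fi) _; apply: nearW => t.
  by rewrite mxE; apply: eq_bigr => l _; rewrite !mxE Fi rmorph_int.
apply: (near_cvg (f := cst 0)); first exact: cvg_cst.
by apply: nearW => t; rewrite mxE big1 // => l _; rewrite !mxE Fi rmorph0 mul0r.
Qed.

(** The image of [DF] is closed, so it contains the limit of DF s_t, and [P] picks a preimage. *)
Lemma cv_image : ff DF *m (ff P *m cv) = cv.
Proof.
have h1 : mlim U (fun t => ff DF *m sv t) (ff DF *m (ff P *m cv)).
  apply: (@mlim_near _ _ _ _ _ _ (fun t => ff DF *m (ff P *m (ff DF *m sv t)))).
    by apply: nearW => t; rewrite !mulmxA -!ffM DFP.
  by do 2!(apply: mlimM; first exact: mlim_cst); exact: DFs_cvg.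
have h2 : mlim U (fun t => ff DF *m sv t) cv by exact: DFs_cvg.
apply/matrixP => i j; move: (h1 i j) (h2 i j) => h3 {}h2.
exact: (cvg_unique (@Rhausdorff R) h3 h2).
Qed.

(** Applying [Q] to s_t subtracts P DF s_t, whose pairings converge. Off the face the pairings of Q
    s_t therefore still become negative, and a single t far enough along [U] provides x. *)
Lemma real_direction : exists x : 'cV[R]_n, forall i, ~~ F i -> (ff (Delta *m Q) *m x) i 0 < 0.
Proof.
have h i : ~~ F i -> \forall t \near U, (ff (Delta *m Q) *m sv t) i 0 < 0.
  move=> nF; pose q t := (ff (Delta *m P) *m (ff DF *m sv t)) i 0.
  have qc : q t @[t --> U] --> (ff (Delta *m P) *m cv) i 0.
    have : mlim U (fun t => ff (Delta *m P) *m (ff DF *m sv t)) (ff (Delta *m P) *m cv).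
      by apply: mlimM; [exact: mlim_cst|exact: DFs_cvg].
    exact.
  set l := _ _ 0 in qc; near=> t.
  have e : (ff (Delta *m Q) *m sv t) i 0 = \sum_j (delta i j)%:~R * s t j - q t.
    rewrite /q -Deltas.
    have -> : ff (Delta *m Q) *m sv t = ff Delta *m sv t - ff (Delta *m P) *m (ff DF *m sv t).
      rewrite mulmxA -ffM -mulmxBl; congr (_ *m _).
      by rewrite /Q mulmxBr mulmx1 mulmxA; exact: map_mxB.
    by rewrite [LHS]mxE [X in _ + X]mxE.
  rewrite e subr_lt0; have h1 : \sum_j (delta i j)%:~R * s t j <= l - 2%:R by near: t; exact: s_inf.
  have : `|l - q t| <= 1 by near: t; move/cvgrPdist_le : qc; apply.
  rewrite ler_norml => /andP[? ?]; lra.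
have : \forall t \near U, forall i, ~~ F i -> (ff (Delta *m Q) *m sv t) i 0 < 0.
  apply: filter_forall => i; case Fi : (F i); first by apply: nearW.
  by apply: filterS (h i _) => //; rewrite Fi.
by move=> /filter_ex [t ht]; exists (sv t).
Unshelve. all: by end_near. Qed.

(** The equations on the face hold for Q x whatever x is, so only strict inequalities have to be
    kept, and these persist under a small change of x. *)
Lemma rat_direction : exists x : 'cV[rat]_n, forall i, ~~ F i -> (Delta *m Q *m x) i 0 < 0.
Proof.
have [x hx] := real_direction.
have [y yx] : exists y : nat -> 'cV[rat]_n, mlim \oo (fun m => ff (y m)) x.
  have /choice [y hy] : forall mj : nat * 'I_n, exists q : rat, `|x mj.2 0 - ratr q| < mj.1.+1%:R^-1.
    move=> [m j] /=; have : (0:R) < m.+1%:R^-1 by rewrite invr_gt0.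
    move: (m.+1%:R^-1) => e e0; have lt : x j 0 - e < x j 0 + e by lra.
    have [q] := rat_in_itvoo lt; rewrite in_itv /= => /andP[q1 q2]; exists q.
    by rewrite ltr_norml; apply/andP; split; lra.
  exists (fun m => \col_j y (m, j)) => j k; rewrite ord1.
  apply/cvgrPdist_lt => e e0; near=> m; rewrite !mxE; apply: lt_trans (hy (m, j)) _ => /=.
  by near: m; exact: near_infty_natSinv_lt (PosNum e0).
have : \forall m \near \oo, forall i, ~~ F i -> (ff (Delta *m Q) *m ff (y m)) i 0 < 0.
  apply: filter_forall => i; case Fi : (F i); first by apply: nearW.
  have : (ff (Delta *m Q) *m ff (y m)) i 0 @[m --> \oo] --> (ff (Delta *m Q) *m x) i 0.
    have : mlim \oo (fun m => ff (Delta *m Q) *m ff (y m)) (ff (Delta *m Q) *m x).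
      by apply: mlimM => //; exact: mlim_cst.
    exact.
  by move/cvgr_lt => /(_ 0 (hx i (negbT Fi))); apply: filterS.
move=> /filter_ex [m hm]; exists (y m) => i /hm.
by rewrite -ffM mxE -(rmorph0 f) ltr_rat.
Unshelve. all: by end_near. Qed.

(** Clearing the denominators of Q x gives [k], and [s0] is the preimage P cv of the limiting
    values. *)
Lemma rational_face : exists (k : 'I_n -> int) (s0 : 'I_n -> R),
  [/\ forall i, F i -> \sum_j delta i j * k j = 0,
      forall i, F i -> \sum_j (delta i j)%:~R * s0 j = c i
    & forall i, ~~ F i -> \sum_j delta i j * k j < 0].
Proof.
have [x hx] := rat_direction; pose y : 'cV[rat]_n := Q *m x.
pose N : int := \prod_j denq (y j 0).
have N0 : 0 < N by apply: prodr_gt0 => j _; exact: denq_gt0.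
pose k j : int := numq (y j 0) * \prod_(l | l != j) denq (y l 0).
have kE j : (k j)%:~R = N%:~R * y j 0 :> rat.
  by rewrite /N (bigD1 j) //= /k !intrM numqE [in RHS]mulrC mulrA.
have skE i : (\sum_j delta i j * k j)%:~R = N%:~R * (Delta *m y) i 0 :> rat.
  rewrite mxE mulr_sumr rmorph_sum; apply: eq_bigr => j _ /=.
  by rewrite intrM kE [Delta i j]mxE mulrCA.
exists k, (fun j => (ff P *m cv) j 0); split.
- move=> i Fi; apply/eqP; rewrite -(intr_eq0 rat) skE.
  have : (DF *m y) i 0 = 0 by rewrite /y mulmxA DFQ mul0mx mxE.
  rewrite mxE => e; rewrite mxE (eq_bigr (fun j => DF i j * y j 0)) ?e ?mulr0 //.
  by move=> j _; rewrite !mxE Fi.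
- move=> i Fi; have /matrixP /(_ i 0) := cv_image; rewrite [RHS]mxE Fi => <-.
  by rewrite mxE; apply: eq_bigr => j _; rewrite [ff DF _ _]mxE [DF _ _]mxE Fi; congr (_ * _); rewrite rmorph_int.
- move=> i nF; rewrite -(ltr_int rat) skE rmorph0 pmulr_rlt0 ?ltr0z //.
  by rewrite /y mulmxA; exact: hx.
Qed.

End RationalFace.

Section UltraLimits.
Variables (R : realType) (T : Type) (U : set_system T).
Context {UU : UltraFilter U}.

(** Replaces the successive extraction of convergent subsequences. *)
Lemma ultra_bounded_cvg (x : T -> R) a b : (forall t, a <= x t <= b) ->
  exists l : R, x @ U --> l.
Proof.
move=> xab; have cA : compact `[a, b]%classic by exact: segment_compact.
have [|l [_ cl]] := cA (fmap x U) _.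
  by apply: nearW => t; rewrite /= in_itv /=.
exists l => B Bl; have [//|nB] := in_ultra_setVsetC [set t | B (x t)] UU.
by have [y []] := cl (~` B) B nB Bl.
Qed.

Lemma ultra_pigeonhole (I : eqType) (r : seq I) (P : I -> T -> Prop) :
  (forall t, exists2 i, i \in r & P i t) -> exists2 i, i \in r & U [set t | P i t].
Proof.
move=> h; apply: contrapT => nh.
have : U [set t | forall i, i \in r -> ~ P i t].
  elim: r {h} nh => [|i r IH] nh.
    by apply: filterS filterT => t _ i; rewrite in_nil.
  have h1 : U [set t | ~ P i t].
    have [Pi|//] := in_ultra_setVsetC [set t | P i t] UU.
    by exfalso; apply: nh; exists i; rewrite ?mem_head.
  have h2 : U [set t | forall i, i \in r -> ~ P i t].
    by apply: IH => -[j jr Pj]; apply: nh; exists j; rewrite ?inE ?jr ?orbT.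
  by apply: filterS2 h1 h2 => t Pi Pr j; rewrite inE => /predU1P[->//|/Pr].
move=> /filter_ex [t ht]; have [i ir Pi] := h t; exact: (ht i ir Pi).
Qed.

End UltraLimits.

Section Meromorphic.
Variable R : realType.

(** After multiplication by z^N the function is a polynomial whose coefficients collect the terms of
    equal exponent, so the partial sums are eventually constant. *)
Lemma meromorphic_sum_powers (I : finType) (c : I -> R) (e : I -> int) :
  meromorphic_at0 (fun z => \sum_i c i * z ^ e i).
Proof.
have [N hN] : exists N : nat, forall i, 0 <= N%:Z + e i.
  exists (\sum_i `|e i|)%N => i; rewrite (bigD1 i) //= PoszD.
  have : - e i <= `|e i|%N%:Z by rewrite abszE -normrN ler_norm.
  set a := Posz _; set b := Posz _; have : 0 <= b by []. move: a b => a b; lra.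
pose d i : nat := absz (N%:Z + e i).
have dE i : (d i)%:Z = N%:Z + e i by rewrite gez0_abs.
exists N%:Z, (fun m => \sum_(i | d i == m) c i); near=> z.
have z0 : 0 < z by near: z; exact: nbhs_right_gt.
apply: (@cvg_trans _ ((fun=> z ^ N%:Z * \sum_i c i * z ^ e i) @ \oo)); last exact: cvg_cst.
apply: near_eq_cvg; near=> m.
have dm i : (d i < m)%N.
  apply: (@leq_ltn_trans (\sum_i d i)); first by rewrite (bigD1 i) //= leq_addr.
  by near: m; exact: nbhs_infty_gt.
rewrite /pseries /series /= mulr_sumr.
transitivity (\sum_(0 <= j < m) \sum_(i | d i == j) c i * z ^+ d i); last first.
  by apply: eq_bigr => j _; rewrite mulr_suml; apply: eq_bigr => i /eqP ->.
rewrite big_mkord (partition_big (fun i => Ordinal (dm i)) predT) //=.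
apply: eq_bigr => j _; apply: eq_big => [i|i _]; first by rewrite -val_eqE.
by rewrite mulrCA -expfzDr ?gt_eqF // -dE -exprnP.
Unshelve. all: by end_near. Qed.

End Meromorphic.

(** * A meromorphic curve to every point of the closure *)

Section ClosureCurves.
Variables (R : realType) (n D : nat) (rho : 'M[R]_n -> 'M[R]_D) (h : 'cV[R]_D).
Hypothesis rep_rho : is_rep rho.
Hypothesis reg_rho : forall a b, regular_fun (fun g => rho g a b).
Hypothesis h_neq0 : h != 0.
Hypothesis h_orth : forall k, k *m k^T = 1%:M -> rho k *m h = h.

Lemma proj_point (A : {vspace 'cV[R]_D}) : proj_space A -> exists2 v, v != 0 & A = <[v]>%VS.
Proof.
move=> dA; exists (vpick A); first by rewrite vpick0 -dimv_eq0 dA.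
apply/eqP; rewrite eq_sym eqEdim -memvE memv_pick /= dim_vline vpick0 -dimv_eq0 dA //.
Qed.

(** With the radii 1 / (m + 1) these neighbourhoods turn a point of the closure into the limit of a
    sequence. Openness is that of the ball, transported by the scalar c that takes the
    representative w to v. *)
Lemma pspace_open_near (v0 : 'cV[R]_D) e : 0 < e ->
  pspace_open [set L : {vspace 'cV[R]_D} |
    exists v, [/\ v != 0, v \in L & forall i, `|v0 i 0 - v i 0| < e]].
Proof.
move=> e0; rewrite /pspace_open openE => w [w0 [v [v0' /vlineP [c vE] hv]]].
have mid : mlim (nbhs w) id w by apply/mlim_cvg; exact: cvg_id.
have c0 : c != 0 by apply: contraNneq v0' => c0; rewrite vE c0 scale0r.
have [i [j wi]] := mx_neq0 w0.
have near1 : nbhs w [set u : 'cV[R]_D | u i j != 0].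
  by have := mid i j => /cvgr_neq0; apply.
have near2 : nbhs w [set u : 'cV[R]_D | forall i, `|v0 i 0 - c * u i 0| < e].
  apply: (@filter_forall _ 'I_D (fun l (u : 'cV[R]_D) => `|v0 l 0 - c * u l 0| < e) (nbhs w)) => l.
  have : `|v0 l 0 - c * u l 0| @[u --> w] --> `|v0 l 0 - c * w l 0|.
    apply: cvg_norm; apply: cvgB; first exact: cvg_cst.
    by apply: cvgM; [exact: cvg_cst|exact: mid].
  by move=> /cvgr_lt; apply; have := hv l; rewrite vE mxE.
rewrite /interior /=; apply: filterS2 near1 near2 => u u0 hu.
have un : u != 0 by apply: contraNneq u0 => ->; rewrite mxE.
split=> //; exists (c *: u); split.
- by rewrite scaler_eq0 negb_or c0.
- by rewrite memvZ ?memv_line.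
- by move=> l; rewrite mxE.
Qed.

Lemma closure_sequence (v0 : 'cV[R]_D) : v0 != 0 ->
  pspace_closure [set <[rho g *m h]>%VS | g in [set g | g \in unitmx]] <[v0]>%VS ->
  exists (g : nat -> 'M[R]_n) (v : nat -> 'cV[R]_D),
    [/\ forall m, g m \in unitmx, forall m, <[rho (g m) *m h]>%VS = <[v m]>%VS & mlim \oo v v0].
Proof.
move=> n0 [_ cl].
have /choice [gv hgv] : forall m : nat, exists gv : 'M[R]_n * 'cV[R]_D,
    [/\ gv.1 \in unitmx, <[rho gv.1 *m h]>%VS = <[gv.2]>%VS &
        forall i, `|v0 i 0 - gv.2 i 0| < m.+1%:R^-1].
  move=> m; have e0 : (0 : R) < m.+1%:R^-1 by rewrite invr_gt0.
  have [|_ [[g ug <-] [v [v0' vL hv]]]] := cl _ (@pspace_open_near v0 _ e0).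
    by exists v0; split; [|exact: memv_line|move=> i; rewrite subrr normr0].
  exists (g, v); split=> //; move/vlineP: vL => [c vE]; rewrite /= vE vline_scale //.
  by apply: contraNneq v0' => c0; rewrite vE c0 scale0r.
exists (fun m => (gv m).1), (fun m => (gv m).2); split.
- by move=> m; have [] := hgv m.
- by move=> m; have [] := hgv m.
- move=> i j; rewrite ord1; apply/cvgrPdist_lt => e e0; near=> m.
  have [_ _ /(_ i)] := hgv m; move/lt_trans; apply.
  by near: m; exact: near_infty_natSinv_lt (PosNum e0).
Unshelve. all: by end_near. Qed.

Lemma det_sqr1_unit (K : 'M[R]_n) : \det K ^+ 2 = 1 -> K \in unitmx.
Proof. by move=> d1; rewrite unitmxE; apply/unitrP; exists (\det K); rewrite -expr2 d1. Qed.

(** From g g^T = K diag(d) K^T one gets the factor K e^s with s = ln(d) / 2, which differs from g by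
    an orthogonal matrix fixing h. *)
Lemma orbit_polar g : g \in unitmx -> exists (K : 'M[R]_n) (s : 'I_n -> R),
  [/\ forall i j, `|K i j| <= 1, \det K ^+ 2 = 1
    & rho g *m h = rho K *m (rho (exp_diag s) *m h)].
Proof.
move=> ug; have [K [d [K1 dK d0 E]]] := pivoted_ldl (pdef_mulT ug).
have uK : K \in unitmx.
  exact: det_sqr1_unit.
exists K, (fun j => ln (d 0 j) / 2%:R); split=> //.
have [_ rM] := rep_rho; rewrite mulmxA -rM ?unit_exp_diag //.
apply: (orbit_eq rep_rho h_orth); first by rewrite unitmx_mul uK unit_exp_diag.
rewrite E trmx_mul tr_diag_mx !mulmxA; congr (_ *m _); rewrite -!mulmxA; congr (_ *m _).
rewrite mulmx_diag; congr diag_mx; apply/rowP => i; rewrite !mxE -expRD.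
by rewrite -splitr lnK // posrE.
Qed.

Lemma ln_cvg : (- ln z : R) @[z --> (0:R)^'+] --> +oo.
Proof.
apply/cvgryPge => A; near=> z.
have z0 : 0 < z by near: z; exact: nbhs_right_gt.
have : z <= expR (- A) by near: z; apply: nbhs_right_le; exact: expR_gt0.
by rewrite -{1}[z]lnK ?posrE // ler_expR lerNr.
Unshelve. all: by end_near. Qed.

Lemma closure_curve A :
  pspace_closure [set <[rho g *m h]>%VS | g in [set g | g \in unitmx]] A ->
  exists X : R -> 'M[R]_n, meromorphic_curve X /\
    pspace_cvg (fun z => <[rho (xget 1%:M [set g | g \in unitmx /\ X z = g *m g^T]) *m h]>%VS) A.
Proof.
move=> clA; have [v0 n0 AE] := proj_point clA.1; rewrite AE in clA *.
have [g [v [ug gv lim_v]]] := closure_sequence n0 clA.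
have [S hS minS] := minimal_expansion h rep_rho reg_rho.
have /choice [Ks hKs] : forall m, exists Ks : 'M[R]_n * ('I_n -> R),
    [/\ forall i j, `|Ks.1 i j| <= 1, \det Ks.1 ^+ 2 = 1
    & rho (g m) *m h = rho Ks.1 *m (rho (exp_diag Ks.2) *m h)].
  by move=> m; have [K [s hKs]] := orbit_polar (ug m); exists (K, s).
pose K m := (Ks m).1; pose s m := (Ks m).2.
(* One ultrafilter finer than the eventual filter makes all the bounded quantities below converge at
   once. *)
have [U [UU sU]] := ultraFilterLemma (@eventually_filter).
have /choice [K0' hK0] : forall ij, exists l, K m ij.1 ij.2 @[m --> U] --> (l : R).
  move=> [i j]; apply: (@ultra_bounded_cvg _ _ _ _ _ (-1) 1) => m.
  by have [/(_ i j) h1 _ _] := hKs m; rewrite -ler_norml.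
pose K0 : 'M[R]_n := \matrix_(i, j) K0' (i, j).
have lim_K : mlim U K K0 by move=> i j; rewrite mxE; exact: (hK0 (i, j)).
have uK0 : K0 \in unitmx.
  have : \det (K m) ^+ 2 @[m --> U] --> \det K0 ^+ 2 by apply: cvg_expr; exact: mlim_det.
  have : \det (K m) ^+ 2 @[m --> U] --> (1 : R).
    apply: (near_cvg (f := cst 1)); first exact: cvg_cst.
    by apply: nearW => m; have [_ ->] := hKs m.
  by move=> c1 c2; apply: det_sqr1_unit; exact: (cvg_unique (@Rhausdorff R) c2 c1).
have S0 : exists p0, p0 \in S.
  have := hS (fun=> 0); case: (S) => [|p r]; last by exists p; rewrite inE eqxx.
  rewrite big_nil => e; have := orbit_neq0 rep_rho h_neq0 (unit_exp_diag (fun=> 0 : R)).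
  by rewrite e eqxx.
have [p0 p0S p0max] : exists2 p0, p0 \in S & U [set m | {in S, forall p,
    weight_pairing p.1 (s m) <= weight_pairing p0.1 (s m)}].
  apply: ultra_pigeonhole => m.
  exact: (seq_argmax (fun p : {ffun 'I_n -> int} * 'cV[R]_D => weight_pairing p.1 (s m)) S0).
(* The truncation at 0 bounds x for every m; for the terms of S it changes nothing on the set of the
   ultrafilter where p0 dominates. *)
pose x (p : {ffun 'I_n -> int} * 'cV[R]_D) m :=
  expR (Num.min 0 (weight_pairing p.1 (s m) - weight_pairing p0.1 (s m))).
have /choice [eps heps] : forall p : {ffun 'I_n -> int} * 'cV[R]_D,
    exists l, x p m @[m --> U] --> (l : R).
  move=> p; apply: (@ultra_bounded_cvg _ _ _ _ _ 0 1) => m.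
  by rewrite expR_ge0 /= -expR0 ler_expR ge_min lexx.
have xE : U [set m |
    {in S, forall p, x p m = expR (weight_pairing p.1 (s m) - weight_pairing p0.1 (s m))}].
  by apply: filterS p0max => m hm p pS; rewrite /x min_r // subr_le0 hm.
have eps0 p : 0 <= eps p.
  by apply: (cvgr_to_ge (heps p)); apply: nearW => m; exact: expR_ge0.
have eps_p0 : eps p0 = 1.
  apply: (cvg_unique (@Rhausdorff R) (heps p0)); apply: (near_cvg (f := cst 1)); first exact: cvg_cst.
  by apply: nearW => m; rewrite /x subrr minxx expR0.
(* The face consists of the terms whose ratio to the dominant one has a nonzero limit. *)
pose Fp p := 0 < eps p.
have dE (p : {ffun 'I_n -> int} * 'cV[R]_D) (t : 'I_n -> R) :
    \sum_j (p.1 j - p0.1 j)%:~R * t j = weight_pairing p.1 t - weight_pairing p0.1 t.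
  by rewrite -sumrB; apply: eq_bigr => j _; rewrite rmorphB mulrBl.
pose q (i : 'I_(size S)) := tnth (in_tuple S) i.
have qS i : q i \in S by exact: mem_tnth.
(* The differences to the weight of p0, paired with s m, converge to ln(eps) on the face and tend to
   minus infinity off it. *)
have [k [s0 [k0 sc kn]]] : exists (k : 'I_n -> int) (s0 : 'I_n -> R),
  [/\ forall i, Fp (q i) -> \sum_j ((q i).1 j - p0.1 j) * k j = 0,
      forall i, Fp (q i) -> \sum_j ((q i).1 j - p0.1 j)%:~R * s0 j = ln (eps (q i))
    & forall i, ~~ Fp (q i) -> \sum_j ((q i).1 j - p0.1 j) * k j < 0].
  apply: (@rational_face R n (size S) nat U _ (fun i j => (q i).1 j - p0.1 j)
      (fun i => Fp (q i)) (fun i => ln (eps (q i))) s) => i.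
    move=> Fi; apply: (near_cvg (f := fun m => ln (x (q i) m))).
      by apply: continuous_cvg; [exact: continuous_ln|exact: heps].
    by apply: filterS xE => m hm; rewrite hm ?qS // expRK dE.
  move=> nFi B; have e0 : eps (q i) = 0.
    by apply/eqP; rewrite eq_le eps0 andbT leNgt.
  have := heps (q i); rewrite e0 => /cvgr_lt /(_ _ (expR_gt0 B)).
  apply: filterS2 xE => m hm; rewrite hm ?qS // ltr_expR dE; exact: ltW.
pose kR j : R := (k j)%:~R; pose m0 := weight_pairing p0.1 kR.
have sq p : p \in S -> exists i, p = q i.
  by move=> /(nthP p0) [i iS <-]; exists (Ordinal iS); rewrite /q (tnth_nth p0).
have kRE (p : {ffun 'I_n -> int} * 'cV[R]_D) : weight_pairing p.1 kR - m0 =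
    (\sum_j (p.1 j - p0.1 j) * k j)%:~R :> R.
  by rewrite /m0 -dE rmorph_sum; apply: eq_bigr => j _ /=; rewrite intrM.
have Fm : {in S, forall p, Fp p -> weight_pairing p.1 kR = m0}.
  move=> p /sq [i ->] /k0 e; apply/eqP; rewrite -subr_eq0 kRE e //.
have Fl : {in S, forall p, ~~ Fp p -> weight_pairing p.1 kR < m0}.
  by move=> p /sq [i ->] /kn e; rewrite -subr_lt0 kRE ltrz0.
have hF : has Fp S by apply/hasP; exists p0; rewrite // /Fp eps_p0 ltr01.
set w := \sum_(p <- S | Fp p) expR (weight_pairing p.1 s0) *: p.2.
have w0 : w != 0 by exact: minS hF Fm Fl s0.
(* The limit of the normalized torus orbit. On the face, eps is the exponential of the pairing of s0
   with the difference to p0, so v1 is a positive multiple of the face sum w. *)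
pose v1 : 'cV[R]_D := \sum_(p <- S) eps p *: p.2.
have v1E : v1 = expR (- weight_pairing p0.1 s0) *: w.
  rewrite /w big_mkcond scaler_sumr; apply: eq_big_seq => p /sq [i ->].
  case Fi : (Fp (q i)).
    rewrite scalerA -expRD addrC -dE sc // lnK //.
  have -> : eps (q i) = 0 by apply/eqP; rewrite eq_le eps0 andbT leNgt -/(Fp (q i)) Fi.
  by rewrite scale0r scaler0.
have lim1 : mlim U (fun m => expR (- weight_pairing p0.1 (s m)) *:
    (rho (exp_diag (s m)) *m h)) v1.
  apply: (@mlim_near _ _ _ _ _ _ (fun m => \sum_(p <- S) x p m *: p.2)).
    apply: filterS xE => m hm; rewrite hS scaler_sumr; apply: eq_big_seq => p pS.
    by rewrite hm // scalerA -expRD addrC.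
  by apply: mlim_sum => p pS; apply: mlimZ; [exact: heps|exact: mlim_cst].
have urK : rho K0 \in unitmx by exact: rep_unit.
have AE' : <[v0]>%VS = <[rho K0 *m w]>%VS.
  transitivity <[rho K0 *m v1]>%VS; last first.
    by rewrite v1E -scalemxAr vline_scale // gt_eqF // expR_gt0.
  apply: (@vline_lim_unique _ _ _ U _ v (fun m => rho (K m) *m
      (expR (- weight_pairing p0.1 (s m)) *: (rho (exp_diag (s m)) *m h)))) => //.
  - by rewrite unitmx_mulv_neq0 // v1E scaler_eq0 negb_or w0 gt_eqF // expR_gt0.
  - by move=> i j; apply: cvg_trans (lim_v i j); apply: cvg_app; exact: sU.
  - by apply: mlimM => //; exact: (mlim_rep reg_rho).
  - apply: nearW => m; rewrite -gv -scalemxAr vline_scale ?gt_eqF ?expR_gt0 //.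
    by have [_ _ ->] := hKs m.
(* Exponents are doubled because X is y y^T with y = K0 e^(s0 - ln(z) k). *)
pose d (z : R) : 'rV[R]_n := \row_j (expR (2%:R * s0 j) * z ^ (- (2%:Z * k j))).
pose X z := K0 *m diag_mx (d z) *m K0^T.
pose y (z : R) := K0 *m exp_diag (fun j => s0 j + (- ln z) * kR j).
have uy z : y z \in unitmx by rewrite unitmx_mul uK0 unit_exp_diag.
have XE z : 0 < z -> X z = y z *m (y z)^T.
  move=> z0; rewrite /X /y trmx_mul tr_diag_mx !mulmxA; congr (_ *m _); rewrite -!mulmxA.
  congr (_ *m _); rewrite mulmx_diag; congr diag_mx; apply/rowP => j; rewrite !mxE.
  by rewrite exprz_expR // -!expRD rmorphN /= intrM /kR; congr expR; ring.
exists X; split.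
  split.
    near=> z; rewrite XE; first exact: pdef_mulT.
    by near: z; exact: nbhs_right_gt.
  move=> i j; rewrite (_ : (fun z => X z i j) = (fun z => \sum_l
      (K0 i l * K0 j l * expR (2%:R * s0 l)) * z ^ (- (2%:Z * k l)))).
    exact: meromorphic_sum_powers.
  apply/funext => z; rewrite /X mxE; apply: eq_bigr => l _.
  by rewrite mul_mx_diag !mxE; ring.
rewrite AE'; apply: (@pspace_cvg_line _ _ _ (fun z => rho K0 *m (expR (- (- ln z * m0)) *:
    (rho (exp_diag (fun j => s0 j + (- ln z) * kR j)) *m h)))).
- by rewrite unitmx_mulv_neq0.
- apply: mlimM; first exact: mlim_cst.
  move=> i j; apply: (@cvg_comp _ _ _ (fun z : R => - ln z) (fun tau => (expR (- (tau * m0)) *: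
      (rho (exp_diag (fun j => s0 j + tau * kR j)) *m h)) i j) _ (pinfty_nbhs R)).
    by exact: ln_cvg.
  exact: (expansion_limit (s := s0) hS Fm Fl).
- near=> z; have z0 : 0 < z by near: z; exact: nbhs_right_gt.
  case: xgetP => [a _ [ua Xa]|/(_ (y z)) /=]; last by case; rewrite XE.
  rewrite (orbit_eq rep_rho h_orth (uy z)) -?XE // -scalemxAr vline_scale ?gt_eqF ?expR_gt0 //.
  by rewrite mulmxA; have [_ <-] := rep_rho; rewrite ?unit_exp_diag.
Unshelve. all: by end_near. Qed.

End ClosureCurves.

(** * The direct sum as one representation with an invariant vector *)

Section SumRepresentation.
Variables (R : realType) (n p : nat) (theta : 'I_p -> spherical_irrep R n).

Lemma polynomial_regular d (rho : 'M[R]_n -> 'M[R]_d) : polynomial_rep rho ->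
  forall a b, regular_fun (fun g => rho g a b).
Proof. by move=> [N [P hP]] a b; exists N, (P a b) => g ug; exact: hP. Qed.

Lemma mxdiagM (d : 'I_p -> nat) (A B : forall i, 'M[R]_(d i)) :
  \mxdiag_i A i *m \mxdiag_i B i = \mxdiag_i (A i *m B i).
Proof.
rewrite {2}/mxdiag mul_mxdiag_mxblock; apply/eq_mxblockP => i j.
have [ij|_] := eqVneq i j; last by rewrite mulmx0.
by case: _ / ij; rewrite !conform_mx_id.
Qed.

Lemma sum_is_rep : is_rep (sum_rep theta).
Proof.
split.
  rewrite /sum_rep -mxdiagZ; apply: eq_mxdiag => i.
  by have [-> _] := si_isrep (theta i).
move=> g x ug ux; rewrite /sum_rep mxdiagM; apply: eq_mxdiag => i.
by have [_ ->] := si_isrep (theta i).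
Qed.

Lemma sum_regular a b : regular_fun (fun g => sum_rep theta g a b).
Proof.
have e g : sum_rep theta g a b = (if tagnat.sig1 a == tagnat.sig1 b then
   conform_mx 0 (si_rep (theta (tagnat.sig1 a)) g) else 0) (tagnat.sig2 a) (tagnat.sig2 b).
  by rewrite /sum_rep /mxdiag mxE.
rewrite (_ : (fun g => _) = fun g => (if tagnat.sig1 a == tagnat.sig1 b then
   conform_mx 0 (si_rep (theta (tagnat.sig1 a)) g) else 0) (tagnat.sig2 a) (tagnat.sig2 b));
  last by apply/funext => g; exact: e.
move: (tagnat.sig2 a) (tagnat.sig2 b); move: (tagnat.sig1 a) (tagnat.sig1 b) => i j k l.
have [ij|_] := eqVneq i j; last first.
  rewrite (_ : (fun=> _) = fun=> 0); first exact: regular_fun0.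
  by apply/funext => g; rewrite mxE.
case: _ / ij in l *; rewrite (_ : (fun g => _) = fun g => si_rep (theta i) g k l).
  exact: polynomial_regular (si_poly (theta i)) _ _.
by apply/funext => g; rewrite conform_mx_id.
Qed.

Lemma sum_orbit g : sum_rep theta g *m sum_vec theta =
  \mxcol_i (si_rep (theta i) g *m si_vec (theta i)).
Proof. exact: mul_mxdiag_mxcol. Qed.

Lemma sum_vec_neq0 : (0 < p)%N -> sum_vec theta != 0.
Proof.
case: p theta => // p' th _; apply/eqP => e.
have : \mxcol_i si_vec (th i) = \mxcol_i 0 by rewrite -/(sum_vec th) e mxcol0.
by move/eq_mxcolP => /(_ ord0) /eqP; rewrite (negPf (si_vec_neq0 (th ord0))).
Qed.

Lemma sum_vec_inv k : k *m k^T = 1%:M -> sum_rep theta k *m sum_vec theta = sum_vec theta.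
Proof.
move=> kk; rewrite sum_orbit; apply: eq_mxcol => i; exact: si_vec_inv.
Qed.

End SumRepresentation.

Lemma int_row_neq0 (R : realType) n (k : 'I_n -> int) : ~ (forall i, k i = 0) -> int_row R k != 0.
Proof.
move=> kk; apply/eqP => /rowP e; apply: kk => i; have := e i; rewrite !mxE => /eqP.
by rewrite intr_eq0 => /eqP.
Qed.

Section PartsAB.
Variables (R : realType) (n p : nat) (theta : 'I_p -> spherical_irrep R n).
Hypothesis p_gt0 : (0 < p)%N.

Lemma compactification_curve A : compactification theta A ->
  exists X, meromorphic_curve X /\ proj_limit theta X A.
Proof.
apply: closure_curve; [exact: sum_is_rep|exact: sum_regular|exact: sum_vec_neq0|].
exact: sum_vec_inv.
Qed.

Lemma sea_limit_proj_limit (X1 X2 : R -> 'M[R]_n) P : sea_limit X1 P -> sea_limit X2 P ->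
  exists A, proj_limit theta X1 A /\ proj_limit theta X2 A.
Proof.
move=> [_ [g1 [k1 [d1 H1]]]] [_ [g2 [k2 [d2 H2]]]].
have [M1 [v1 [n1 L1 C1]]] := diagonalized_limit (@sum_is_rep _ _ _ theta)
  (@sum_regular _ _ _ theta) (sum_vec_neq0 theta p_gt0) (@sum_vec_inv _ _ _ theta) d1.
have [M2 [v2 [n2 L2 C2]]] := diagonalized_limit (@sum_is_rep _ _ _ theta)
  (@sum_regular _ _ _ theta) (sum_vec_neq0 theta p_gt0) (@sum_vec_inv _ _ _ theta) d2.
suff e : <[sum_rep theta (g1 0%R) *m v1]>%VS = <[sum_rep theta (g2 0%R) *m v2]>%VS.
  by exists <[sum_rep theta (g1 0%R) *m v1]>%VS; split; [exact: C1|rewrite e; exact: C2].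
have [dom1 _ u1 _] := d1; have [dom2 _ u2 _] := d2.
(* When all exponents vanish the flow is constant, so the leading vector spans the line of the
   invariant vector. *)
have lead0 (k : 'I_n -> int) M v : (forall i, k i = 0) -> v != 0 ->
    leads (sum_rep theta) (sum_vec theta) (fun j => (k j)%:~R) M v ->
    <[v]>%VS = <[sum_vec theta]>%VS.
  move=> k0 v0 L; apply: (@vline_lim_unique _ _ _ (pinfty_nbhs R) _
    (fun tau => expR (- (tau * M)) *: (sum_rep theta (exp_diag (fun j => tau * (k j)%:~R)) *m sum_vec theta))
    (fun=> sum_vec theta)) => //; [exact: sum_vec_neq0|exact: mlim_cst|].
  apply: nearW => tau; rewrite vline_scale ?gt_eqF ?expR_gt0 //.
  rewrite (_ : exp_diag _ = 1%:M); first by have [-> _] := sum_is_rep theta; rewrite mul1mx.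
  rewrite /exp_diag; apply/matrixP => i j; rewrite !mxE k0 mulr0 expR0 //.
case: H1 => [[k10 PE1]|[k1n PE1]]; case: H2 => [[k20 PE2]|[k2n PE2]].
- move: PE2; rewrite PE1 => -[E].
  have := orbit_eq (@sum_is_rep _ _ _ theta) (@sum_vec_inv _ _ _ theta) u1 E => e.
  have [c1 c1n e1] := vline_eqP n1 (lead0 _ _ _ k10 n1 L1).
  have [c2 c2n e2] := vline_eqP n2 (lead0 _ _ _ k20 n2 L2).
  by rewrite e1 e2 -!scalemxAr !vline_scale // e.
- by move: PE2; rewrite PE1.
- by move: PE2; rewrite PE1.
- move: PE2; rewrite PE1 => -[E].
  have [a [b [a0 S]]] := (null_pencil_eqP u1 u2 (int_row_neq0 R k1n) (int_row_neq0 R k2n)).1 E.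
  have rowE (k : 'I_n -> int) : (fun j => (k j)%:~R) = int_row R k 0.
    by apply/funext => j; rewrite mxE.
  apply: (strong_same_limit (@sum_is_rep _ _ _ theta) (@sum_regular _ _ _ theta)
    (@sum_vec_inv _ _ _ theta) u1 u2 _ a0 S n1 n2).
  + by move=> i j ij; rewrite !mxE ler_int; exact: dom1.
  + by rewrite -rowE; exact: L1.
  + by rewrite -rowE; exact: L2.
Qed.

End PartsAB.

(** * Leading principal minors *)

Section CauchyBinet.
Variable K : comPzRingType.

Lemma det_mulmx_sum m n (A : 'M[K]_(m, n)) (B : 'M[K]_(n, m)) :
  \det (A *m B) = \sum_(f : {ffun 'I_m -> 'I_n}) (\prod_i A i (f i)) * \det (rowsub f B).
Proof.
under [RHS]eq_bigr do rewrite mulr_sumr.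
rewrite exchange_big; apply: eq_bigr => s _ /=.
under eq_bigr do rewrite mxE.
rewrite bigA_distr_bigA /= mulr_sumr; apply: eq_bigr => f _.
rewrite big_split /= mulrCA; congr (_ * (_ * _)).
by apply: eq_bigr => i _; rewrite mxE.
Qed.

(** Summation over all maps: each subset is counted m! times and non-injective maps contribute 0.
    Expanding the first determinant gives one copy of [det_mulmx_sum] per permutation, once f is
    reindexed to absorb the sign. *)
Lemma cauchy_binet m n (A : 'M[K]_(m, n)) (B : 'M[K]_(n, m)) :
  (m`!)%:R * \det (A *m B) =
  \sum_(f : {ffun 'I_m -> 'I_n}) \det (colsub f A) * \det (rowsub f B).
Proof.
under eq_bigr do rewrite /(\det (colsub _ _)) mulr_suml.
rewrite exchange_big /=.
transitivity (\sum_(s : 'S_m) \det (A *m B)).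
  by rewrite sumr_const card_Sn mulr_natl.
apply: eq_bigr => s _; rewrite det_mulmx_sum.
pose act (t : 'S_m) (f : {ffun 'I_m -> 'I_n}) : {ffun 'I_m -> 'I_n} := [ffun i => f (t i)].
rewrite (reindex_onto (act s) (act s^-1%g)) => [|f _]; last first.
  by apply/ffunP => i; rewrite !ffunE permK.
have pT f : act s^-1%g (act s f) == f by apply/eqP/ffunP => i; rewrite !ffunE permKV.
rewrite (eq_bigl predT) => [|f]; last by rewrite pT.
apply: eq_bigr => f _.
have -> : rowsub (act s f) B = row_perm s (rowsub f B).
  by apply/matrixP => i j; rewrite !mxE ffunE.
rewrite row_permE det_mulmx det_perm mulrA; congr (_ * _); rewrite mulrC; congr (_ * _).
by apply: eq_bigr => i _; rewrite mxE ffunE.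
Qed.

End CauchyBinet.

Section LeadingMinors.
Variables (K : fieldType) (n : nat).
Implicit Types (j : 'I_n) (x y : 'M[K]_n).

Definition trunc j : 'I_j.+1 -> 'I_n := widen_ord (ltn_ord j).
Arguments trunc j _ : clear implicits.
(** Ordinals start at 0, so this minor has order j + 1. *)
Definition lead_minor j x : K := \det (mxsub (trunc j) (trunc j) x).
(** The Pluecker coordinates of the span of the first j + 1 columns, indexed by maps instead of
    subsets. *)
Definition col_minor j (f : {ffun 'I_j.+1 -> 'I_n}) x : K := \det (mxsub f (trunc j) x).

Lemma lead_minor_mul (j : 'I_n) (x y : 'M[K]_n) (d : 'rV[K]_n) :
  (j.+1`!)%:R * lead_minor j (x^T *m diag_mx d *m y) =
  \sum_(f : {ffun 'I_j.+1 -> 'I_n}) (\prod_a d 0 (f a)) * (col_minor f x * col_minor f y).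
Proof.
have -> : lead_minor j (x^T *m diag_mx d *m y) =
    \det ((rowsub (trunc j) x^T *m diag_mx d) *m colsub (trunc j) y).
  congr (\det _); apply/matrixP => a b; rewrite !mxE; apply: eq_bigr => i _.
  by rewrite !mxE; congr (_ * _); apply: eq_bigr => l _; rewrite !mxE.
rewrite cauchy_binet; apply: eq_bigr => f _.
have -> : colsub f (rowsub (trunc j) x^T *m diag_mx d) =
    (mxsub f (trunc j) x)^T *m diag_mx (\row_a d 0 (f a)).
  by rewrite !mul_mx_diag; apply/matrixP => a b; rewrite !mxE.
rewrite det_mulmx det_tr det_diag [X in X * _]mulrC -mulrA; congr (_ * (_ * _)).
  by apply: eq_bigr => a _; rewrite mxE.
by congr (\det _); apply/matrixP => a b; rewrite !mxE.
Qed.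

Lemma col_minor_inj j (f : {ffun 'I_j.+1 -> 'I_n}) x : ~~ injectiveb f -> col_minor f x = 0.
Proof.
move=> /injectivePn [a [b ab fab]]; apply: (determinant_alternate ab) => c.
by rewrite !mxE fab.
Qed.

(** The Cauchy-Binet expansion with the projector onto the first j + 1 coordinates in the middle: it
    discards all other maps and leaves a product of two square blocks. *)
Lemma lead_minor_trunc j x y :
  \sum_(f : {ffun 'I_j.+1 -> 'I_n} | [forall a, (f a <= j)%N]) col_minor f x * col_minor f y =
  (j.+1`!)%:R * (lead_minor j x * lead_minor j y).
Proof.
pose d : 'rV[K]_n := \row_i (i <= j)%N%:R.
have := lead_minor_mul j x y d.
rewrite (bigID (fun f : {ffun 'I_j.+1 -> 'I_n} => [forall a, (f a <= j)%N])) /=.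
rewrite [X in _ + X]big1 => [|f /forallPn [a fa]]; last first.
  by rewrite (bigD1 a) //= mxE (negPf fa) !mul0r.
rewrite addr0 (eq_bigr (fun f => col_minor f x * col_minor f y)) => [<-|f /forallP fa]; last first.
  by rewrite big1 ?mul1r // => a _; rewrite mxE fa.
congr (_ * _); rewrite /lead_minor -[\det (mxsub _ _ x)]det_tr -det_mulmx; congr (\det _).
rewrite mul_mx_diag; apply/matrixP => a b; rewrite !mxE.
rewrite (bigID (fun i : 'I_n => (i < j.+1)%N)) /= [X in _ + X]big1 => [|i ij]; last first.
  by rewrite !mxE -ltnS (negPf ij) mulr0 mul0r.
rewrite addr0 (big_ord_narrow (ltn_ord j)); apply: eq_bigr => i _.
by rewrite !mxE /= -ltnS ltn_ord mulr1.
Qed.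

Lemma lead_minor_mul1 (j : 'I_n) x y :
  (j.+1`!)%:R * lead_minor j (x^T *m y) =
  \sum_(f : {ffun 'I_j.+1 -> 'I_n}) col_minor f x * col_minor f y.
Proof.
have := lead_minor_mul j x y (const_mx 1); rewrite diag_const_mx mulmx1 => ->.
by apply: eq_bigr => f _; rewrite big1 ?mul1r // => a _; rewrite mxE.
Qed.

Lemma lead_minor_upper j x b : is_trig_mx b^T ->
  lead_minor j (x *m b) = lead_minor j x * \prod_(l < n | (l <= j)%N) b l l.
Proof.
move=> /is_trig_mxP tb.
have -> : \prod_(l < n | (l <= j)%N) b l l = lead_minor j b.
  rewrite (big_ord_narrow (ltn_ord j)) /lead_minor -det_tr det_trig.
    by apply: eq_bigr => i _; rewrite !mxE.
  by apply/is_trig_mxP => a c ac; rewrite !mxE; have := tb (trunc j a) (trunc j c) ac; rewrite mxE.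
rewrite /lead_minor -det_mulmx; congr (\det _); apply/matrixP => a c; rewrite !mxE.
rewrite (bigID (fun i : 'I_n => (i < j.+1)%N)) /= [X in _ + X]big1 => [|i ij]; last first.
  have := tb (trunc j c) i; rewrite mxE => -> //; rewrite ?mulr0 //=.
  by rewrite (leq_trans (ltn_ord c)) // leqNgt.
by rewrite addr0 (big_ord_narrow (ltn_ord j)); apply: eq_bigr => i _; rewrite !mxE.
Qed.

Lemma lead_minor1 j : lead_minor j (1%:M : 'M[K]_n) = 1.
Proof.
rewrite /lead_minor (_ : mxsub _ _ _ = 1%:M) ?det1 //.
by apply/matrixP => a b; rewrite !mxE.
Qed.

End LeadingMinors.
Arguments trunc {n} j _.

Section MinorLimits.
Variables (R : realType) (n : nat).
Implicit Types (k : 'I_n -> R) (j : 'I_n).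

Definition top_weight k j : R := \sum_(i < n | (i <= j)%N) k i.

(** Weights are measured from the threshold k_j. Each k_i - k_j is at most its positive part h_i,
    the sum of h over an injective image is at most its total, and this total is the excess of the
    top weight; a value below the threshold loses strictly. *)
Lemma sum_weight_le k j (f : 'I_j.+1 -> 'I_n) :
  (forall i l : 'I_n, (i <= l)%N -> k l <= k i) -> injective f ->
  \sum_a k (f a) <= top_weight k j /\
  ((exists a, k (f a) < k j) -> \sum_a k (f a) < top_weight k j).
Proof.
move=> dom injf; pose h (i : 'I_n) := if (i <= j)%N then k i - k j else 0.
have h0 i : 0 <= h i by rewrite /h; case: ifP => // ij; rewrite subr_ge0 dom.
have kh i : k i - k j <= h i.
  by rewrite /h; case: leqP => // ji; rewrite subr_le0 dom // ltnW.
have top : top_weight k j = \sum_i h i + k j *+ j.+1.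
  rewrite /h -big_mkcond /= sumrB /top_weight.
  rewrite (_ : \sum_(i < n | (i <= j)%N) k j = k j *+ j.+1) ?subrK //.
  by rewrite (big_ord_narrow (ltn_ord j) (F := fun=> k j)) sumr_const card_ord.
have himg : \sum_a h (f a) <= \sum_i h i.
  rewrite -(big_imset h (h := f) (A := predT)) /=; last by move=> a b _ _; exact: injf.
  rewrite [leRHS](bigID (mem (f @: predT))) /= lerDl sumr_ge0 // => i _; exact: h0.
have shift : \sum_a k (f a) = \sum_a (k (f a) - k j) + k j *+ j.+1.
  by rewrite sumrB sumr_const card_ord subrK.
rewrite top shift lerD2r ltrD2r; split; first by apply: le_trans himg; exact: ler_sum.
case=> a fa; apply: lt_le_trans himg; rewrite (bigD1 a) //= [ltRHS](bigD1 a) //=.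
rewrite ltr_leD //; last exact: ler_sum.
by apply: lt_le_trans (h0 _); rewrite subr_lt0.
Qed.

(* The factorial compensates for summing over maps instead of subsets. *)
Definition face_minor k j (x y : 'M[R]_n) : R :=
  (j.+1`!)%:R^-1 * \sum_(f : {ffun 'I_j.+1 -> 'I_n} |
      injectiveb f && (\sum_a k (f a) == top_weight k j)) col_minor f x * col_minor f y.

(** In the Cauchy-Binet expansion a map f carries the exponential of tau times its weight, so only
    the maps of top weight survive the normalization. *)
Lemma lead_minor_cvg (T : Type) (F : set_system T) {FF : Filter F} (x y : T -> 'M[R]_n)
    x0 y0 (tau : T -> R) k j :
  (forall i l : 'I_n, (i <= l)%N -> k l <= k i) ->
  mlim F x x0 -> mlim F y y0 -> tau t @[t --> F] --> +oo ->
  expR (- (tau t * top_weight k j)) *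
    lead_minor j ((x t)^T *m exp_diag (fun i => tau t * k i) *m y t) @[t --> F] -->
  face_minor k j x0 y0.
Proof.
move=> dom xx yy ty; pose m1 : R := (j.+1`!)%:R^-1.
have m0 : (j.+1`!)%:R != 0 :> R by rewrite pnatr_eq0 -lt0n fact_gt0.
have cvg_minor (f : {ffun 'I_j.+1 -> 'I_n}) : col_minor f (x t) * col_minor f (y t) @[t --> F] -->
    col_minor f x0 * col_minor f y0.
  have mm (z : T -> 'M[R]_n) z0 : mlim F z z0 -> col_minor f (z t) @[t --> F] --> col_minor f z0.
    move=> zz; apply: (mlim_det (f := fun t => mxsub f (trunc j) (z t))) => a b.
    by rewrite mxE; under eq_cvg do rewrite mxE; exact: zz.
  by apply: cvgM; exact: mm.
rewrite /face_minor big_mkcond /=.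
apply: (near_cvg (f := fun t => m1 * \sum_(f : {ffun 'I_j.+1 -> 'I_n})
  (if injectiveb f then expR (tau t * (\sum_a k (f a) - top_weight k j)) else 0) *
  (col_minor f (x t) * col_minor f (y t)))).
  apply: cvgM; first exact: cvg_cst.
  apply: cvg_sumr => f _; case: (boolP (injectiveb f)) => /= [/injectiveP injf|_]; last first.
    by under eq_cvg do rewrite mul0r; exact: cvg_cst.
  have [le lt] := sum_weight_le dom injf.
  have [e|ne] := eqVneq (\sum_a k (f a)) (top_weight k j).
    by under eq_cvg do rewrite e subrr mulr0 expR0 mul1r; exact: cvg_minor.
  have pos : 0 < top_weight k j - \sum_a k (f a) by rewrite subr_gt0 lt_neqAle ne le.
  rewrite -[X in _ --> X](mul0r (col_minor f x0 * col_minor f y0)).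
  apply: cvgM; last exact: cvg_minor.
  have e t : tau t * (\sum_a k (f a) - top_weight k j) =
      - ((top_weight k j - \sum_a k (f a)) * tau t) by ring.
  by under eq_cvg do rewrite e; exact: expR_decay.
apply: nearW => t; apply: (mulfI m0); rewrite mulrA mulfV // mul1r mulrCA.
rewrite lead_minor_mul mulr_sumr; apply: eq_bigr => f _.
case: (boolP (injectiveb f)) => [_|ninj]; last first.
  by rewrite !(col_minor_inj _ ninj) !(mul0r, mulr0).
rewrite [RHS]mulrA; congr (_ * _).
rewrite (_ : \prod_a _ = expR (tau t * \sum_a k (f a))); last first.
  by rewrite mulr_sumr expR_sum; apply: eq_bigr => a _; rewrite mxE.
by rewrite -expRD; congr expR; ring.
Qed.

Lemma trunc_weight k j : \sum_a k (trunc j a) = top_weight k j.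
Proof.
rewrite /top_weight (big_ord_narrow (ltn_ord j)); apply: eq_bigr => a _.
by congr k; apply: val_inj.
Qed.

(** A strict drop after j leaves the maps into the first j + 1 indices as the only maximal injective
    ones, and [lead_minor_trunc] factors their sum. *)
Lemma face_minor_strict k j x y : (forall i l : 'I_n, (i <= l)%N -> k l <= k i) ->
  (forall i : 'I_n, (j < i)%N -> k i < k j) ->
  face_minor k j x y = lead_minor j x * lead_minor j y.
Proof.
move=> dom st; have m0 : (j.+1`!)%:R != 0 :> R by rewrite pnatr_eq0 -lt0n fact_gt0.
apply: (mulfI m0); rewrite /face_minor mulrA mulfV // mul1r -lead_minor_trunc.
rewrite big_mkcond [RHS]big_mkcond /=; apply: eq_bigr => f _.
case: (boolP (injectiveb f)) => [|ninj] /=; last first.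
  by rewrite (col_minor_inj x ninj) mul0r if_same.
move=> /injectiveP injf; congr (if _ then _ else _).
have [le lt] := sum_weight_le dom injf.
apply/eqP/forallP => [e a|fj].
  rewrite leqNgt; apply/negP => ja; have : \sum_a k (f a) < top_weight k j.
    by apply: lt; exists a; exact: st.
  by rewrite e ltxx.
rewrite -(big_imset k (h := f) (A := predT)) /=; last by move=> a b _ _; exact: injf.
apply: eq_bigl; apply/subset_cardP.
  rewrite card_imset // card_ord -sum1_card (big_ord_narrow (ltn_ord j) (F := fun=> 1%N)).
  by rewrite sum1_card card_ord.
by apply/fintype.subsetP => _ /imsetP [a _ ->]; exact: fj.
Qed.

Lemma face_minor_gt0 k j x : lead_minor j x != 0 -> 0 < face_minor k j x x.
Proof.
move=> x0; rewrite /face_minor mulr_gt0 ?invr_gt0 ?ltr0n ?fact_gt0 //.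
pose f : {ffun 'I_j.+1 -> 'I_n} := [ffun a => trunc j a].
have fE : f =1 trunc j by move=> a; rewrite ffunE.
have cf : col_minor f x = lead_minor j x.
  by congr (\det _); apply/matrixP => a b; rewrite !mxE fE.
rewrite (bigD1 f) /=; last first.
  apply/andP; split.
    apply/injectiveP => a b; rewrite !fE => /(congr1 val) /= ab; exact: val_inj.
  by rewrite -(trunc_weight k); apply/eqP; apply: eq_bigr => a _; rewrite fE.
rewrite ltr_pwDl ?cf -?expr2 ?exprn_even_gt0 // sumr_ge0 // => g _.
by rewrite -expr2 sqr_ge0.
Qed.

End MinorLimits.

Lemma mulmx_col (K : pzSemiRingType) p q r (M : 'M[K]_(p, q)) (N : 'M[K]_(q, r)) i j :
  (M *m N) i j = (M *m col j N) i 0.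
Proof. by rewrite !mxE; apply: eq_bigr => l _; rewrite mxE. Qed.

(** * Spherical representations from kernels *)

Section PolynomialFunctions.
Variables (R : realType) (n : nat).

Definition poly_fun (f : 'M[R]_n -> R) : Prop :=
  exists P : mpoly.mpoly (n * n) R, forall g, f g = mpoly.meval (fun l => mxvec g 0 l) P.

Lemma poly_fun_ext f f' : (forall g, f g = f' g) -> poly_fun f -> poly_fun f'.
Proof. by move=> e [P hP]; exists P => g; rewrite -e. Qed.

Lemma poly_fun_cst c : poly_fun (fun=> c).
Proof. by exists (mpoly.mpolyC (n * n) c) => g; rewrite mpoly.mevalC. Qed.

Lemma poly_fun_entry i j : poly_fun (fun g => g i j).
Proof.
exists (mpoly.mpolyX R (mpoly.mnm1 (mxvec_index i j))) => g.
by rewrite mpoly.mevalXU mxvecE.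
Qed.

Lemma poly_funD f f' : poly_fun f -> poly_fun f' -> poly_fun (fun g => f g + f' g).
Proof. by move=> [P hP] [Q hQ]; exists (P + Q) => g; rewrite mpoly.mevalD hP hQ. Qed.

Lemma poly_funM f f' : poly_fun f -> poly_fun f' -> poly_fun (fun g => f g * f' g).
Proof. by move=> [P hP] [Q hQ]; exists (P * Q) => g; rewrite mpoly.mevalM hP hQ. Qed.

Lemma poly_fun_sum (I : Type) (r : seq I) (f : I -> 'M[R]_n -> R) :
  (forall i, poly_fun (f i)) -> poly_fun (fun g => \sum_(i <- r) f i g).
Proof.
move=> h; elim: r => [|i r IH].
  by apply: poly_fun_ext (poly_fun_cst 0) => g; rewrite big_nil.
by apply: poly_fun_ext (poly_funD (h i) IH) => g; rewrite big_cons.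
Qed.

Lemma poly_fun_prod (I : Type) (r : seq I) (f : I -> 'M[R]_n -> R) :
  (forall i, poly_fun (f i)) -> poly_fun (fun g => \prod_(i <- r) f i g).
Proof.
move=> h; elim: r => [|i r IH].
  by apply: poly_fun_ext (poly_fun_cst 1) => g; rewrite big_nil.
by apply: poly_fun_ext (poly_funM (h i) IH) => g; rewrite big_cons.
Qed.

Lemma poly_fun_exp f k : poly_fun f -> poly_fun (fun g => f g ^+ k).
Proof.
move=> h; elim: k => [|k IH]; first by apply: poly_fun_ext (poly_fun_cst 1) => g; rewrite expr0.
by apply: poly_fun_ext (poly_funM h IH) => g; rewrite exprS.
Qed.

Lemma poly_fun_det m (B : 'M[R]_n -> 'M[R]_m) :
  (forall i j, poly_fun (fun g => B g i j)) -> poly_fun (fun g => \det (B g)).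
Proof.
move=> h; apply: poly_fun_sum => s; apply: poly_funM; first exact: poly_fun_cst.
by apply: poly_fun_prod => i; exact: h.
Qed.

End PolynomialFunctions.

(** * The irreducible representation spanned by a reproducing kernel *)

Section KernelRepresentation.
Variables (R : realType) (n D : nat) (Phi : 'M[R]_n -> 'rV[R]_D) (H : 'cV[R]_D).

(** The representation space consists of the combinations of the functions x |-> kform x y for
    invertible y; the adjunction [kform_adj] makes it stable under f |-> f(a^T x). The vector [H]
    singles out the invariant function [kvec]. *)
Definition kform x y : R := (Phi x *m (Phi y)^T) 0 0.
Definition kvec x : R := (Phi x *m H) 0 0.

Variable m : 'I_n -> int.
Hypothesis kform_adj : forall a x y, kform (a *m x) y = kform x (a^T *m y).
Hypothesis kform11 : kform 1%:M 1%:M = 1.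
Hypothesis kform_poly : forall x y, poly_fun (fun a => kform x (a *m y)).
Hypothesis kform_upper : forall x b, b \in unitmx -> is_trig_mx b^T ->
  kform x b = (\prod_i b i i ^ m i) * kform x 1%:M.
(** Along d the rescaled kernel degenerates to rank one, that is, to a projection onto the highest
    weight line; irreducibility rests on this. *)
Hypothesis kform_cvg : exists (d : R -> 'M[R]_n) (e : R -> R),
  (forall t, d t \in unitmx) /\ forall x y,
  e t * kform x (d t *m y) @[t --> +oo] --> kform x 1%:M * kform 1%:M y.
Hypothesis kvec_neq0 : forall x, x \in unitmx -> kvec x != 0.
Hypothesis kvec_orth : forall k x, k *m k^T = 1%:M -> kvec (k^T *m x) = kvec x.
Hypothesis m_noninc : nonincreasing_wt m.
Hypothesis m_even : forall j, (2 %| m j)%Z.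

(** A free family of maximal length among the feature vectors of invertible matrices; the length is
    bounded by D. *)
Lemma kernel_basis : exists d (gs : 'I_d -> 'M[R]_n),
  let A := \matrix_i Phi (gs i) in
  [/\ forall i, gs i \in unitmx, row_free A & forall g, g \in unitmx -> (Phi g <= A)%MS].
Proof.
pose P d := exists gs : 'I_d -> 'M[R]_n,
  (forall i, gs i \in unitmx) /\ row_free (\matrix_i Phi (gs i)).
have ex : exists d, `[< P d >].
  exists 0%N; apply/asboolP; exists (fun=> 1%:M); split; first by case.
  by rewrite /row_free -leqn0 rank_leq_row.
have bd d : `[< P d >] -> (d <= D)%N.
  by move=> /asboolP [gs [_ /eqP fr]]; rewrite -{1}fr rank_leq_col.
case: (ex_maxnP ex bd) => d /asboolP [gs [ug fr]] dmax; exists d, gs; split=> // g hg.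
apply: contrapT => /negP ng.
pose gs' (i : 'I_(d + 1)) := match fintype.split i with inl i => gs i | inr _ => g end.
suff : (d + 1 <= d)%N by rewrite addn1 ltnn.
apply: dmax; apply/asboolP; exists gs'; split.
  by move=> i; rewrite /gs'; case: fintype.split.
have -> : \matrix_i Phi (gs' i) = col_mx (\matrix_i Phi (gs i)) (Phi g).
  apply/row_matrixP => i; rewrite rowK /gs'; case: (split_ordP i) => k ->.
    by rewrite rowKu rowK.
  by rewrite rowKd; apply/matrixP => a b; rewrite !mxE !ord1.
rewrite /row_free eqn_leq rank_leq_row /= -addsmxE addn1.
have := mxrankS (addsmxSl (\matrix_i Phi (gs i)) (Phi g)); rewrite (eqP fr) leq_eqVlt.
case/predU1P => [e|//]; case/negP: ng.
apply: submx_trans (addsmxSr (\matrix_i Phi (gs i)) (Phi g)) _.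
by rewrite -(geq_leqif (mxrank_leqif_sup (addsmxSl _ _))) (eqP fr) -e.
Qed.

Section Basis.
Variables (d : nat) (gs : 'I_d -> 'M[R]_n).
Let A := \matrix_i Phi (gs i).
Hypothesis unit_gs : forall i, gs i \in unitmx.
Hypothesis free_gs : row_free A.
Hypothesis span_gs : forall g, g \in unitmx -> (Phi g <= A)%MS.

Let Gram := A *m A^T.
Let coord x : 'rV[R]_d := Phi x *m pinvmx A.
Let kcol y : 'cV[R]_d := \col_i kform (gs i) y.
Let krow x : 'rV[R]_d := \row_j kform x (gs j).

(** Positivity of the real scalar product: u Gram = 0 gives |u A|^2 = 0, and [A] is free. *)
Lemma Gram_unit : Gram \in unitmx.
Proof.
rewrite -row_free_unit.
have sq0 (w : 'rV[R]_D) : w *m w^T = 0 -> w = 0.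
  move=> /matrixP /(_ 0 0); rewrite mxE [RHS]mxE => e.
  have s0 : sqn w^T = 0 by rewrite -[RHS]e; apply: eq_bigr => i _; rewrite mxE expr2.
  apply/eqP; apply: contraTT isT => n0.
  have : w^T != 0 by rewrite -[0]trmx0 (inj_eq trmx_inj).
  by move/sqn_gt0; rewrite s0 ltxx.
have inj (u : 'rV[R]_d) : u *m Gram = 0 -> u = 0.
  move=> e; apply: (row_free_inj free_gs); rewrite mul0mx; apply: sq0.
  by rewrite trmx_mul mulmxA -(mulmxA u) -/Gram e mul0mx.
rewrite -kermx_eq0; apply/eqP/row_matrixP => i; rewrite row0; apply: inj.
by rewrite -row_mul mulmx_ker row0.
Qed.

Lemma coordP g : g \in unitmx -> Phi g = coord g *m A.
Proof. by move=> ug; rewrite mulmxKpV // span_gs. Qed.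

Lemma kcolE y : kcol y = A *m (Phi y)^T.
Proof.
apply/matrixP => i j; rewrite ord1 mxE /kform mxE [RHS]mxE; apply: eq_bigr => l _.
by rewrite [A i l]mxE.
Qed.

Lemma krowE x : krow x = Phi x *m A^T.
Proof.
apply/matrixP => i j; rewrite !ord1 mxE /kform mxE [RHS]mxE; apply: eq_bigr => l _.
by rewrite ![_^T _ _]mxE [A j l]mxE.
Qed.

Lemma kform_reproduce x y : y \in unitmx -> kform x y = (krow x *m invmx Gram *m kcol y) 0 0.
Proof.
move=> uy; rewrite krowE kcolE /kform; move: (coord y) (coordP uy) => c ->.
rewrite trmx_mul (mulmxA A) -/Gram -(mulmxA (Phi x *m _)) (mulmxA (invmx Gram)).
by rewrite mulVmx ?Gram_unit // mul1mx -mulmxA.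
Qed.

Lemma kform_coord g y : g \in unitmx -> kform g y = (coord g *m kcol y) 0 0.
Proof. by move=> ug; rewrite kcolE mulmxA -coordP. Qed.

Let rvec : 'cV[R]_d := invmx Gram *m (A *m H).

Lemma kvec_reproduce x : x \in unitmx -> kvec x = (krow x *m rvec) 0 0.
Proof.
move=> ux; rewrite krowE /kvec /rvec; move: (coord x) (coordP ux) => c ->.
by rewrite -(mulmxA c A A^T) -/Gram -(mulmxA c Gram) mulKVmx ?Gram_unit // mulmxA.
Qed.

Let gmat a : 'M[R]_d := \matrix_(i, j) kform (gs i) (a *m gs j).
(** A function is recorded by the column of its values at the points gs. In these coordinates this
    is the matrix of f |-> f(a^T x): it sends [kcol y] to [kcol (a *m y)] for invertible y. *)
Definition kernel_rep a : 'M[R]_d := gmat a *m invmx Gram.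
Definition kernel_vec : 'cV[R]_d := \col_i kvec (gs i).

Lemma row_gmat a i : row i (gmat a) = krow (a^T *m gs i).
Proof. by apply/rowP => j; rewrite !mxE kform_adj trmxK. Qed.

Lemma kernel_rep_col a y : y \in unitmx -> kernel_rep a *m kcol y = kcol (a *m y).
Proof.
move=> uy; apply/matrixP => i j; rewrite ord1 [RHS]mxE.
have -> : kform (gs i) (a *m y) = kform (a^T *m gs i) y by rewrite kform_adj trmxK.
rewrite kform_reproduce // -row_gmat /kernel_rep -!row_mul.
by rewrite [RHS]mxE.
Qed.

Lemma kernel_rep_vec a : a \in unitmx ->
  kernel_rep a *m kernel_vec = \col_i kvec (a^T *m gs i).
Proof.
move=> ua; have -> : kernel_vec = Gram *m rvec.
  apply/matrixP => i j; rewrite ord1 mxE kvec_reproduce // [RHS]mxE mxE.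
  apply: eq_bigr => l _; congr (_ * _); rewrite krowE mxE [RHS]mxE.
  by apply: eq_bigr => q _; rewrite [A i q]mxE.
rewrite /kernel_rep mulmxA mulmxKV ?Gram_unit //.
apply/matrixP => i j; rewrite ord1 [RHS]mxE kvec_reproduce ?unitmx_mul ?unitmx_tr ?ua ?unit_gs //.
by rewrite -row_gmat -row_mul [RHS]mxE.
Qed.

Lemma gmat_col a j : col j (gmat a) = kcol (a *m gs j).
Proof. by apply/colP => i; rewrite !mxE. Qed.

Lemma kernel_is_rep : is_rep kernel_rep.
Proof.
split.
  have -> : kernel_rep 1%:M = Gram *m invmx Gram; last by rewrite mulmxV ?Gram_unit.
  congr (_ *m _); apply/matrixP => i j; rewrite mxE mul1mx /kform mxE [RHS]mxE.
  by apply: eq_bigr => l _; rewrite ![_^T _ _]mxE ![A _ _]mxE.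
move=> a b ua ub; rewrite [kernel_rep b]/kernel_rep mulmxA; congr (_ *m _).
apply/matrixP => i j.
have -> : (kernel_rep a *m gmat b) i j = (kernel_rep a *m kcol (b *m gs j)) i 0.
  by rewrite mulmx_col gmat_col.
by rewrite kernel_rep_col ?unitmx_mul ?ub ?unit_gs // mulmxA !mxE.
Qed.

Lemma kernel_polynomial : polynomial_rep kernel_rep.
Proof.
have h ab : poly_fun (fun g => kernel_rep g ab.1 ab.2).
  apply: (@poly_fun_ext _ _ (fun g => \sum_l kform (gs ab.1) (g *m gs l) * invmx Gram l ab.2)).
    by move=> g; rewrite mxE; apply: eq_bigr => l _; rewrite mxE.
  by apply: poly_fun_sum => l; apply: poly_funM; [exact: kform_poly|exact: poly_fun_cst].
have /choice [P hP] := h.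
by exists 0%N, (fun a b => P (a, b)) => g _ a b; rewrite expr0 mul1r (hP (a, b)).
Qed.

Lemma kcol1_neq0 : kcol 1%:M != 0.
Proof.
apply/eqP => e; have := kform_reproduce 1%:M (unitmx1 R n).
by rewrite e mulmx0 kform11 mxE => /eqP; rewrite oner_eq0.
Qed.

Lemma vspace_closed (T : Type) (F : set_system T) {FF : ProperFilter F}
    (W : {vspace 'cV[R]_d}) (x : T -> 'cV[R]_d) x0 :
  (forall t, x t \in W) -> mlim F x x0 -> x0 \in W.
Proof.
move=> xW xx0; pose pr := projv W.
have prE v : v \in W <-> pr v = v.
  by split=> [/projv_id//|<-]; exact: memv_proj.
have lin v : pr v = \sum_i v i 0 *: pr (delta_mx i 0).
  rewrite {1}(matrix_sum_delta v) linear_sum; apply: eq_bigr => i _.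
  by rewrite big_ord1 linearZ.
have lim_pr : mlim F (fun t => pr (x t)) (pr x0).
  apply: (@mlim_near _ _ _ _ _ _ (fun t => \sum_i x t i 0 *: pr (delta_mx i 0))).
    by apply: nearW => t; rewrite [RHS]lin.
  rewrite (lin x0); apply: mlim_sum => i _; apply: mlimZ; [exact: xx0|exact: mlim_cst].
apply/prE/matrixP => i j; have l1 := lim_pr i j; have l2 := xx0 i j.
apply: (cvg_unique (@Rhausdorff R) l1); apply: near_cvg l2 _; apply: nearW => t.
by have /prE -> := xW t.
Qed.

(* The torus elements d t contract any vector onto the highest weight vector
   kcol 1, whose orbit spans. *)
Lemma kernel_irreducible : irreducible_rep kernel_rep.
Proof.
have [i0 [_ _]] := mx_neq0 kcol1_neq0.
split; first by rewrite (leq_ltn_trans _ (ltn_ord i0)).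
move=> W invW; have [->|W0] := eqVneq W 0%VS; first by left.
right; pose u := vpick W; have uW : u \in W by exact: memv_pick.
have [i [j uij]] : exists i j, u i j != 0 by apply: mx_neq0; rewrite vpick0.
move: uij; rewrite ord1 => ui {j}.
have ugi : (gs i)^T \in unitmx by rewrite unitmx_tr unit_gs.
(* The translation moves the value of u at gs i to the identity, so the coefficient l that the
   contraction puts on the highest weight vector is u i 0. *)
pose u' := kernel_rep (gs i)^T *m u; have u'W : u' \in W by exact: invW.
pose c := invmx Gram *m u'; pose l := (krow 1%:M *m c) 0 0.
have GramE a b : Gram a b = kform (gs a) (gs b).
  by rewrite /kform !mxE; apply: eq_bigr => q _; rewrite !mxE.
have u'E : u' = Gram *m c by rewrite mulKVmx ?Gram_unit.
have l0 : l != 0.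
  have -> : l = u i 0; last by [].
  have e : krow 1%:M *m invmx Gram *m gmat (gs i)^T = row i Gram.
    apply/rowP => b; rewrite mulmx_col gmat_col -kform_reproduce ?unitmx_mul ?ugi ?unit_gs //.
    rewrite mxE GramE -[in RHS](mulmx1 (gs i)).
    by rewrite kform_adj.
  rewrite /l /c /u' /kernel_rep !mulmxA e -row_mul mulmxV ?Gram_unit // -row_mul mul1mx.
  by rewrite mxE.
have k1W : kcol 1%:M \in W.
  suff h : l *: kcol 1%:M \in W by rewrite -[kcol _](scalerK l0) memvZ.
  have [dd [e [ud cd]]] := kform_cvg.
  apply: (@vspace_closed R (+oo%R : set_system R) _ W (fun t => e t *: (kernel_rep (dd t) *m u'))).
    by move=> t; rewrite memvZ // invW.
  move=> a b; rewrite ord1.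
  apply: (near_cvg (f := fun t => \sum_q (e t * kform (gs a) (dd t *m gs q)) * c q 0)).
    rewrite (_ : (l *: kcol 1%:M) a 0 = \sum_q kform (gs a) 1%:M * kform 1%:M (gs q) * c q 0).
      by apply: cvg_sumr => q _; apply: cvgM; [exact: cd|exact: cvg_cst].
    rewrite mxE [kcol _ _ _]mxE mulrC /l mxE mulr_sumr; apply: eq_bigr => q _.
    by rewrite [krow _ _ _]mxE mulrA.
  apply: nearW => t; rewrite mxE /kernel_rep u'E -mulmxA (mulmxA (invmx _)) mulVmx ?Gram_unit //.
  by rewrite mul1mx mxE mulr_sumr; apply: eq_bigr => q _; rewrite [gmat _ _ _]mxE mulrA.
have kW b : kcol (gs b) \in W.
  by rewrite -[gs b]mulmx1 -kernel_rep_col ?unitmx1 // invW.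
apply/vspaceP => v; rewrite memvf -[v](mulKVmx Gram_unit).
rewrite (_ : Gram *m _ = \sum_b (invmx Gram *m v) b 0 *: kcol (gs b)).
  by rewrite memv_suml // => b _; rewrite memvZ.
apply/matrixP => a b; rewrite ord1 mxE summxE; apply: eq_bigr => q _.
by rewrite GramE [RHS]mxE [kcol _ _ _]mxE mulrC.
Qed.

(** Evaluation at any invertible g, not only at the basis points, is a linear functional; through it
    limits of vectors are read as limits of kernel values. *)
Lemma coord_kernel_rep g x : g \in unitmx -> x \in unitmx ->
  (coord g *m (kernel_rep x *m kernel_vec)) 0 0 = kvec (x^T *m g).
Proof.
move=> ug ux; rewrite kernel_rep_vec // kvec_reproduce ?unitmx_mul ?unitmx_tr ?ux //.
have -> : krow (x^T *m g) = coord g *m gmat x.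
  apply/rowP => j; rewrite mulmx_col gmat_col -kform_coord // mxE.
  by rewrite kform_adj trmxK.
rewrite -mulmxA; congr ((_ *m _) 0 0); apply/matrixP => i j.
rewrite ord1 mxE kvec_reproduce ?unitmx_mul ?unitmx_tr ?ux ?unit_gs //.
by rewrite -row_gmat -row_mul mxE.
Qed.

Lemma kernel_highest_weight : highest_weight kernel_rep m.
Proof.
exists (kcol 1%:M); first exact: kcol1_neq0.
move=> b ub tb; rewrite kernel_rep_col ?unitmx1 // mulmx1; apply/matrixP => i j.
by rewrite ord1 mxE kform_upper // [RHS]mxE [kcol _ _ _]mxE.
Qed.

End Basis.

Lemma kernel_spherical : exists sp : spherical_irrep R n,
  (exists gs : 'I_(si_dim sp) -> 'M[R]_n, forall x, x \in unitmx -> forall i,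
     (si_rep sp x *m si_vec sp) i 0 = kvec (x^T *m gs i)) /\
  forall g, g \in unitmx -> exists l : 'rV_(si_dim sp), forall x, x \in unitmx ->
     (l *m (si_rep sp x *m si_vec sp)) 0 0 = kvec (x^T *m g).
Proof.
have [d [gs [ug fg sg]]] := kernel_basis.
have irr := kernel_irreducible ug fg sg.
have v0 : kernel_vec gs != 0.
  have [d0 _] := irr; apply/eqP => /matrixP /(_ (Ordinal d0) 0).
  by rewrite !mxE => /eqP; apply/negP; exact: kvec_neq0.
have vinv k : k *m k^T = 1%:M -> kernel_rep gs k *m kernel_vec gs = kernel_vec gs.
  move=> kk; have [uk _] := mulmx1_unit kk.
  by rewrite kernel_rep_vec //; apply/matrixP => i j; rewrite !mxE kvec_orth.
exists (SphericalIrrep (kernel_is_rep ug fg sg) (kernel_polynomial gs) irr m_noninc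
  (kernel_highest_weight fg sg) m_even v0 vinv) => /=; split.
  by exists gs => x ux i; rewrite kernel_rep_vec // mxE.
by move=> g ugg; exists (Phi g *m pinvmx (\matrix_i Phi (gs i))) => x ux; exact: coord_kernel_rep.
Qed.

End KernelRepresentation.

(** * The kernels given by products of leading minors *)

Section MinorKernel.
Variables (R : realType) (n : nat).
Implicit Types (x y : 'M[R]_n) (c : 'I_n -> nat) (j : 'I_n).

Definition minors c (x : 'M[R]_n) : R := \prod_j lead_minor j x ^+ c j.

(** Kernels of finite rank that are Gram kernels of a feature map; tensor products of features make
    them stable under products. *)
Definition has_features (kap : 'M[R]_n -> 'M[R]_n -> R) : Prop :=
  exists (I : finType) (psi : 'M[R]_n -> I -> R),
  forall x y, kap x y = \sum_i psi x i * psi y i.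

Lemma has_featuresM kap kap' : has_features kap -> has_features kap' ->
  has_features (fun x y => kap x y * kap' x y).
Proof.
move=> [I [psi hpsi]] [I' [psi' hpsi']].
exists (I * I')%type, (fun x p => psi x p.1 * psi' x p.2) => x y.
rewrite hpsi hpsi' big_distrlr pair_bigA /=; apply: eq_bigr => p _; ring.
Qed.

Lemma has_features1 : has_features (fun _ _ => 1).
Proof. by exists unit, (fun _ _ => 1) => x y; rewrite big_const card_unit /= addr0 mulr1. Qed.

Lemma has_features_prod (I : Type) (r : seq I) (kap : I -> 'M[R]_n -> 'M[R]_n -> R) (c : I -> nat) :
  (forall i, has_features (kap i)) ->
  has_features (fun x y => \prod_(i <- r) kap i x y ^+ c i).
Proof.
have ext k k' : (forall x y, k x y = k' x y) -> has_features k -> has_features k'.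
  by move=> e [J [psi h]]; exists J, psi => x y; rewrite -e.
move=> h; elim: r => [|i r IH].
  by apply: ext has_features1 => x y; rewrite big_nil.
apply: (ext (fun x y => kap i x y ^+ c i * \prod_(i <- r) kap i x y ^+ c i)).
  by move=> x y; rewrite big_cons.
apply: has_featuresM => //; elim: (c i) => [|k IHk].
  by apply: ext has_features1 => x y; rewrite expr0.
apply: (ext (fun x y => kap i x y * kap i x y ^+ k)); first by move=> x y; rewrite exprS.
exact: has_featuresM.
Qed.

Lemma lead_minor_features j : has_features (fun x y => lead_minor j (x^T *m y)).
Proof.
have m0 : 0 < (j.+1`!)%:R :> R by rewrite ltr0n fact_gt0.
exists {ffun 'I_j.+1 -> 'I_n}, (fun x f => Num.sqrt (j.+1`!)%:R^-1 * col_minor f x) => x y.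
apply: (mulfI (lt0r_neq0 m0)); rewrite lead_minor_mul1 mulr_sumr.
apply: eq_bigr => f _; rewrite mulrACA -expr2 sqr_sqrtr ?invr_ge0 ?ltW //.
by rewrite mulVKf ?gt_eqF.
Qed.

(** A principal submatrix is P^T x P for the inclusion [P] of the first coordinates, hence again
    positive definite. *)
Lemma lead_minor_neq0 j x : pdef x -> lead_minor j x != 0.
Proof.
move=> px; pose P : 'M[R]_(n, j.+1) := colsub (trunc j) 1%:M.
have e (m : nat) (B : 'M[R]_(n, m)) : P^T *m B = rowsub (trunc j) B.
  apply/matrixP => a b; rewrite mxE (bigD1 (trunc j a)) //= big1 => [|i ia].
    by rewrite !mxE eqxx mul1r addr0.
  by rewrite !mxE (negPf ia) mul0r.
have xE : mxsub (trunc j) (trunc j) x = P^T *m x *m P.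
  rewrite -mulmxA e; apply/matrixP => a b; rewrite !mxE (bigD1 (trunc j b)) //= big1 => [|i ib].
    by rewrite !mxE eqxx mulr1 addr0.
  by rewrite !mxE (negPf ib) mulr0.
suff : pdef (mxsub (trunc j) (trunc j) x) by move/posdef_unit; rewrite unitmxE unitfE.
split; first by have [sx _] := px; rewrite xE !trmx_mul trmxK sx mulmxA.
move=> v v0; rewrite xE /qf -!mulmxA (mulmxA v^T) -[v^T *m P^T]trmx_mul (mulmxA _ x).
apply: px.2; apply: contraNneq v0 => Pv; have := e _ (P *m v); rewrite Pv mulmx0 => /matrixP h.
apply/eqP/matrixP => a b; rewrite mxE; have := h a b; rewrite [LHS]mxE.
have -> : rowsub (trunc j) (0 : 'M[R]_(n, 1)) = rowsub (trunc j) (P *m v) by rewrite Pv.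
rewrite mxE mxE (bigD1 a) //= big1 => [|i ia]; first by rewrite !mxE eqxx mul1r addr0.
rewrite !mxE (_ : (_ == _) = false) ?mul0r //; apply/negP => /eqP /(congr1 val) /= ai.
by move/eqP: ia; apply; apply: val_inj.
Qed.

Lemma minors_neq0 c x : pdef x -> minors c x != 0.
Proof. by move=> px; apply/prodf_neq0 => j _; rewrite expf_neq0 // lead_minor_neq0. Qed.

(** The weight sum of 2 c_j omega_j, where omega_j has j + 1 ones; the factor 2, which gives
    evenness, comes from squaring the kernel. *)
Definition minor_weight c (l : 'I_n) : int := Posz (\sum_(j < n | (l <= j)%N) 2 * c j)%N.

Lemma minors_upper c x b : is_trig_mx b^T ->
  minors c (x *m b) ^+ 2 = (\prod_i b i i ^ minor_weight c i) * minors c x ^+ 2.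
Proof.
move=> tb; have -> : minors c (x *m b) = minors c x *
    \prod_(j < n) \prod_(l < n | (l <= j)%N) b l l ^+ c j.
  rewrite -big_split; apply: eq_bigr => j _ /=.
  by rewrite lead_minor_upper // exprMn prodrXl.
rewrite exprMn mulrC; congr (_ * _).
rewrite (exchange_big_dep predT) //= -prodrXl; apply: eq_bigr => l _.
rewrite -[LHS]prodrXl /minor_weight -exprnP expr_sum.
by apply: eq_bigr => j _; rewrite -exprM mulnC.
Qed.

Lemma minors_tr c x : minors c x^T = minors c x.
Proof.
apply: eq_bigr => j _; congr (_ ^+ _); rewrite /lead_minor -det_tr; congr (\det _).
by apply/matrixP => a b; rewrite !mxE.
Qed.

Definition total_weight c (k : 'I_n -> R) : R := \sum_j (c j)%:R * top_weight k j.

Lemma minors_cvg (T : Type) (F : set_system T) {FF : Filter F} (x y : T -> 'M[R]_n)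
    x0 y0 (tau : T -> R) (k : 'I_n -> R) c :
  (forall i l : 'I_n, (i <= l)%N -> k l <= k i) ->
  mlim F x x0 -> mlim F y y0 -> tau t @[t --> F] --> +oo ->
  expR (- (tau t * total_weight c k)) *
    minors c ((x t)^T *m exp_diag (fun i => tau t * k i) *m y t) @[t --> F] -->
  \prod_j face_minor k j x0 y0 ^+ c j.
Proof.
move=> dom xx yy ty.
apply: (near_cvg (f := fun t => \prod_j (expR (- (tau t * top_weight k j)) *
   lead_minor j ((x t)^T *m exp_diag (fun i => tau t * k i) *m y t)) ^+ c j)).
  by apply: cvg_prodr => j _; apply: cvg_expr; exact: lead_minor_cvg.
apply: nearW => t; rewrite -[RHS]mulr1 /total_weight mulr_sumr -sumrN expR_sum mulr1 -big_split /=.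
apply: eq_bigr => j _; rewrite exprMn -expRM_natl; congr (expR _ * _); ring.
Qed.

Lemma minor_spherical c : exists sp : spherical_irrep R n,
  (exists gs : 'I_(si_dim sp) -> 'M[R]_n, forall x, x \in unitmx -> forall i,
     (si_rep sp x *m si_vec sp) i 0 = minors c ((x^T *m gs i)^T *m (x^T *m gs i))) /\
  forall g, g \in unitmx -> exists l : 'rV_(si_dim sp), forall x, x \in unitmx ->
     (l *m (si_rep sp x *m si_vec sp)) 0 0 = minors c ((x^T *m g)^T *m (x^T *m g)).
Proof.
have [I [psi psiE]] : has_features (fun x y => minors c (x^T *m y)).
  by apply: has_features_prod => j; exact: lead_minor_features.
(* The feature space of the squared kernel is the tensor square of that of the
   kernel; pairing with its canonical element H evaluates the kernel on the diagonal. *)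
pose Phi x : 'rV[R]_#|{: I * I}| := \row_q (psi x (enum_val q).1 * psi x (enum_val q).2).
pose H : 'cV[R]_#|{: I * I}| := \col_q ((enum_val q).1 == (enum_val q).2)%:R.
have kformE x y : kform Phi x y = minors c (x^T *m y) ^+ 2.
  rewrite psiE expr2 big_distrlr pair_bigA /= /kform mxE.
  rewrite (reindex _ (onW_bij _ (enum_val_bij {: I * I}))) /=.
  by apply: eq_bigr => q _; rewrite !mxE; ring.
have kvecE x : kvec Phi H x = minors c (x^T *m x).
  rewrite psiE /kvec mxE.
  transitivity (\sum_(p : I * I) psi x p.1 * psi x p.2 * (p.1 == p.2)%:R).
    rewrite [RHS](reindex _ (onW_bij _ (enum_val_bij {: I * I}))) /=.
    by apply: eq_bigr => q _; rewrite !mxE.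
  rewrite -(pair_bigA _ (fun i i' => psi x i * psi x i' * (i == i')%:R)) /=.
  apply: eq_bigr => i _; rewrite (bigD1 i) //= eqxx mulr1 big1 ?addr0 // => i' ii'.
  by rewrite eq_sym (negPf ii') mulr0.
have [] // := @kernel_spherical R n _ Phi H (minor_weight c).
- by move=> a x y; rewrite !kformE trmx_mul mulmxA.
- rewrite kformE trmx1 mul1mx /minors big1 ?expr1n // => j _.
  by rewrite lead_minor1 expr1n.
- move=> x y; apply: (poly_fun_ext (f := fun a => minors c (x^T *m (a *m y)) ^+ 2)).
    by move=> a; rewrite kformE.
  apply: poly_fun_exp; apply: poly_fun_prod => j; apply: poly_fun_exp.
  apply: poly_fun_det => a b.
  apply: (poly_fun_ext (f := fun g => \sum_q x^T (trunc j a) q *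
      \sum_l g q l * y l (trunc j b))).
    by move=> g; rewrite [RHS]mxE [RHS]mxE; apply: eq_bigr => q _; rewrite [(g *m y) _ _]mxE.
  apply: poly_fun_sum => q; apply: poly_funM; first exact: poly_fun_cst.
  by apply: poly_fun_sum => l; apply: poly_funM; [exact: poly_fun_entry|exact: poly_fun_cst].
- by move=> x b ub tb; rewrite !kformE mulmx1 minors_upper.
(* Strictly decreasing exponents make every face minor factor, so the limit of the kernel has rank
   one. *)
- pose k (i : 'I_n) : R := - (i : nat)%:R.
  exists (fun t => exp_diag (fun i => t * k i)), (fun t => expR (- (t * total_weight c k)) ^+ 2).
  split=> [t|x y]; first exact: unit_exp_diag.
  rewrite !kformE trmx1 mulmx1 mul1mx minors_tr -exprMn.
  apply: (near_cvg (f := fun t => (expR (- (t * total_weight c k)) *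
      minors c (x^T *m exp_diag (fun i => t * k i) *m y)) ^+ 2)).
    apply: cvg_expr.
    have -> : minors c x * minors c y = \prod_j face_minor k j x y ^+ c j.
      rewrite -big_split /=; apply: eq_bigr => j _; rewrite face_minor_strict ?exprMn //.
        by move=> i l il; rewrite lerN2 ler_nat.
      by move=> i ji; rewrite ltrN2 ltr_nat.
    apply: (minors_cvg (x := fun=> x) (y := fun=> y) (tau := id)).
    - by move=> i l il; rewrite lerN2 ler_nat.
    - exact: mlim_cst.
    - exact: mlim_cst.
    - exact: cvg_id.
  by apply: nearW => t; rewrite kformE exprMn mulmxA.
- move=> x ux; rewrite kvecE; apply: minors_neq0.
  by rewrite -[X in _ *m X]trmxK; apply: pdef_mulT; rewrite unitmx_tr.
- move=> k x kk; rewrite !kvecE trmx_mul trmxK -mulmxA (mulmxA k) kk mul1mx //.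
- move=> i j ij; rewrite lez_nat [leqRHS](bigID (fun l : 'I_n => (j <= l)%N)) /=.
  apply: leq_trans (leq_addr _ _); apply: eq_leq; apply: eq_bigl => l.
  by case: (leqP j l) => jl; rewrite ?andbF // (leq_trans ij jl).
- by move=> j; rewrite /minor_weight -big_distrr /= PoszM dvdz_mulr.
move=> sp [[gs gsE] lE]; exists sp; split.
  by exists gs => x ux i; rewrite gsE // kvecE.
by move=> g ug; have [l h] := lE g ug; exists l => x ux; rewrite h // kvecE.
Qed.

End MinorKernel.

(** * Recovering the null pencil from the limits *)

Section LimitMinors.
Variables (R : realType) (n : nat).
Implicit Types (c : 'I_n -> nat) (k : 'I_n -> R) (g : 'M[R]_n).

Definition face_minors c k (x : 'M[R]_n) : R := \prod_j face_minor k j x x ^+ c j.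

Lemma face_minors1_neq0 c k : face_minors c k 1%:M != 0.
Proof.
apply/prodf_neq0 => j _; rewrite expf_neq0 // gt_eqF // face_minor_gt0 //.
by rewrite lead_minor1 oner_eq0.
Qed.

Lemma gram_minors_cvg c k g0 g : (forall i l : 'I_n, (i <= l)%N -> k l <= k i) ->
  let x tau := g0 *m exp_diag (fun j => tau * k j) in
  expR (- (tau * (2%:R * total_weight c k))) *
    minors c (((x tau)^T *m g)^T *m ((x tau)^T *m g)) @[tau --> +oo] -->
  face_minors c k (g0^T *m g).
Proof.
move=> dom x; apply: (near_cvg (f := fun tau : R => expR (- (2%:R * tau * total_weight c k)) *
   minors c ((g0^T *m g)^T *m exp_diag (fun i => 2%:R * tau * k i) *m (g0^T *m g)))).
  apply: (minors_cvg (x := fun=> g0^T *m g) (y := fun=> g0^T *m g)) => //; first exact: mlim_cst.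
    exact: mlim_cst.
  by apply: (gt0_cvgMry (ltr0Sn R 1)); exact: cvg_id.
apply: nearW => tau; congr (expR _ * minors c _); first ring.
rewrite /x trmx_mul trmxK !trmx_mul trmxK tr_diag_mx !mulmxA; congr (_ *m _ *m _).
rewrite -!mulmxA; congr (_ *m (_ *m _)); rewrite /exp_diag tr_diag_mx mulmx_diag; congr diag_mx.
by apply/rowP => i; rewrite !mxE -expRD; congr expR; ring.
Qed.

(** Two normalizations of the same function, both with finite limits, differ by the factor e^(-(M -
    W) tau). *)
Lemma exp_scale_lim (f : R -> R) (M W L E : R) :
  expR (- (tau * M)) * f tau @[tau --> +oo] --> L ->
  expR (- (tau * W)) * f tau @[tau --> +oo] --> E ->
  (W < M -> L = 0) /\ (M = W -> L = E).
Proof.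
move=> fL fE; split=> [WM|MW]; last first.
  by move: fE; rewrite -MW => fE; exact: cvg_unique fL fE.
apply: (cvg_unique (@Rhausdorff R) fL).
rewrite -(mul0r E); apply: (near_cvg (f := fun tau : R => expR (- ((M - W) * tau)) *
    (expR (- (tau * W)) * f tau))).
  by apply: cvgM => //; apply: expR_decay; [rewrite subr_gt0|exact: cvg_id].
by apply: nearW => tau; rewrite mulrA -expRD; congr (expR _ * _); ring.
Qed.

Definition minor_functional (sp : spherical_irrep R n) c (l : 'rV_(si_dim sp)) g : Prop :=
  forall x, x \in unitmx ->
    (l *m (si_rep sp x *m si_vec sp)) 0 0 = minors c ((x^T *m g)^T *m (x^T *m g)).

(** The first clause writes the coordinates as kernel values, so that a limit vector can be tested
    for vanishing; the second provides a functional for every invertible g. *)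
Definition represents (sp : spherical_irrep R n) c : Prop :=
  (exists gs : 'I_(si_dim sp) -> 'M[R]_n, forall i, minor_functional c (delta_mx 0 i) (gs i)) /\
  forall g, g \in unitmx -> exists l : 'rV_(si_dim sp), minor_functional c l g.

Lemma exists_represents c : exists sp, represents sp c.
Proof.
have [sp [[gs gsE] lE]] := @minor_spherical R n c; exists sp; split; last exact: lE.
by exists gs => i x ux; rewrite -rowE mxE gsE.
Qed.

Section OneCurve.
Variables (p : nat) (theta : 'I_p -> spherical_irrep R n) (c : 'I_p -> 'I_n -> nat).
Hypothesis theta_c : forall i, represents (theta i) (c i).
Variables (g0 : 'M[R]_n) (k : 'I_n -> R) (M : R) (w : 'cV[R]_(sum_dim theta)).
Hypothesis unit_g0 : g0 \in unitmx.
Hypothesis dom_k : forall i l : 'I_n, (i <= l)%N -> k l <= k i.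
Hypothesis cvg_w : mlim (pinfty_nbhs R) (fun tau => expR (- (tau * M)) *:
  (sum_rep theta (g0 *m exp_diag (fun j => tau * k j)) *m sum_vec theta)) w.

Let x tau := g0 *m exp_diag (fun j => tau * k j).
Let Om i := 2%:R * total_weight (c i) k.

Lemma unit_flow tau : x tau \in unitmx.
Proof. by rewrite unitmx_mul unit_g0 unit_exp_diag. Qed.

Lemma functional_cvg i g (l : 'rV_(si_dim (theta i))) : minor_functional (c i) l g ->
  expR (- (tau * M)) * minors (c i) (((x tau)^T *m g)^T *m ((x tau)^T *m g)) @[tau --> +oo] -->
  (l *m submxcol w i) 0 0.
Proof.
move=> lg; have lim_i : mlim (pinfty_nbhs R)
    (fun tau => expR (- (tau * M)) *: (si_rep (theta i) (x tau) *m si_vec (theta i))) (submxcol w i).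
  move=> a b; have := @cvg_w (tagnat.Rank i a) b; rewrite [submxcol w i a b]mxE.
  have e tau : si_rep (theta i) (x tau) *m si_vec (theta i) =
      submxcol (sum_rep theta (x tau) *m sum_vec theta) i by rewrite sum_orbit mxcolK.
  move=> h; apply: near_cvg h _; apply: nearW => tau.
  by rewrite e mxE [RHS]mxE [submxcol _ _ _ _]mxE.
have h : mlim (pinfty_nbhs R) (fun tau => l *m (expR (- (tau * M)) *:
    (si_rep (theta i) (x tau) *m si_vec (theta i)))) (l *m submxcol w i).
  by apply: mlimM => //; exact: mlim_cst.
have h00 := @h 0 0; apply: near_cvg h00 _.
by apply: nearW => tau; rewrite -scalemxAr mxE lg // unit_flow.
Qed.

(** Otherwise the i-th summand would outgrow the normalization e^(tau M). The test point g0^-T makes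
    g0^T g = 1, where the limiting product of minors is nonzero. *)
Lemma weight_le_scale i : Om i <= M.
Proof.
have ui : invmx g0^T \in unitmx by rewrite unitmx_inv unitmx_tr.
have [_ /(_ _ ui) [l hl]] := theta_c i; rewrite leNgt; apply/negP => lt.
have [/(_ lt) e _] := exp_scale_lim (gram_minors_cvg (c := c i) (g0 := g0) (g := invmx g0^T) dom_k)
  (functional_cvg hl).
by move/eqP: e; rewrite mulmxV ?unitmx_tr //; apply/negP; exact: face_minors1_neq0.
Qed.

Lemma functional_limit i g (l : 'rV_(si_dim (theta i))) : minor_functional (c i) l g ->
  (l *m submxcol w i) 0 0 = if M == Om i then face_minors (c i) k (g0^T *m g) else 0.
Proof.
move=> hl; have [h1 h2] := exp_scale_lim (functional_cvg hl)
  (gram_minors_cvg (c := c i) (g0 := g0) (g := g) dom_k).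
case: eqP => [|/eqP ne]; first exact: h2.
by apply: h1; rewrite lt_neqAle eq_sym ne weight_le_scale.
Qed.

Lemma exists_top_weight : w != 0 -> exists i, M = Om i.
Proof.
move=> w0; apply: contrapT => h; move/eqP: w0; apply.
apply/mxcolP => i; rewrite submxcol0; have [[gs hgs] _] := theta_c i.
apply/matrixP => a b; rewrite ord1 [RHS]mxE.
have := functional_limit (hgs a); rewrite -rowE mxE => ->.
by case: eqP => // e'; case: h; exists i.
Qed.

End OneCurve.
End LimitMinors.

(** * Consequences of equal limits in all compactifications *)

Section EqualLimits.
Variables (R : realType) (n : nat) (X1 X2 g1 g2 : R -> 'M[R]_n) (k1 k2 : 'I_n -> int).
Hypothesis diag1 : diagonalized_by X1 g1 k1.
Hypothesis diag2 : diagonalized_by X2 g2 k2.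
Hypothesis same : forall (p : nat) (theta : 'I_p -> spherical_irrep R n), (0 < p)%N ->
  forall A1 A2, proj_limit theta X1 A1 -> proj_limit theta X2 A2 -> A1 = A2.

Let K1 i : R := (k1 i)%:~R.
Let K2 i : R := (k2 i)%:~R.

Lemma limit_vector X (g : R -> 'M[R]_n) k p (theta : 'I_p -> spherical_irrep R n) :
  (0 < p)%N -> diagonalized_by X g k ->
  exists M w, [/\ w != 0, proj_limit theta X <[w]>%VS &
    mlim (pinfty_nbhs R) (fun tau => expR (- (tau * M)) *:
      (sum_rep theta (g 0%R *m exp_diag (fun j => tau * (k j)%:~R)) *m sum_vec theta)) w].
Proof.
move=> p0 dX; have [_ _ u0 _] := dX.
have [M [v [v0 L C]]] := diagonalized_limit (@sum_is_rep _ _ _ theta)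
  (@sum_regular _ _ _ theta) (sum_vec_neq0 theta p0) (@sum_vec_inv _ _ _ theta) dX.
have srep := sum_is_rep theta.
exists M, (sum_rep theta (g 0%R) *m v); split=> //.
  by apply: unitmx_mulv_neq0 => //; exact: (rep_unit srep).
have h : mlim (pinfty_nbhs R) (fun tau => sum_rep theta (g 0%R) *m (expR (- (tau * M)) *:
    (sum_rep theta (exp_diag (fun j => tau * (k j)%:~R)) *m sum_vec theta))) (sum_rep theta (g 0%R) *m v).
  by apply: mlimM => //; exact: mlim_cst.
apply: mlim_near h; apply: nearW => tau.
by rewrite -scalemxAr mulmxA srep.2 // unit_exp_diag.
Qed.

(** Equal lines mean w1 = eta w2, and every evaluation functional turns this into an identity of
    limiting minors. At g1^-T and g2^-T the corresponding side is nonzero, so the same summands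
    dominate for both curves. *)
Lemma same_limit_minors p (theta : 'I_p -> spherical_irrep R n) c : (0 < p)%N ->
  (forall i, represents (theta i) (c i)) ->
  exists M1 M2 eta : R, [/\ eta != 0,
    (forall i, 2%:R * total_weight (c i) K1 <= M1) /\ (forall i, 2%:R * total_weight (c i) K2 <= M2),
    exists i, M1 = 2%:R * total_weight (c i) K1,
    forall i, (M1 == 2%:R * total_weight (c i) K1) = (M2 == 2%:R * total_weight (c i) K2)
  & forall i, M1 = 2%:R * total_weight (c i) K1 -> forall g, g \in unitmx ->
     face_minors (c i) K1 ((g1 0%R)^T *m g) = eta * face_minors (c i) K2 ((g2 0%R)^T *m g)].
Proof.
move=> p0 tc; have [dom1 _ u1 _] := diag1; have [dom2 _ u2 _] := diag2.
have dK1 (i l : 'I_n) : (i <= l)%N -> K1 l <= K1 i by move=> il; rewrite ler_int dom1.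
have dK2 (i l : 'I_n) : (i <= l)%N -> K2 l <= K2 i by move=> il; rewrite ler_int dom2.
have [M1 [w1 [w10 L1 C1]]] := limit_vector theta p0 diag1.
have [M2 [w2 [w20 L2 C2]]] := limit_vector theta p0 diag2.
have [eta eta0 we] := vline_eqP w10 (same p0 L1 L2).
have E i g : g \in unitmx ->
    (if M1 == 2%:R * total_weight (c i) K1 then face_minors (c i) K1 ((g1 0%R)^T *m g) else 0) =
    eta * (if M2 == 2%:R * total_weight (c i) K2 then face_minors (c i) K2 ((g2 0%R)^T *m g) else 0).
  move=> ug; have [_ /(_ g ug) [l hl]] := tc i.
  rewrite -(functional_limit tc u1 dK1 C1 hl) -(functional_limit tc u2 dK2 C2 hl) we.
  have -> : submxcol (eta *: w2) i = eta *: submxcol w2 i by apply/matrixP => a b; rewrite !mxE.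
  by rewrite -scalemxAr mxE.
have ui (g : 'M[R]_n) : g \in unitmx -> invmx g^T \in unitmx by rewrite unitmx_inv unitmx_tr.
have e i : (M1 == 2%:R * total_weight (c i) K1) = (M2 == 2%:R * total_weight (c i) K2).
  case: (boolP (M2 == _)) => e2; [case: eqP => // e1|case: eqP => // e1].
    have := E i _ (ui _ u2); rewrite (introF eqP e1) e2 mulmxV ?unitmx_tr // => /eqP.
    by rewrite eq_sym mulf_eq0 (negPf eta0) (negPf (face_minors1_neq0 _ _)).
  have := E i _ (ui _ u1); rewrite (introT eqP e1) (negPf e2) mulr0 mulmxV ?unitmx_tr // => /eqP.
  by rewrite (negPf (face_minors1_neq0 _ _)).
exists M1, M2, eta; split=> //.
- split=> i; first exact: (weight_le_scale tc u1 dK1 C1).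
  exact: (weight_le_scale tc u2 dK2 C2).
- exact: (exists_top_weight tc u1 dK1 C1 w10).
- move=> i e1 g ug; have := E i g ug.
  by rewrite -e (introT eqP e1).
Qed.

(** Dominance of [c] in the sum of two terms is the inequality of growth rates, and simultaneous
    dominance makes both terms share the scalar eta. *)
Lemma same_limit_pair c c' :
  (total_weight c' K1 <= total_weight c K1 <-> total_weight c' K2 <= total_weight c K2) /\
  (total_weight c K1 = total_weight c' K1 -> exists2 eta : R, eta != 0 & forall g, g \in unitmx ->
     face_minors c K1 ((g1 0%R)^T *m g) = eta * face_minors c K2 ((g2 0%R)^T *m g) /\
     face_minors c' K1 ((g1 0%R)^T *m g) = eta * face_minors c' K2 ((g2 0%R)^T *m g)).
Proof.
pose cc (i : 'I_2) := if i == ord0 then c else c'.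
have /choice [theta tc] : forall i : 'I_2, exists sp, represents (R := R) sp (cc i).
  by move=> i; exact: exists_represents.
have [M1 [M2 [eta [eta0 [le1 le2] [i0 ei0] e ee]]]] := same_limit_minors (ltn0Sn 1) tc.
have top : (M1 = 2%:R * total_weight c K1 \/ M1 = 2%:R * total_weight c' K1) /\
    (M2 = 2%:R * total_weight c K2 \/ M2 = 2%:R * total_weight c' K2).
  have := e i0; rewrite {1}ei0 eqxx => /esym /eqP; move: ei0; rewrite /cc.
  by case: (i0 == ord0) => ? ?; split; [left|left|right|right].
have := (le1 0, le1 1, le2 0, le2 1); rewrite /cc /= => -[[[l1 l1'] l2] l2'].
have := (e 0, e 1); rewrite /cc /= => -[e0 e1].
have := (ee 0, ee 1); rewrite /cc /= => -[ee0 ee1].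
have two (a b : R) : (2%:R * a <= 2%:R * b) = (a <= b) by rewrite ler_pM2l ?ltr0n.
split.
  split=> h.
    have /eqP : M2 == 2%:R * total_weight c K2.
      rewrite -e0; apply/eqP; case: top => -[//|E] _; apply: le_anti; rewrite l1 andbT E two //.
    by move=> E; rewrite -two -E.
  have /eqP : M1 == 2%:R * total_weight c K1.
    rewrite e0; apply/eqP; case: top => _ [//|E]; apply: le_anti; rewrite l2 andbT E two //.
  by move=> E; rewrite -two -E.
move=> h; exists eta => // g ug; split; [apply: ee0|apply: ee1] => //.
  by case: top => -[//|->] _; rewrite h.
by case: top => -[->|//] _; rewrite h.
Qed.

(** Take c to be the indicator of j. The scalar is positive because at g1^-T the left side is
    positive, while the minor on the right is a sum of squares up to a positive factor. *)
Lemma minor_ratio j : exists2 lam : R, 0 < lam & forall g, g \in unitmx ->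
  face_minor K1 j ((g1 0%R)^T *m g) ((g1 0%R)^T *m g) =
  lam * face_minor K2 j ((g2 0%R)^T *m g) ((g2 0%R)^T *m g).
Proof.
have [_ _ u1 _] := diag1.
have [_ /(_ erefl) [eta eta0 h]] := same_limit_pair (fun l => (l == j)%N) (fun l => (l == j)%N).
have E k x : face_minors (fun l => (l == j)%N) k x = face_minor k j x x.
  rewrite /face_minors (bigD1 j) //= eqxx expr1 big1 ?mulr1 // => l lj.
  by rewrite (negPf lj) expr0.
have h' g : g \in unitmx -> face_minor K1 j ((g1 0%R)^T *m g) ((g1 0%R)^T *m g) =
    eta * face_minor K2 j ((g2 0%R)^T *m g) ((g2 0%R)^T *m g).
  by move=> ug; have [] := h g ug; rewrite !E.
exists eta => //; have ui : invmx (g1 0%R)^T \in unitmx by rewrite unitmx_inv unitmx_tr.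
have := h' _ ui; rewrite mulmxV ?unitmx_tr //.
have pos : 0 < face_minor K1 j 1%:M 1%:M.
  by apply: face_minor_gt0; rewrite lead_minor1 oner_eq0.
have nn x : 0 <= face_minor K2 j x x.
  rewrite mulr_ge0 ?invr_ge0 ?ler0n // sumr_ge0 // => f _; rewrite -expr2 sqr_ge0 //.
move=> e; rewrite lt_def eta0 /= leNgt; apply/negP => neg.
by move: pos; rewrite e ltNge mulr_le0_ge0 // ltW.
Qed.

End EqualLimits.

Section Proportionality.
Variable R : realType.

(** The test vectors are integral, and integrality of a supplies enough of them: A_j e_l - A_l e_j
    is orthogonal to a, which forces b and L to be proportional to a. The vectors e_j and -e_j fix
    the sign of r. *)
Lemma int_proportional n (A : 'I_n -> int) (a b L : 'I_n -> R) :
  (forall j, a j = (A j)%:~R) ->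
  (forall x : 'I_n -> int, \sum_j (x j)%:~R * a j <= 0 <-> \sum_j (x j)%:~R * b j <= 0) ->
  (forall x : 'I_n -> int, \sum_j (x j)%:~R * a j = 0 -> \sum_j (x j)%:~R * L j = 0) ->
  exists r beta, 0 < r /\ forall j, b j = r * a j /\ L j = beta * a j.
Proof.
move=> aA ab aL.
have sumN (x : 'I_n -> int) (f : 'I_n -> R) :
    \sum_j (- x j)%:~R * f j = - \sum_j (x j)%:~R * f j.
  by rewrite -sumrN; apply: eq_bigr => j _; rewrite rmorphN mulNr.
have ab0 x : \sum_j (x j)%:~R * a j = 0 -> \sum_j (x j)%:~R * b j = 0.
  move=> e; apply: le_anti; rewrite (ab x).1 ?e //= -oppr_le0 -sumN.
  by apply: (ab (fun j => - x j)).1; rewrite sumN e oppr0.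
pose d (j : 'I_n) (m : int) (i : 'I_n) : int := if i == j then m else 0.
have sum_d j m (f : 'I_n -> R) : \sum_i (d j m i)%:~R * f i = m%:~R * f j.
  rewrite (bigD1 j) //= /d eqxx big1 ?addr0 // => i ij.
  by rewrite (negPf ij) mul0r.
have [[j aj]|h] := pselect (exists j, a j != 0); last first.
  have a0 j : a j = 0 by apply/eqP/negP => /negP aj; apply: h; exists j.
  (* For a = 0 the vectors e_j already force b = L = 0, and any positive r will do. *)
  exists 1, 0; split=> // j; rewrite a0 !mulr0.
  have e : \sum_i (d j 1 i)%:~R * a i = 0 by rewrite sum_d a0 mulr0.
  by have := (ab0 _ e, aL _ e); rewrite !sum_d !mul1r => -[].
have cross l (f : 'I_n -> R) : \sum_i (d l (A j) i - d j (A l) i)%:~R * f i = a j * f l - a l * f j.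
  rewrite !aA -!sum_d -sumrB; apply: eq_bigr => i _.
  by rewrite rmorphB mulrBl.
have bE l : b l = b j / a j * a l.
  have := ab0 _ (etrans (cross l a) (_ : _ = 0)); rewrite cross => /(_ _)/eqP.
  by rewrite mulrC subrr subr_eq0 => /(_ erefl)/eqP e; rewrite mulrAC -[b j * _]mulrC -e mulrC mulKf.
have LE l : L l = L j / a j * a l.
  have := aL _ (etrans (cross l a) (_ : _ = 0)); rewrite cross => /(_ _)/eqP.
  by rewrite mulrC subrr subr_eq0 => /(_ erefl)/eqP e; rewrite mulrAC -[L j * _]mulrC -e mulrC mulKf.
exists (b j / a j), (L j / a j); split=> //.
have := (ab (d j 1), ab (d j (-1))); rewrite !sum_d !mul1r rmorphN1 !mulN1r !oppr_le0 => -[p m].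
case: (ltrgtP (a j) 0) aj => // aj _.
  by rewrite nmulr_lgt0 ?invr_lt0 // ltNge; apply/negP => /m; rewrite leNgt aj.
by rewrite divr_gt0 // ltNge; apply/negP => /p; rewrite leNgt aj.
Qed.

Lemma top_weight_eq0 n (k : 'I_n -> R) : (forall j, top_weight k j = 0) -> forall i, k i = 0.
Proof.
move=> h i; have [m] := ubnP (i : nat); elim: m i => // m IH i im.
have := h i; rewrite /top_weight (bigD1 i) //= big1 ?addr0 // => l /andP[li ne].
by apply: IH; rewrite -ltnS (leq_trans _ im) // ltnS ltn_neqAle li andbT.
Qed.

Lemma face_minor_scale n (k : 'I_n -> R) r j x y : r != 0 ->
  face_minor (fun i => r * k i) j x y = face_minor k j x y.
Proof.
move=> r0; congr (_ * _); apply: eq_bigl => f; congr (_ && _).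
by rewrite /top_weight -!mulr_sumr (inj_eq (mulfI r0)).
Qed.

Variables (n : nat) (X1 X2 g1 g2 : R -> 'M[R]_n) (k1 k2 : 'I_n -> int).
Hypothesis diag1 : diagonalized_by X1 g1 k1.
Hypothesis diag2 : diagonalized_by X2 g2 k2.
Hypothesis same : forall (p : nat) (theta : 'I_p -> spherical_irrep R n), (0 < p)%N ->
  forall A1 A2, proj_limit theta X1 A1 -> proj_limit theta X2 A2 -> A1 = A2.

Let K1 i : R := (k1 i)%:~R.
Let K2 i : R := (k2 i)%:~R.

Lemma same_limit_proportional : exists r beta, [/\ 0 < r, forall i, K2 i = r * K1 i &
  forall j g, g \in unitmx ->
    face_minor K1 j ((g1 0%R)^T *m g) ((g1 0%R)^T *m g) = expR (beta * top_weight K1 j) *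
    face_minor K1 j ((g2 0%R)^T *m g) ((g2 0%R)^T *m g)].
Proof.
have [_ _ u2 _] := diag2.
have /choice [L hL] : forall j, exists L, forall g, g \in unitmx ->
    face_minor K1 j ((g1 0%R)^T *m g) ((g1 0%R)^T *m g) =
    expR L * face_minor K2 j ((g2 0%R)^T *m g) ((g2 0%R)^T *m g).
  move=> j; have [lam lam0 h] := minor_ratio diag1 diag2 same j.
  by exists (ln lam); rewrite lnK.
(* Exponents of minors are natural numbers, so an integral combination is split into a difference of
   two. *)
pose pos (x : 'I_n -> int) j : nat := if 0 <= x j then `|x j|%N else 0%N.
pose neg (x : 'I_n -> int) j : nat := if 0 <= x j then 0%N else `|x j|%N.
have posneg x (f : 'I_n -> R) : \sum_j (x j)%:~R * f j =
    \sum_j (pos x j)%:R * f j - \sum_j (neg x j)%:R * f j.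
  rewrite -sumrB; apply: eq_bigr => j _; rewrite -mulrBl; congr (_ * _).
  rewrite /pos /neg; case: (leP 0 (x j)) => xj; first by rewrite subr0 natr_absz ger0_norm.
  by rewrite sub0r natr_absz ltr0_norm // rmorphN opprK.
have [r [beta [r0 h]]] : exists r beta, 0 < r /\ forall j,
    top_weight K2 j = r * top_weight K1 j /\ L j = beta * top_weight K1 j.
  apply: (int_proportional (A := fun j => \sum_(i < n | (i <= j)%N) k1 i)).
  - by move=> j; rewrite rmorph_sum.
  - move=> x; have [h _] := same_limit_pair diag1 diag2 same (neg x) (pos x).
    by rewrite !posneg !subr_le0.
  (* Equal growth gives both parts one common eta. At g2^-T the minors of the second curve are
     nonzero and cancel, so both sums of L have exponential eta. *)
  - move=> x; rewrite !posneg => /eqP; rewrite subr_eq0 => /eqP e.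
    have [_ /(_ e) [eta eta0 h]] := same_limit_pair diag1 diag2 same (pos x) (neg x).
    have E c g : g \in unitmx -> face_minors c K1 ((g1 0%R)^T *m g) =
        expR (\sum_j (c j)%:R * L j) * face_minors c K2 ((g2 0%R)^T *m g).
      move=> ug; rewrite expR_sum -big_split; apply: eq_bigr => j _ /=.
      by rewrite hL // exprMn expRM_natl.
    have ui : invmx (g2 0%R)^T \in unitmx by rewrite unitmx_inv unitmx_tr.
    have [] := h _ ui; rewrite !E // mulmxV ?unitmx_tr //.
    move=> /(mulIf (face_minors1_neq0 _ _)) e1 /(mulIf (face_minors1_neq0 _ _)) e2.
    by apply/eqP; rewrite subr_eq0; apply/eqP/expR_inj; rewrite e1 e2.
have Kr i : K2 i = r * K1 i.
  apply/eqP; rewrite -subr_eq0; apply/eqP; apply: (top_weight_eq0 (k := fun i => K2 i - r * K1 i)).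
  move=> j; rewrite /top_weight sumrB -mulr_sumr.
  by have [e _] := h j; apply/eqP; rewrite subr_eq0; apply/eqP.
exists r, beta; split=> // j g ug; rewrite hL //; have [_ ->] := h j.
rewrite (_ : K2 = fun i => r * K1 i) ?face_minor_scale ?gt_eqF //.
by apply/funext => i; rewrite Kr.
Qed.

End Proportionality.

(** * Block triangularity of the relative position *)

Section BlockStructure.
Variables (R : realType) (n : nat).
Implicit Types (k : 'I_n -> R) (j : 'I_n) (y g Q : 'M[R]_n).

Lemma det_replace_col (K : comNzRingType) m (i0 : 'I_m) (w : 'I_m -> K) :
  \det (\matrix_(p, q) if q == i0 then w p else (p == q)%:R) = w i0.
Proof.
set T := \matrix_(p, q) _; rewrite (expand_det_col T i0).
have adj1 : \adj (1%:M : 'M[K]_m) = 1%:M by rewrite -[LHS]mul1mx mul_mx_adj det1.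
have cofE p : cofactor T p i0 = (i0 == p)%:R.
  have -> : cofactor T p i0 = \adj (1%:M : 'M[K]_m) i0 p; last by rewrite adj1 mxE.
  rewrite mxE; congr (_ * \det _); apply/matrixP => a b; rewrite !mxE.
  by rewrite eq_sym (negPf (neq_lift _ _)).
rewrite (bigD1 i0) //= cofE eqxx mulr1 mxE eqxx big1 ?addr0 // => p pi.
by rewrite cofE eq_sym (negPf pi) mulr0.
Qed.

(* Test against g = y^-1 T, where T is the identity with column i replaced by
   column a of y: the minor of g vanishes, and that of y g = T is y i a. *)
Lemma block_triangular k y (beta : R) :
  (forall i l : 'I_n, (i <= l)%N -> k l <= k i) -> y \in unitmx ->
  (forall j g, g \in unitmx -> face_minor k j g g =
    expR (beta * top_weight k j) * face_minor k j (y *m g) (y *m g)) ->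
  forall i a, k a < k i -> y i a = 0.
Proof.
move=> dom uy F i a ai; apply/eqP; apply: contrapT => /negP yia.
(* The last index whose weight exceeds k_a: the weights drop strictly after it, so the face minor
   factors, and i <= j < a. *)
have [j ja jmax] : exists2 j, k a < k j & forall l, k a < k l -> (l <= j)%N.
  by case: (@arg_maxnP _ i (fun l => k a < k l) (fun l : 'I_n => (l : nat)) ai) => j ja jmax; exists j.
have strict (l : 'I_n) : (j < l)%N -> k l < k j.
  by move=> jl; apply: le_lt_trans ja; rewrite leNgt; apply/negP => /jmax; rewrite leqNgt jl.
pose T := \matrix_(p, q) if q == i then y p a else (p == q)%:R.
have uT : T \in unitmx by rewrite unitmxE det_replace_col unitfE.
have ij : (i < j.+1)%N by rewrite ltnS jmax.
have Ta : (y *m (invmx y *m T)) = T by rewrite mulKVmx.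
have := F j (invmx y *m T); rewrite unitmx_mul unitmx_inv uy uT => /(_ isT).
rewrite !face_minor_strict // Ta.
have -> : lead_minor j (invmx y *m T) = 0.
  have c0 p : (invmx y *m T) p i = (p == a)%:R.
    have -> : (p == a)%:R = (1%:M : 'M[R]_n) p a by rewrite mxE.
    rewrite -(mulVmx uy) [LHS]mxE [RHS]mxE; apply: eq_bigr => l _.
    by rewrite mxE eqxx.
  rewrite /lead_minor (expand_det_col _ (Ordinal ij)) big1 // => p _; rewrite mxE.
  rewrite (_ : trunc j (Ordinal ij) = i); last exact: val_inj.
  rewrite c0 (_ : (_ == a) = false) ?mul0r //; apply/negP => /eqP pa.
  have : k j <= k a by apply: dom; rewrite -pa /= -ltnS.
  by rewrite leNgt ja.
have -> : lead_minor j T = y i a.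
  rewrite /lead_minor; transitivity (\det (\matrix_(p, q)
      if q == Ordinal ij then y (trunc j p) a else (p == q)%:R)).
    by congr (\det _); apply/matrixP => p q; rewrite !mxE.
  by rewrite det_replace_col; congr (y _ a); apply: val_inj.
by rewrite mul0r => /esym/eqP; rewrite !mulf_eq0 (negPf yia) gt_eqF ?expR_gt0.
Qed.

Definition block_part k y : 'M[R]_n := \matrix_(i, l) if k i == k l then y i l else 0.
Definition block_diagonal k g : Prop := forall i l, k i != k l -> g i l = 0.

Definition flow k y (t : R) : 'M[R]_n :=
  exp_diag (fun i => t * k i) *m y *m exp_diag (fun i => - (t * k i)).

Lemma flowE k y t i l : flow k y t i l = expR (t * (k i - k l)) * y i l.
Proof.
rewrite /flow mul_mx_diag mul_diag_mx !mxE mulrAC -expRD; congr (expR _ * _); ring.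
Qed.

Lemma flow_cvg k y : (forall i l, k l < k i -> y i l = 0) ->
  mlim (pinfty_nbhs R) (flow k y) (block_part k y).
Proof.
move=> tri i l; rewrite mxE; have [e|ne] := eqVneq (k i) (k l).
  apply: (near_cvg (f := fun=> y i l)); first exact: cvg_cst.
  by apply: nearW => t; rewrite flowE e subrr mulr0 expR0 mul1r.
have [lt|le] := ltP (k l) (k i).
  apply: (near_cvg (f := fun=> 0)); first exact: cvg_cst.
  by apply: nearW => t; rewrite flowE tri // mulr0.
have pos : 0 < k l - k i by rewrite subr_gt0 lt_neqAle ne.
rewrite -[X in _ --> X](mul0r (y i l)).
apply: (near_cvg (f := fun t => expR (- ((k l - k i) * t)) * y i l)).
  by apply: cvgM; [apply: expR_decay => //; exact: cvg_id|exact: cvg_cst].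
by apply: nearW => t; rewrite flowE; congr (expR _ * _); ring.
Qed.

Lemma block_diagonal_exp k g t : block_diagonal k g ->
  exp_diag (fun i => t * k i) *m g = g *m exp_diag (fun i => t * k i).
Proof.
move=> bg; rewrite mul_diag_mx mul_mx_diag; apply/matrixP => i l; rewrite !mxE.
have [->|ne] := eqVneq (k i) (k l); first by rewrite mulrC.
by rewrite bg // mulr0 mul0r.
Qed.

Lemma lead_minor_exp_diag k j t Z :
  lead_minor j (exp_diag (fun i => t * k i) *m Z *m exp_diag (fun i => t * k i)) =
  expR (2%:R * t * top_weight k j) * lead_minor j Z.
Proof.
pose e : 'M[R]_(j.+1) := diag_mx (\row_a expR (t * k (trunc j a))).
have dete : \det e = expR (t * top_weight k j).
  rewrite det_diag -trunc_weight mulr_sumr expR_sum; apply: eq_bigr => a _; rewrite mxE //.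
rewrite /lead_minor (_ : mxsub _ _ _ = e *m mxsub (trunc j) (trunc j) Z *m e).
  by rewrite !det_mulmx dete mulrC mulrA -expRD; congr (expR _ * _); ring.
by rewrite /e /exp_diag !mul_mx_diag !mul_diag_mx; apply/matrixP => a b; rewrite !mxE.
Qed.

Lemma mlim_lead_minor (T : Type) (F : set_system T) {FF : Filter F} (f : T -> 'M[R]_n) A j :
  mlim F f A -> lead_minor j (f t) @[t --> F] --> lead_minor j A.
Proof.
move=> fA; apply: (mlim_det (f := fun t => mxsub (trunc j) (trunc j) (f t))) => a b.
by rewrite mxE; under eq_cvg do rewrite mxE; exact: fA.
Qed.

(** Both sides are limits of one function of t: the block diagonal g commutes with the torus, so the
    torus factors around the Gram matrix of y g can be moved onto y, where they form the flow that
    tends to the block part. *)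
Lemma face_minor_block k j y g : (forall i l : 'I_n, (i <= l)%N -> k l <= k i) ->
  (forall i l, k l < k i -> y i l = 0) -> block_diagonal k g ->
  face_minor k j (y *m g) (y *m g) =
  lead_minor j ((block_part k y *m g)^T *m (block_part k y *m g)).
Proof.
move=> dom tri bg.
have l1 : expR (- (2%:R * t * top_weight k j)) *
    lead_minor j ((y *m g)^T *m exp_diag (fun i => 2%:R * t * k i) *m (y *m g)) @[t --> +oo] -->
    face_minor k j (y *m g) (y *m g).
  apply: (lead_minor_cvg (x := fun=> y *m g) (y := fun=> y *m g)) => //; [exact: mlim_cst|exact: mlim_cst|].
  by apply: (gt0_cvgMry (ltr0Sn R 1)); exact: cvg_id.
apply: (cvg_unique (@Rhausdorff R) l1).
have fg : mlim (pinfty_nbhs R) (fun t => (flow k y t *m g)^T *m (flow k y t *m g))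
    ((block_part k y *m g)^T *m (block_part k y *m g)).
  have fg : mlim (pinfty_nbhs R) (fun t => flow k y t *m g) (block_part k y *m g).
    by apply: mlimM; [exact: flow_cvg|exact: mlim_cst].
  by apply: mlimM => //; exact: mlim_tr.
have l2 : lead_minor j ((flow k y t *m g)^T *m (flow k y t *m g)) @[t --> +oo] -->
    lead_minor j ((block_part k y *m g)^T *m (block_part k y *m g)) by exact: mlim_lead_minor.
apply: near_cvg l2 _; apply: nearW => t.
have -> : expR (- (2%:R * t * top_weight k j)) = expR (2%:R * (- t) * top_weight k j).
  by congr expR; ring.
rewrite -lead_minor_exp_diag; congr (lead_minor j _).
have nt : exp_diag (fun i => - t * k i) = exp_diag (fun i => - (t * k i)).
  by congr exp_diag; apply/funext => i; rewrite mulNr.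
have -> : flow k y t *m g = exp_diag (fun i => t * k i) *m (y *m g) *m exp_diag (fun i => - (t * k i)).
  by rewrite /flow -nt -!mulmxA -(block_diagonal_exp _ bg).
rewrite nt !trmx_mul ![(exp_diag _)^T]tr_diag_mx -!mulmxA; congr (_ *m (_ *m (_ *m _))).
rewrite !mulmxA; congr (_ *m _ *m _ *m _); rewrite /exp_diag mulmx_diag; congr diag_mx.
by apply/rowP => i; rewrite !mxE -expRD; congr expR; ring.
Qed.

End BlockStructure.

Section Identification.
Variables (R : realType) (n : nat).
Implicit Types (k : 'I_n -> R) (j : 'I_n) (y g Q P : 'M[R]_n).

Lemma lead_minor_last (K : fieldType) m (a : 'I_m) (B : 'M[K]_m) :
  (forall i l : 'I_m, (i < a)%N -> (l <= a)%N -> B i l = (i == l)%:R) -> lead_minor a B = B a a.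
Proof.
move=> h; have ta : trunc a ord_max = a by exact: val_inj.
rewrite /lead_minor det_trig.
  rewrite big_ord_recr /= mxE ta big1 ?mul1r // => i _; rewrite mxE h /= ?eqxx //.
  exact: ltnW.
apply/is_trig_mxP => i l il; rewrite mxE h /=.
- by rewrite -val_eqE /= ltn_eqF.
- by rewrite (leq_trans il) // -ltnS.
- by rewrite -ltnS.
Qed.

(** Adding e times column b to column a makes the minor a quadratic polynomial in e, from which the
    entry P_ab can be read. *)
Lemma lead_minor_shear P (a b : 'I_n) (e : R) : P^T = P -> (a < b)%N ->
  (forall i l : 'I_n, (i < a)%N -> P i l = (i == l)%:R) ->
  let g := 1%:M + e *: delta_mx b a in
  lead_minor a (g^T *m P *m g) = P a a + 2%:R * e * P a b + e ^+ 2 * P b b.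
Proof.
move=> sP ab hP g.
have PE i l : P i l = P l i by rewrite -{1}sP mxE.
have Pg (M : 'M[R]_n) i l : (M *m g) i l = M i l + e * (M i b * (l == a)%:R).
  rewrite /g mulmxDr mulmx1 -scalemxAr !mxE; congr (_ + _ * _).
  rewrite (bigD1 b) //= big1 ?addr0 => [|q qb]; first by rewrite mxE eqxx.
  by rewrite mxE (negPf qb) mulr0.
have gP i l : (g^T *m P) i l = P i l + e * (P b l * (i == a)%:R).
  have -> : g^T *m P = (P *m g)^T by rewrite trmx_mul sP.
  by rewrite mxE Pg PE [P l b]PE.
rewrite lead_minor_last => [|i l ia la].
  by rewrite Pg !gP eqxx [P b a]PE /=; ring.
have [ia' ib] : (i == a) = false /\ (i == b) = false.
  by split; apply/negP => /eqP E; move: ia; rewrite E ?ltnn // ltnNge ltnW.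
by rewrite Pg !gP ia' !mulr0 !addr0 !hP // ib mul0r mulr0 addr0.
Qed.

Lemma unit_shear (a b : 'I_n) (e : R) : (a < b)%N -> 1%:M + e *: delta_mx b a \in unitmx.
Proof.
move=> ab; rewrite unitmxE det_trig.
  rewrite big1 ?unitr1 // => i _; rewrite !mxE eqxx.
  case: (i =P b) => [->|_]; last by rewrite mulr0 addr0.
  by rewrite -val_eqE /= gtn_eqF // mulr0 addr0.
apply/is_trig_mxP => i l il; rewrite !mxE -val_eqE /= ltn_eqF // add0r.
case: (i =P b) => [ib|_]; last by rewrite mulr0.
by rewrite -val_eqE /= gtn_eqF ?mulr0 // (ltn_trans ab) // -ib.
Qed.

(** Induction on rows: once the earlier rows are those of 1, the minor at a is the entry Q_aa, and
    the shears inside a block with e = 1 and e = -1 isolate Q_ab. *)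
Lemma gram_block_identity k Q : Q^T = Q -> block_diagonal k Q ->
  (forall g, g \in unitmx -> block_diagonal k g -> forall j,
     lead_minor j (g^T *m Q *m g) = lead_minor j (g^T *m g)) -> Q = 1%:M.
Proof.
move=> sQ bQ h; apply/matrixP => a b; rewrite [RHS]mxE.
have [m] := ubnP (a : nat); elim: m a b => // m IH a b am.
have below (i l : 'I_n) : (i < a)%N -> Q i l = (i == l)%:R.
  by move=> ia; apply: IH; rewrite -ltnS (leq_trans _ am).
have below1 (i l : 'I_n) : (i < a)%N -> (1%:M : 'M[R]_n) i l = (i == l)%:R by rewrite mxE.
case: (ltngtP a b) => [ab|ba|/val_inj <-].
- have ne : (a == b) = false by rewrite -val_eqE /= ltn_eqF.
  rewrite ne; have [e|kn] := eqVneq (k a) (k b); last exact: bQ.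
  have test e' : Q a a + 2%:R * e' * Q a b + e' ^+ 2 * Q b b = 1 + e' ^+ 2.
    rewrite -lead_minor_shear // h ?unit_shear //.
      rewrite -[X in X *m _]mulmx1 lead_minor_shear ?trmx1 // !mxE !eqxx ne /=; ring.
    move=> i l il; rewrite !mxE; case: eqP => [iel|_]; first by rewrite iel eqxx in il.
    case: eqP => [ib|_]; last by rewrite mulr0 add0r.
    case: eqP => [la|_]; last by rewrite mulr0 add0r.
    by rewrite ib la e eqxx in il.
  by have := test 1; have := test (-1); rewrite sqrrN expr1n /=; lra.
- have -> : Q a b = Q b a by rewrite -{1}sQ mxE.
  by rewrite below // eq_sym.
- rewrite eqxx -(lead_minor_last (a := a) (B := Q)) => [|i l ia _]; last exact: below.
  have := h 1%:M (unitmx1 R n) _ a; rewrite !trmx1 !mulmx1 mul1mx => ->.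
    by rewrite lead_minor1.
  by move=> i l il; rewrite mxE; case: eqP => // iel; rewrite iel eqxx in il.
Qed.

(** The torus factor of z absorbs the character: on both sides of a Gram matrix it multiplies the
    leading minor at j by e^(beta top_weight). *)
Lemma block_gram k y beta : (forall i l : 'I_n, (i <= l)%N -> k l <= k i) -> y \in unitmx ->
  (forall j g, g \in unitmx -> face_minor k j g g =
    expR (beta * top_weight k j) * face_minor k j (y *m g) (y *m g)) ->
  let z := exp_diag (fun i => beta / 2%:R * k i) *m block_part k y in
  z^T *m z = 1%:M.
Proof.
move=> dom uy F z; have tri := block_triangular dom uy F.
pose b := block_part k y; pose e := exp_diag (fun i => beta / 2%:R * k i).
have bb : block_diagonal k b by move=> i l il; rewrite mxE (negPf il).
have zE : z = b *m e by rewrite /z block_diagonal_exp.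
have eT : e^T = e by rewrite tr_diag_mx.
apply: (gram_block_identity (k := k)).
- by rewrite trmx_mul trmxK.
- move=> i l il; rewrite zE mxE big1 // => q _; rewrite mxE /e /exp_diag !mul_mx_diag !mxE.
  have [qi|_] := eqVneq (k q) (k i); last by rewrite !mul0r.
  by rewrite qi (negPf il) mul0r mulr0.
move=> g ug bg j; have := F j g ug; rewrite face_minor_block // -/b => Fg.
have F1 : face_minor k j g g = lead_minor j (g^T *m g).
  have -> : face_minor k j g g = face_minor k j (1%:M *m g) (1%:M *m g) by rewrite mul1mx.
  have one : block_part k 1%:M = 1%:M.
    apply/matrixP => i l; rewrite !mxE; case: (eqVneq i l) => [->|_]; first by rewrite eqxx.
    by rewrite if_same.
  rewrite face_minor_block // ?one ?mul1mx // => i l il; rewrite mxE.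
  by case: eqP => // iel; rewrite iel ltxx in il.
have zg : z *m g = b *m g *m e by rewrite zE -!mulmxA /e block_diagonal_exp.
have -> : g^T *m (z^T *m z) *m g = (z *m g)^T *m (z *m g).
  rewrite [(z *m g)^T]trmx_mul -(mulmxA g^T z^T (z *m g)) -(mulmxA g^T (z^T *m z) g).
  by rewrite -(mulmxA z^T z g).
have -> : (z *m g)^T *m (z *m g) = e *m ((b *m g)^T *m (b *m g)) *m e.
  by rewrite zg [(b *m g *m e)^T]trmx_mul eT !mulmxA.
rewrite -F1 Fg.
by rewrite lead_minor_exp_diag; congr (expR _ * _); field.
Qed.

Lemma gram_cvg_near_le (T : Type) (F : set_system T) {FF : Filter F} (x y : T -> 'M[R]_n) :
  (forall t, x t \in unitmx) ->
  mlim F (fun t => (invmx (x t) *m y t) *m (invmx (x t) *m y t)^T) 1%:M ->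
  forall d, 0 < d -> \forall t \near F, near_le d (x t *m (x t)^T) (y t *m (y t)^T).
Proof.
move=> ux V1 d d0.
have [e [e0 e1 e2]] : exists e : R, [/\ 0 < e, e <= 1 - expR (- d) & e <= expR d - 1].
  exists (Num.min (1 - expR (- d)) (expR d - 1)).
  by rewrite lt_min !subr_gt0 -expR0 !ltr_expR oppr_lt0 d0 !ge_min !lexx orbT.
(* Dividing by n + 1 instead of n covers the case n = 0. *)
have n1 : 0 < n.+1%:R :> R by [].
have ent i l : \forall t \near F,
    `|((invmx (x t) *m y t) *m (invmx (x t) *m y t)^T - 1%:M) i l| <= e / n.+1%:R.
  have /cvgrPdist_le /(_ (e / n.+1%:R)) := @V1 i l; rewrite divr_gt0 // => /(_ isT).
  have E (A : 'M[R]_n) : (A - 1%:M) i l = A i l - (1%:M : 'M[R]_n) i l by rewrite !mxE.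
  by apply: filterS => t; rewrite E distrC.
have : \forall t \near F, forall il : 'I_n * 'I_n,
    `|((invmx (x t) *m y t) *m (invmx (x t) *m y t)^T - 1%:M) il.1 il.2| <= e / n.+1%:R.
  by apply: filter_forall => -[i l]; exact: ent.
apply: filterS => t ht v; pose V := invmx (x t) *m y t; pose w := (x t)^T *m v.
have xE : qf (x t *m (x t)^T) v = sqn w.
  by rewrite -[X in X *m _]mulmx1 qf_conj qf1.
have yE : qf (y t *m (y t)^T) v = qf (V *m V^T) w.
  by rewrite -qf_conj /V trmx_mul !mulmxA mulmxV // mul1mx -mulmxA -trmx_mul mulmxV // trmx1 mulmx1.
have : `|qf (V *m V^T - 1%:M) w| <= n%:R * (e / n.+1%:R) * sqn w.
  by apply: qf_le_entry => i l; exact: (ht (i, l)).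
have ne : n%:R * (e / n.+1%:R) <= e.
  by rewrite mulrCA -[leRHS]mulr1 ler_wpM2l ?(ltW e0) // ler_pdivrMr // mul1r ler_nat.
rewrite qfD qfN qf1 xE yE ler_norml => /andP[lo hi].
have s0 := sqn_ge0 w; have nes := ler_wpM2r s0 ne.
have := ler_wpM2r s0 e1; have := ler_wpM2r s0 e2.
rewrite !mulrBl !mul1r => h1 h2.
have lin (a b c f q s : R) : - f <= q - s -> q - s <= f -> f <= c -> c <= a - s ->
  c <= s - b -> b <= q <= a by move=> *; apply/andP; split; lra.
exact: lin lo hi nes h1 h2.
Qed.

End Identification.

(** * Equal limits in all compactifications force equal points of the sea urchin *)

Section PartC.
Variables (R : realType) (n : nat) (X1 X2 : R -> 'M[R]_n) (P1 P2 : sea_point R n).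
Hypothesis sea1 : sea_limit X1 P1.
Hypothesis sea2 : sea_limit X2 P2.
Hypothesis same : forall (p : nat) (theta : 'I_p -> spherical_irrep R n), (0 < p)%N ->
  forall A1 A2, proj_limit theta X1 A1 -> proj_limit theta X2 A2 -> A1 = A2.

Lemma proj_limits_sea_limit : P1 = P2.
Proof.
case: sea1 => _ [g1 [k1 [d1 H1]]]; case: sea2 => _ [g2 [k2 [d2 H2]]].
have [dom1 _ u1 _] := d1; have [dom2 _ u2 _] := d2.
pose K i : R := (k1 i)%:~R; pose a1 := g1 0%R; pose a2 := g2 0%R.
have domK (i l : 'I_n) : (i <= l)%N -> K l <= K i by move=> il; rewrite ler_int dom1.
have [r [beta [r0 Kr F]]] := same_limit_proportional d1 d2 same.
(* Testing at a1^-T g instead of g normalizes the first frame to the identity and leaves this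
   relative position. *)
pose y := (invmx a1 *m a2)^T.
have uy : y \in unitmx by rewrite unitmx_tr unitmx_mul unitmx_inv u1 u2.
have ui : invmx a1^T \in unitmx by rewrite unitmx_inv unitmx_tr.
have Fy j g : g \in unitmx -> face_minor K j g g =
    expR (beta * top_weight K j) * face_minor K j (y *m g) (y *m g).
  move=> ug; have ug' : invmx a1^T *m g \in unitmx by rewrite unitmx_mul ui.
  have := F j _ ug'; rewrite !mulmxA mulmxV ?unitmx_tr // mul1mx.
  by rewrite -trmx_inv -trmx_mul.
pose z := exp_diag (fun i => beta / 2%:R * K i) *m block_part K y.
have zz : z^T *m z = 1%:M := block_gram domK uy Fy.
pose x t := a1 *m exp_diag (fun i => t / 2%:R * K i).
(* The shift by beta turns the character e^(beta top_weight) into a change of time along the second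
   geodesic. *)
pose x' t := a2 *m exp_diag (fun i => (t + beta) / 2%:R * K i).
have ux t : x t \in unitmx by rewrite unitmx_mul u1 unit_exp_diag.
have xx' t : invmx (x t) *m x' t =
    (exp_diag (fun i => beta / 2%:R * K i) *m flow K y (t / 2%:R))^T.
  suff -> : x' t = x t *m (exp_diag (fun i => beta / 2%:R * K i) *m flow K y (t / 2%:R))^T.
    by rewrite mulKmx.
  rewrite /flow.
  rewrite !trmx_mul trmxK /x ![(exp_diag _)^T]tr_diag_mx !mulmxA.
  have -> : a1 *m exp_diag (fun i => t / 2%:R * K i) *m diag_mx (\row_i expR (- (t / 2%:R * K i))) = a1.
    rewrite -mulmxA /exp_diag mulmx_diag (_ : diag_mx _ = 1%:M) ?mulmx1 //.
    by apply/matrixP => i l; rewrite !mxE -expRD subrr expR0.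
  rewrite mulmxV // mul1mx /x' -mulmxA; congr (_ *m _); rewrite mulmx_diag; congr diag_mx.
  by apply/rowP => i; rewrite !mxE -expRD; congr expR; field.
have lim1 : mlim (pinfty_nbhs R) (fun t => (invmx (x t) *m x' t) *m (invmx (x t) *m x' t)^T) 1%:M.
  have lz : mlim (pinfty_nbhs R)
      (fun t => exp_diag (fun i => beta / 2%:R * K i) *m flow K y (t / 2%:R)) z.
    apply: mlimM; first exact: mlim_cst.
    move=> i l; apply: (@cvg_comp _ _ _ (fun t : R => t / 2%:R)
      (fun t => flow K y t i l) _ (pinfty_nbhs R)).
      by apply: (gt0_cvgMly (M := 2%:R^-1)); [rewrite invr_gt0 ltr0n|exact: cvg_id].
    exact: (flow_cvg (block_triangular domK uy Fy)).
  have lzz : mlim (pinfty_nbhs R) (fun t =>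
      (exp_diag (fun i => beta / 2%:R * K i) *m flow K y (t / 2%:R))^T *m
      (exp_diag (fun i => beta / 2%:R * K i) *m flow K y (t / 2%:R))) (z^T *m z).
    by apply: (mlimM (F := pinfty_nbhs R)) => //; apply: (mlim_tr (F := pinfty_nbhs R)).
  rewrite -zz; apply: (mlim_near (F := pinfty_nbhs R)) lzz.
  by apply: nearW => t; rewrite xx' trmxK.
have SA d (d0 : 0 < d) : \forall t \near +oo, near_le d (x t *m (x t)^T) (x' t *m (x' t)^T).
  by apply: gram_cvg_near_le.
have K0 : (forall i, k1 i = 0) <-> (forall i, k2 i = 0).
  split=> h i; have := Kr i; rewrite h ?mulr0 => /eqP; first by rewrite intr_eq0 => /eqP.
  by rewrite eq_sym mulf_eq0 gt_eqF //= intr_eq0 => /eqP.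
case: H1 => [[h1 ->]|[h1 ->]]; case: H2 => [[h2 ->]|[h2 ->]].
(* With zero exponents there is a single block, and the Gram identity for z says that a1^-1 a2 is
   orthogonal. *)
- have e0 t : exp_diag (fun i => t * K i) = 1%:M.
    by apply/matrixP => i l; rewrite !mxE /K h1 mulr0 expR0.
  have bp : block_part K y = y by apply/matrixP => i l; rewrite mxE /K !h1 eqxx.
  move: zz; rewrite /z e0 mul1mx bp /y trmxK trmx_mul => e.
  congr Interior; have : a1 *m (invmx a1 *m a2 *m (a2^T *m (invmx a1)^T)) *m a1^T = a1 *m a1^T.
    by rewrite e mulmx1.
  by rewrite !mulmxA mulmxV // mul1mx -!mulmxA -trmx_mul mulmxV // trmx1 mulmx1.
- by case: h2; apply/K0.
- by case: h1; apply/K0.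
congr Boundary.
apply/(null_pencil_eqP u1 u2 (int_row_neq0 R h1) (int_row_neq0 R h2)).
(* Because k2 = r k1, the second geodesic at time (t + beta) / r has exponents (t + beta) k1. *)
exists r^-1, (beta / r); split; first by rewrite invr_gt0.
have curveE (a : 'M[R]_n) (s : 'I_n -> R) : a *m diag_mx (\row_i expR (s i)) *m a^T =
    (a *m exp_diag (fun i => s i / 2%:R)) *m (a *m exp_diag (fun i => s i / 2%:R))^T.
  rewrite trmx_mul tr_diag_mx !mulmxA; congr (_ *m _); rewrite -mulmxA mulmx_diag.
  by congr (_ *m diag_mx _); apply/rowP => i; rewrite !mxE -expRD; congr expR; field.
move=> d d0; apply: filterS (SA d d0) => t; rewrite /geodesic_curve !curveE.
have e (f f' : 'I_n -> R) : f =1 f' -> exp_diag f = exp_diag f' by move=> /funext ->.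
rewrite (e _ (fun i => t / 2%:R * K i)) => [|i]; last by rewrite mxE -/(K i); field.
rewrite (e (fun i => int_row R k2 0 i * (r^-1 * t + beta / r) / 2%:R)
  (fun i => (t + beta) / 2%:R * K i)) // => i.
by rewrite mxE Kr -/(K i); field; rewrite gt_eqF.
Qed.

End PartC.

Theorem theorem8p3 (R : realType) (n : nat) (hn : (0 < n)%N) :
  (* (a) *)
  (forall (p : nat) (theta : 'I_p -> spherical_irrep R n), (0 < p)%N ->
     forall A, compactification theta A ->
       exists X, meromorphic_curve X /\ proj_limit theta X A) /\
  (* (b) *)
  (forall X1 X2 : R -> 'M[R]_n, meromorphic_curve X1 -> meromorphic_curve X2 ->
     forall P, sea_limit X1 P -> sea_limit X2 P ->
     forall (p : nat) (theta : 'I_p -> spherical_irrep R n), (0 < p)%N ->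
       exists A, proj_limit theta X1 A /\ proj_limit theta X2 A) /\
  (* (c) *)
  (forall X1 X2 : R -> 'M[R]_n, meromorphic_curve X1 -> meromorphic_curve X2 ->
     forall P1 P2, sea_limit X1 P1 -> sea_limit X2 P2 -> P1 <> P2 ->
     exists (p : nat) (theta : 'I_p -> spherical_irrep R n), (0 < p)%N /\
       exists A1 A2,
         [/\ proj_limit theta X1 A1, proj_limit theta X2 A2 & A1 <> A2]).
Proof.
split=> [p theta p0 A|]; first exact: compactification_curve.
split=> [X1 X2 _ _ P s1 s2 p theta p0|X1 X2 _ _ P1 P2 s1 s2 ne].
  exact: sea_limit_proj_limit s1 s2.
(* Contraposition: if no compactification separates the curves, their limits agree in all of
   them. *)
apply: contrapT => h; apply: ne; apply: (proj_limits_sea_limit s1 s2).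
move=> p theta p0 A1 A2 L1 L2; apply: contrapT => ne; apply: h.
by exists p, theta; split=> //; exists A1, A2.
Qed.
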